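(* For every integer $r\ge2$ and every $\xi\in(0,1)$ there are constants $c,C>0$, depending only on $r$ and $\xi$, such that the following holds for all integers $n\ge1$, all $p\in(0,1-\xi]$ and all real $t$. Let $X=X_{r,n,p}$ be the number of copies of $K_{1,r}$ in $G_{n,p}$, let $\mu:=\mathbb{E}X$, $\sigma^2:=\operatorname{Var}X$ with $\sigma\ge0$, and suppose $1\le\mu+t\le X_{r,n,1}$. For $t>0$ put $M(t):=\max\{t^{1/r},\ t/n^{r-1}\}$. (i) If $p\ge(\log n)/n$ and $t\ge\sigma$, then $$c\,\Psi(t)\le-\log\mathbb{P}(X\ge\mu+t)\le C\,\Psi(t),\qquad\text{where}\quad \Psi(t):=\min\bigl\{t^2/\sigma^2,\ M(t)\log(e/p)\bigr\}.$$ (ii) If $\mu\ge\xi$ and $t>0$ satisfies $t^2/\sigma^2\ge M(t)\log(e/p)\cdot(\log n)^{2r}$, then $$c\,M(t)\log(e/p)\le-\log\mathbb{P}(X\ge\mu+t)\le C\,M(t)\log(e/p).$$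
   Context: $G_{n,p}$ is the binomial random graph on the vertex set $\{1,\dots,n\}$, in which each of the $\binom n2$ possible edges is present independently with probability $p$. $K_{1,r}$ is the star with $r$ edges. A copy of $K_{1,r}$ in a graph is a (not necessarily induced) subgraph isomorphic to $K_{1,r}$. $X_{r,n,1}$ is the (deterministic) number of copies of $K_{1,r}$ in the complete graph $K_n$, i.e. $n\binom{n-1}{r}$ for $r\ge2$. $\log$ is the natural logarithm. (The hypothesis $1\le\mu+t\le X_{r,n,1}$ forces $n\ge r+1$, so $\sigma>0$.) *)

(* Defs.v *)
From HB Require Import structures.
From mathcomp Require Import all_boot all_order all_algebra.
From mathcomp Require Import all_classical all_reals all_analysis.

Set Implicit Arguments.
Unset Strict Implicit.
Unset Printing Implicit Defensive.

Import Order.TTheory GRing.Theory Num.Theory.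

Local Open Scope ring_scope.

Definition complete_edges (V : finType) : {set {set V}} :=
  [set e : {set V} | #|e| == 2%N]%SET.

(* Simple graphs with vertex set the whole of [V]. *)
Record sgraph (V : finType) := SGraph {
  edges : {set {set V}};
  edges_complete : edges \subset complete_edges V }.

HB.instance Definition _ (V : finType) := [isSub for @edges V].
HB.instance Definition _ (V : finType) := [Finite of sgraph V by <:].

Definition complete_graph (V : finType) : sgraph V :=
  SGraph (subxx (complete_edges V)).

(* [None] is the centre, the [Some i] are the leaves. *)
Definition star_edges (r : nat) : {set {set option 'I_r}} :=
  [set [set None; Some i] | i : 'I_r]%SET.

Lemma star_edges_complete (r : nat) :
  star_edges r \subset complete_edges (option 'I_r).
Proof. by apply/fintype.subsetP => _ /imsetP[i _ ->]; rewrite inE cards2. Qed.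

Definition star (r : nat) : sgraph (option 'I_r) :=
  SGraph (star_edges_complete r).

(* The copies of [H] in [G]: a subgraph is a pair of a vertex set and an edge
   set, and it is isomorphic to [H] when it is the image of [H] under an
   injective map of the vertices. *)
Definition copies (W V : finType) (H : sgraph W) (G : sgraph V) :
    {set {set V} * {set {set V}}} :=
  [set S : {set V} * {set {set V}} |
    (S.2 \subset edges G) &&
    [exists f : {ffun W -> V}, [&& injectiveb f,
      S.1 == (f @: [set: W])%SET &
      S.2 == [set (f @: e)%SET | e : {set W} in edges H]%SET]]]%SET.

Section Gnp.
Context {R : realType}.

(* The law of the random graph on [V] in which each possible edge is present
   independently with probability [p]. *)
Definition gnp (V : finType) (p : R) (G : sgraph V) : R :=
  \prod_(e in complete_edges V) bernoulli_pmf p (e \in edges G).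

Definition gnp_pr (V : finType) (p : R) (A : pred (sgraph V)) : R :=
  \sum_(G | A G) gnp p G.

Definition gnp_mean (V : finType) (p : R) (X : sgraph V -> R) : R :=
  \sum_G gnp p G * X G.

Definition gnp_var (V : finType) (p : R) (X : sgraph V -> R) : R :=
  gnp_mean p (fun G => (X G - gnp_mean p X) ^+ 2).

Definition star_count (r n : nat) (G : sgraph 'I_n) : R :=
  #|copies (star r) G|%:R.

End Gnp.

(* Main.v *)
(** The number of stars is X = sum_v C(d_v, r), with d_v the degree of v.

    Upper bound on the tail. Truncate the degrees at a level D which is a large
    constant times np (or log n, or 1, when p is small). A star of the truncated
    count shares an edge with at most 2 r D^(r-1) others, so a large truncated
    count produces many m-tuples of edge-disjoint stars, whose expected number
    is at most mu^m; taking m of order t / D^(r-1) bounds the probability of an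
    excess t/2 by exp(-c t^2 / (D^(r-1) (mu + t))). The rest of X is at most
    sum_{d > D} N_d C(d-1, r-1), with N_d the number of vertices of degree at
    least d, and the exponential moment of the total degree of a fixed set of k
    vertices gives P(N_d >= k) <= n^k exp(-kd (log(d/np)/2 - 1)). Thresholds for
    N_d proportional to d^(1/2-r) make every level cost M(t) log(e/p).

    Lower bound on the tail. Planting k vertices of degree D costs p^(kD) and
    loses only the deviations controlled by Chebyshev and Markov; this gives the
    rate M(t) log(e/p). For t = O(mu), raising p to p(1 + K t/mu) moves the mean
    beyond mu + t, and Cauchy-Schwarz for the likelihood ratio gives the rate
    t^2/sigma^2. *)

Require Import Defs.
From mathcomp Require Import all_boot all_order all_algebra.
From mathcomp Require Import all_classical all_reals all_analysis.
From mathcomp Require Import zify ring lra.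
From mathcomp Require Import fintype finset.

Set Implicit Arguments.
Unset Strict Implicit.
Unset Printing Implicit Defensive.

Import Order.TTheory GRing.Theory Num.Theory.
Local Open Scope set_scope.
Local Open Scope ring_scope.

(** * Random subsets *)

Section RandomSubset.
Context {R : realFieldType} {T : finType}.
Implicit Types (q : T -> R) (A F : {set T}) (f g : {set T} -> R).

(** The upper bound must reach the scale where log (e/p), not log (d/np), is the price of an edge,
    without losing a logarithm. The exponent 1/2 - r of the thresholds settles both points. The
    contributions of the levels d <= m = min{t^(1/r), n} become proportional to d^(-1/2) and sum to
    order m^(1/2), so adding them up costs no logarithm. The cost of level d keeps a spare factor of
    at least (m/d)^(1/2), which turns log (d/np) into log (m/np), and this is of order log (e/p)
    once t^2 is at least of order n (np)^(2r-1). Two exponentials come out of the split; their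
    factor 2 is worthless where the exponent is bounded, and there Cantelli's inequality takes over
    with a bound strictly below 1. In the bulk, D of order np gives t^2/sigma^2 up to the mean and
    t/(np)^(r-1) beyond it, which already dominates M(t) log (e/p). For np below log n the union
    bound over vertices forces D above the order np, and the power of log n in (ii) helps to pay for
    D^(r-1). *)

Definition weight q A : R := \prod_e (if e \in A then q e else 1 - q e).

Definition expect q f : R := \sum_A weight q A * f A.

Lemma sum_prod_split (a b : T -> R) :
  \sum_(A : {set T}) \prod_e (if e \in A then a e else b e) =
  \prod_e (a e + b e).
Proof. by rewrite bigA_distr. Qed.

Lemma weight_ge0 q A : (forall e, 0 <= q e <= 1) -> 0 <= weight q A.
Proof.
move=> q01; apply: prodr_ge0 => e _; have /andP[? ?] := q01 e.
by case: ifP; rewrite ?subr_ge0.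
Qed.

Lemma expect_cst q c : expect q (fun=> c) = c.
Proof.
rewrite /expect -mulr_suml sum_prod_split big1 ?mul1r// => e _.
by rewrite addrC subrK.
Qed.

Lemma expectD q f g : expect q (fun A => f A + g A) = expect q f + expect q g.
Proof. by rewrite /expect -big_split/=; apply: eq_bigr => A _; rewrite mulrDr. Qed.

Lemma expectZ q c f : expect q (fun A => c * f A) = c * expect q f.
Proof. by rewrite /expect mulr_sumr; apply: eq_bigr => A _; rewrite mulrCA. Qed.

Lemma expectN q f : expect q (fun A => - f A) = - expect q f.
Proof. by rewrite /expect -sumrN; apply: eq_bigr => A _; rewrite mulrN. Qed.

Lemma expectB q f g : expect q (fun A => f A - g A) = expect q f - expect q g.
Proof. by rewrite expectD expectN. Qed.

Lemma expect_sum q (I : finType) (P : pred I) (f : I -> {set T} -> R) :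
  expect q (fun A => \sum_(i | P i) f i A) = \sum_(i | P i) expect q (f i).
Proof.
rewrite /expect exchange_big/=; apply: eq_bigr => A _.
by rewrite mulr_sumr.
Qed.

Lemma eq_expect q f g : f =1 g -> expect q f = expect q g.
Proof. by move=> fg; apply: eq_bigr => A _; rewrite fg. Qed.

Lemma ler_expect q f g : (forall e, 0 <= q e <= 1) ->
  (forall A, f A <= g A) -> expect q f <= expect q g.
Proof.
by move=> q01 fg; apply: ler_sum => A _; apply: ler_wpM2l; rewrite ?weight_ge0.
Qed.

Lemma expect_ge0 q f : (forall e, 0 <= q e <= 1) ->
  (forall A, 0 <= f A) -> 0 <= expect q f.
Proof. by move=> q01 f0; rewrite -(expect_cst q 0) ler_expect. Qed.

Lemma expect_prod q (x : T -> R) :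
  expect q (fun A => \prod_(e in A) x e) = \prod_e (1 + q e * (x e - 1)).
Proof.
rewrite (eq_bigr (fun e => q e * x e + (1 - q e))); last by move=> e _; ring.
rewrite -sum_prod_split; apply: eq_bigr => A _.
rewrite /weight [X in _ * X]big_mkcond -big_split/=; apply: eq_bigr => e _.
by case: ifP; rewrite ?mulr1.
Qed.

Lemma weight_setU1 q e A : e \notin A ->
  weight q (e |: A) * (1 - q e) = weight q A * q e.
Proof.
move=> eA; rewrite /weight (bigD1 e)//= [in RHS](bigD1 e)//= setU11 (negPf eA).
rewrite mulrAC [RHS]mulrAC [q e * _]mulrC; congr (_ * _).
by apply: eq_bigr => e' ne; rewrite in_setU1 (negPf ne).
Qed.

Lemma expect_mem q e f :
  expect q (fun A => (e \in A)%:R * f A) = q e * expect q (fun A => f (e |: A)).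
Proof.
have split g : expect q g = \sum_(A : {set T} | e \notin A)
    (weight q A * g A + weight q (e |: A) * g (e |: A)).
  rewrite /expect (bigID (fun A : {set T} => e \notin A))/= big_split/=.
  congr (_ + _).
  rewrite (reindex_onto (fun A => e |: A) (fun A => A :\ e))/=; last first.
    by move=> A /negPn eA; rewrite setD1K.
  apply: eq_bigl => A; rewrite setU11/=.
  by apply/eqP/idP => [<-|eA]; [rewrite setD11|rewrite setU1K].
rewrite !split mulr_sumr; apply: eq_bigr => A eA.
rewrite (negPf eA) setU11 setUA setUid mul0r mulr0 add0r mul1r -mulrDl mulrA.
congr (_ * _); rewrite mulrDr [q e * weight q A]mulrC -(weight_setU1 _ eA).
by ring.
Qed.

(** Given that [F] is contained in [A], the other elements remain independent, so [A] is distributed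
    as [F :|: A]. Both the second moment of the star count and planting rest on this identity. *)
Lemma expect_subset q F f :
  expect q (fun A => (F \subset A)%:R * f A) =
  (\prod_(e in F) q e) * expect q (fun A => f (F :|: A)).
Proof.
have [k] := ubnP #|F|; elim: k F f => // k IH F f /ltnSE leFk.
have [->|[e eF]] := set_0Vmem F.
  rewrite big_set0 mul1r; apply: eq_expect => A.
  by rewrite sub0set mul1r set0U.
have ltF : (#|F :\ e| < k)%N by move: leFk; rewrite (cardsD1 e) eF.
rewrite (big_setD1 e)//= -mulrA.
transitivity (expect q (fun A => (e \in A)%:R * ((F :\ e \subset A)%:R * f A))).
  by apply: eq_expect => A; rewrite -{1}(setD1K eF) subUset sub1set -mulnb natrM mulrA.
rewrite expect_mem; congr (_ * _).
transitivity (expect q (fun A => (F :\ e \subset A)%:R * f (e |: A))).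
  apply: eq_expect => A; congr ((nat_of_bool _)%:R * _); apply/idP/idP => [/fintype.subsetP sF|sF].
    apply/fintype.subsetP => x xF; move: (sF x xF); rewrite in_setU1.
    by case/orP => // /eqP xe; move: xF; rewrite xe setD11.
  exact: subset_trans sF (subsetUr _ _).
rewrite (IH _ (fun A => f (e |: A)))//; congr (_ * _); apply: eq_expect => A.
by rewrite setUA setD1K.
Qed.

Lemma expect_contains q F :
  expect q (fun A => (F \subset A)%:R) = \prod_(e in F) q e.
Proof.
have := expect_subset q F (fun=> 1); rewrite expect_cst mulr1 => <-.
by apply: eq_expect => A; rewrite mulr1.
Qed.

End RandomSubset.

Section Probability.
Context {R : realFieldType} {T : finType}.
Implicit Types (q : T -> R) (A F : {set T}) (f g : {set T} -> R).
Implicit Types P : pred {set T}.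

Definition prob q P : R := expect q (fun A => (P A)%:R).

Lemma le_prob q P P' : (forall e, 0 <= q e <= 1) ->
  (forall A, P A -> P' A) -> prob q P <= prob q P'.
Proof.
move=> q01 PP'; apply: ler_expect => // A; rewrite ler_nat.
by case: (boolP (P A)) => // /PP' ->.
Qed.

Lemma prob_ge0 q P : (forall e, 0 <= q e <= 1) -> 0 <= prob q P.
Proof. by move=> q01; apply: expect_ge0 => // A; rewrite ler0n. Qed.

Lemma probC q P : prob q (predC P) = 1 - prob q P.
Proof.
rewrite -(expect_cst q 1) -expectB; apply: eq_expect => A /=.
by case: (P A); rewrite ?subrr ?subr0.
Qed.

Lemma prob_union q P (I : finType) (P' : I -> pred {set T}) :
  (forall e, 0 <= q e <= 1) -> (forall A, P A -> exists i, P' i A) ->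
  prob q P <= \sum_i prob q (P' i).
Proof.
move=> q01 PP'; rewrite -expect_sum; apply: ler_expect => // A /=.
rewrite -natr_sum ler_nat; case: (boolP (P A)) => // /PP'[i Pi].
by rewrite (bigD1 i)//= Pi.
Qed.

Lemma prob_union2 q P P1 P2 : (forall e, 0 <= q e <= 1) ->
  (forall A, P A -> P1 A || P2 A) -> prob q P <= prob q P1 + prob q P2.
Proof.
move=> q01 PP; rewrite -expectD; apply: ler_expect => // A /=.
rewrite -natrD ler_nat; case: (boolP (P A)) => // /PP.
by case: (P1 A); case: (P2 A).
Qed.

Lemma markov_ineq q f a : (forall e, 0 <= q e <= 1) -> (forall A, 0 <= f A) ->
  prob q (fun A => a <= f A) * a <= expect q f.
Proof.
move=> q01 f0; rewrite mulrC -expectZ; apply: ler_expect => // A /=.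
by case: (lerP a (f A)) => ?; rewrite ?mulr1 ?mulr0.
Qed.

Definition expect_variance q f : R := expect q (fun A => (f A - expect q f) ^+ 2).

Lemma expect_variance_ge0 q f : (forall e, 0 <= q e <= 1) -> 0 <= expect_variance q f.
Proof. by move=> q01; apply: expect_ge0 => // A; rewrite sqr_ge0. Qed.

Lemma expect_varianceE q f :
  expect_variance q f = expect q (fun A => f A * f A) - expect q f ^+ 2.
Proof.
rewrite /expect_variance; set mu := expect q f.
rewrite (@eq_expect _ _ q _ (fun A => f A * f A - 2 * mu * f A + mu ^+ 2)); last first.
  by move=> A; ring.
by rewrite expectD expectB expectZ expect_cst -/mu; ring.
Qed.

Lemma chebyshev_below q f s : (forall e, 0 <= q e <= 1) -> 0 <= s ->
  prob q (fun A => f A <= expect q f - s) * s ^+ 2 <= expect_variance q f.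
Proof.
move=> q01 s0; rewrite mulrC -expectZ; apply: ler_expect => // A /=.
case: (lerP (f A)) => fs; rewrite ?mulr1 ?mulr0 ?sqr_ge0//.
by rewrite -(sqrrN (f A - _)) lerXn2r ?nnegrE//; lra.
Qed.

Lemma cantelli_above q f t : (forall e, 0 <= q e <= 1) -> 0 < t ->
  prob q (fun A => expect q f + t <= f A) * (expect_variance q f + t ^+ 2) <= expect_variance q f.
Proof.
move=> q01 t0; set v := expect_variance q f; set mu := expect q f.
have v0 : 0 <= v by exact: expect_variance_ge0.
(* The shift u = v / t minimises (v + u^2) / (t + u)^2, whose value is then v / (v + t^2). *)
set u := v / t; have u0 : 0 <= u by rewrite divr_ge0// ltW.
have vE : v = u * t by rewrite divfK// gt_eqF.
have : prob q (fun A => mu + t <= f A) * (t + u) ^+ 2 <= v + u ^+ 2.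
  have <- : expect q (fun A => (f A - mu + u) ^+ 2) = v + u ^+ 2.
    rewrite (@eq_expect _ _ q _ (fun A => ((f A - mu) ^+ 2 + 2 * u * (f A - mu)) + u ^+ 2)).
      rewrite expectD expectD expectZ expectB !expect_cst -/mu subrr mulr0 addr0.
      by [].
    by move=> A; ring.
  rewrite mulrC -expectZ; apply: ler_expect => // A /=.
  case: (lerP (mu + t)) => fs; rewrite ?mulr1 ?mulr0 ?sqr_ge0//.
  by rewrite lerXn2r ?nnegrE//; lra.
set P := prob _ _; rewrite vE => H.
have tu : 0 < t + u by lra.
rewrite -(ler_pM2r tu); have -> : P * (u * t + t ^+ 2) * (t + u) = t * (P * (t + u) ^+ 2) by ring.
by apply: (le_trans (ler_wpM2l (ltW t0) H)); rewrite le_eqVlt; apply/orP; left; apply/eqP; ring.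
Qed.

(** Cauchy-Schwarz for the likelihood ratio: the product is its second moment under [q], which
    factorises over the elements. Where [q] is degenerate, [q'] agrees with it and the factor is 1
    because 0 / 0 = 0. *)
Lemma change_of_measure q q' P :
  (forall e, 0 <= q e <= 1) -> (forall e, 0 <= q' e <= 1) ->
  (forall e, q' e = q e \/ 0 < q e < 1) ->
  prob q' P ^+ 2 <=
  prob q P * \prod_e (1 + (q' e - q e) ^+ 2 / (q e * (1 - q e))).
Proof.
move=> q01 q'01 qq'; set Q := \prod_e _; set a := prob q' P.
(* Absolute continuity: dividing by [weight q A] is harmless, since [weight q' A] vanishes wherever
   that weight does. *)
have ratio A : weight q' A = 0 \/ 0 < weight q A.
  have [/prodf_neq0 w0|/negbNE/prodf_eq0[e _ e0]] :=
      boolP (\prod_e (if e \in A then q' e else 1 - q' e) != 0); last first.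
    by left; apply/eqP/prodf_eq0; exists e.
  right; apply: prodr_gt0 => e _; have := w0 e isT; have := q01 e.
  by case: (qq' e) => [->|]; case: ifP => _; lra.
have QE : Q = expect q (fun A => (weight q' A / weight q A) ^+ 2).
  have -> : Q = \prod_e (q' e ^+ 2 / q e + (1 - q' e) ^+ 2 / (1 - q e)).
    apply: eq_bigr => e _; have := q01 e.
    case: (qq' e) => [->|/andP[q0 q1] _].
      move=> _; rewrite subrr expr0n mul0r addr0.
      have [->|q0] := eqVneq (q e) 0; first by rewrite subr0 expr0n mul0r add0r expr1n divr1.
      have [->|q1] := eqVneq (q e) 1; first by rewrite subrr expr0n mul0r addr0 expr1n divr1.
      have nq1 : 1 - q e != 0 by rewrite subr_eq0 eq_sym.
      by field; apply/andP.
    have nq1 : 1 - q e != 0 by rewrite subr_eq0 gt_eqF.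
    have nq0 : q e != 0 by rewrite gt_eqF.
    by field; apply/andP.
  rewrite -sum_prod_split; apply: eq_bigr => A _.
  transitivity (weight q' A ^+ 2 / weight q A).
    rewrite /weight -prodrXl -prodf_div; apply: eq_bigr => e _.
    by case: ifP.
  have [w'0|/lt0r_neq0 w0] := ratio A; last by field.
  by rewrite w'0 mul0r expr0n mul0r mulr0.
have Q1 : 1 <= Q.
  have -> : 1 = \prod_(e : T) 1 :> R by rewrite big1.
  apply: ler_prod => e _; rewrite ler01/= lerDl.
  by have := q01 e => /andP[? ?]; rewrite divr_ge0 ?sqr_ge0 ?mulr_ge0// subr_ge0.
have aE : a = expect q (fun A => (P A)%:R * (weight q' A / weight q A)).
  apply: eq_bigr => A _; rewrite mulrCA [RHS]mulrC; congr (_ * _).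
  by have [->|/lt0r_neq0 w0] := ratio A; [rewrite mul0r mulr0|field].
(* Expanding this square gives Q (Q [prob q P] - a^2), and Q >= 1 can be cancelled. *)
have : 0 <= expect q (fun A => (Q * (P A)%:R - a * (weight q' A / weight q A)) ^+ 2).
  by apply: expect_ge0 => // A; exact: sqr_ge0.
rewrite (@eq_expect _ _ q _ (fun A => Q ^+ 2 * (P A)%:R
   - 2 * Q * a * ((P A)%:R * (weight q' A / weight q A))
   + a ^+ 2 * (weight q' A / weight q A) ^+ 2)); last first.
  by move=> A; case: (P A) => /=; ring.
rewrite expectD expectB !expectZ -aE -QE -/(prob q P).
have -> : Q ^+ 2 * prob q P - 2 * Q * a * a + a ^+ 2 * Q = Q * (prob q P * Q - a ^+ 2) by ring.
by rewrite pmulr_rge0 ?subr_ge0//; lra.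
Qed.

End Probability.

(** * Families with few intersections *)

Section DisjointFamilies.
Context {R : realFieldType} {T I : finType} (Q : pred I) (S : I -> {set T}).
Implicit Types (q : T -> R) (A F : {set T}).

(** Counts the ordered [m]-tuples of members inside [A] that are pairwise disjoint and disjoint from
    [F]; [F] accumulates what has been used. *)
Fixpoint disjoint_tuples (m : nat) (A F : {set T}) : nat :=
  if m is m'.+1 then
    \sum_(i | (S i \subset A) && (Q i && [disjoint S i & F]))
       disjoint_tuples m' A (F :|: S i)
  else 1%N.

(** For disjoint sets the probabilities of containment multiply; forgetting the disjointness
    constraint afterwards only enlarges the sum. *)
Lemma expect_disjoint_tuples q m F : (forall e, 0 <= q e <= 1) ->
  expect q (fun A => (F \subset A)%:R * (disjoint_tuples m A F)%:R) <=
  (\prod_(e in F) q e) * (\sum_(i | Q i) \prod_(e in S i) q e) ^+ m.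
Proof.
move=> q01; have prod0 F' : 0 <= \prod_(e in F') q e.
  by apply: prodr_ge0 => e _; case/andP: (q01 e).
elim: m F => [|m IH] F /=.
  by rewrite expect_subset expect_cst expr0.
rewrite (@eq_expect _ _ q _ (fun A => \sum_(i | Q i && [disjoint S i & F])
   (F :|: S i \subset A)%:R * (disjoint_tuples m A (F :|: S i))%:R)); last first.
  move=> A; rewrite natr_sum big_mkcondl mulr_sumr/=; apply: eq_bigr => i _.
  by rewrite subUset; case: (S i \subset A); case: (F \subset A); rewrite /= ?mulr0 ?mul0r.
rewrite expect_sum exprS mulrA mulr_sumr mulr_suml.
rewrite [leLHS]big_mkcond [leRHS]big_mkcond; apply: ler_sum => i _.
case: (Q i) => //=; case: ifP => [dis|_]; last first.
  by rewrite !mulr_ge0 ?exprn_ge0//; apply: sumr_ge0 => *.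
apply: (le_trans (IH _)); rewrite ler_wpM2r//.
  by rewrite exprn_ge0//; apply: sumr_ge0 => *.
rewrite [X in X <= _](_ : _ = \prod_(e in F) q e * \prod_(e in S i) q e)//.
rewrite -bigU/= 1?disjoint_sym//; apply: eq_bigl => e; by rewrite !inE.
Qed.

(** Greedy choice: [j] counts the members chosen so far, each of which spoils at most [C] members of
    [J]. When the last member is chosen at most j + m - 1 blocks of size [C] are spoiled, so at
    least [a] candidates remain at every step. *)
Lemma disjoint_tuples_ge (J : {set I}) A (C : nat) (a : R) m j F :
  0 <= a -> (forall i, i \in J -> Q i && (S i \subset A)) ->
  (forall i, i \in J -> #|[set k in J | ~~ [disjoint S k & S i]]| <= C)%N ->
  (#|[set k in J | ~~ [disjoint S k & F]]| <= j * C)%N ->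
  a + ((j + m.-1) * C)%:R <= #|J|%:R ->
  a ^+ m <= (disjoint_tuples m A F)%:R.
Proof.
move=> a0 JA JC; elim: m j F => [|m IH] j F FC aJ; first by rewrite expr0.
rewrite /= natr_sum exprS.
pose J' := [set k in J | [disjoint S k & F]].
have cJ' : a <= #|J'|%:R.
  have cJ : #|J| = (#|J'| + #|[set k in J | ~~ [disjoint S k & F]]|)%N.
    rewrite -(cardsID [set k | [disjoint S k & F]] J); congr (_ + _)%N; apply: eq_card => k.
      by rewrite !inE.
    by rewrite !inE andbC.
  move: aJ; rewrite cJ natrD /= => aJ.
  have : (#|[set k in J | ~~ [disjoint S k & F]]|)%:R <= ((j + m) * C)%:R :> R.
    by rewrite ler_nat (leq_trans FC)// leq_mul2r leq_addr orbT.
  lra.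
apply: (@le_trans _ _ (\sum_(i in J') a ^+ m)).
  by rewrite sumr_const -[leRHS]mulr_natl ler_wpM2r// exprn_ge0.
rewrite [leRHS]big_mkcond [leLHS]big_mkcond; apply: ler_sum => i _.
rewrite inE; case: (boolP (i \in J)) => //= iJ; last by case: ifP.
have /andP[-> ->] /= := JA i iJ; case: ifP => // dis.
case: m IH aJ => [|m] IH aJ; first by rewrite expr0.
apply: (IH j.+1); last by move: aJ => /=; rewrite addSnnS.
rewrite mulSn addnC; apply: leq_trans (leq_add FC (JC i iJ)).
rewrite -cardsUI; apply: leq_trans (leq_addr _ _); apply: subset_leq_card.
apply/fintype.subsetP => k; rewrite !inE => /andP[-> ] /=.
by rewrite -!setI_eq0 setIUr setU_eq0 negb_and.
Qed.

(* If the family contained in [A] is large but each member meets few others,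
   many [m]-tuples of disjoint members can be chosen greedily, whereas their
   expected number is at most the [m]-th power of the mean. *)
Lemma prob_large_family q (P : pred {set T}) (C m : nat) (a b : R) :
  (forall e, 0 <= q e <= 1) -> 0 <= a ->
  (forall A, P A -> exists J : {set I},
     [/\ forall i, i \in J -> Q i && (S i \subset A),
         forall i, i \in J -> (#|[set k in J | ~~ [disjoint S k & S i]]| <= C)%N
       & b <= #|J|%:R]) ->
  a + (m.-1 * C)%:R <= b ->
  prob q P * a ^+ m <= (\sum_(i | Q i) \prod_(e in S i) q e) ^+ m.
Proof.
move=> q01 a0 PJ ab.
have := @expect_disjoint_tuples q m finset.set0 q01.
rewrite big_set0 mul1r; apply: le_trans.
rewrite mulrC -expectZ; apply: ler_expect => // A.
rewrite sub0set mul1r; case: (boolP (P A)) => [/PJ[J [JA JC bJ]]|_]; last by rewrite mulr0.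
rewrite mulr1; apply: (@disjoint_tuples_ge J A C a m 0) => //.
  rewrite mul0n leqn0 cards_eq0; apply/eqP/setP => k.
  by rewrite !inE -setI_eq0 setI0 eqxx andbF.
by rewrite add0n (le_trans ab).
Qed.

End DisjointFamilies.

(** * Stars and degrees *)

Section Stars.
Context {V : finType}.
Implicit Types (G : {set {set V}}) (v u : V) (s : V * {set V}) (r : nat).

Definition star_at s : {set {set V}} := [set [set s.1; a] | a in s.2].

Definition is_star r s := (s.1 \notin s.2) && (#|s.2| == r).

Definition nbh G v : {set V} := [set u | (u != v) && ([set v; u] \in G)].

Definition deg G v := #|nbh G v|.

Definition num_stars r G : nat := (\sum_v 'C(deg G v, r))%N.

Lemma set2_inj v : injective (fun a => [set v; a]).
Proof.
move=> a b /setP E; have := E a; have := E b; rewrite !inE !eqxx !orbT.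
case: (eqVneq a v) => [->|] /=; first by case: (eqVneq b v) => [->|] //=; rewrite eq_sym => /negPf ->.
by move=> _ _ /esym/eqP.
Qed.

Lemma star_at_subset s G : s.1 \notin s.2 ->
  (star_at s \subset G) = (s.2 \subset nbh G s.1).
Proof.
move=> vA; apply/fintype.subsetP/fintype.subsetP => [sG a aA|sN _ /imsetP[a aA ->]].
  rewrite inE (sG _ (imset_f _ aA)) andbT.
  by apply: contraNneq vA => <-.
by have := sN a aA; rewrite inE => /andP[].
Qed.

Lemma star_at_complete s : s.1 \notin s.2 -> star_at s \subset complete_edges V.
Proof.
move=> vA; apply/fintype.subsetP => _ /imsetP[a aA ->]; rewrite inE cards2.
by have -> : s.1 != a by apply: contraNneq vA => ->.
Qed.

Lemma card_star_at s : #|star_at s| = #|s.2|.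
Proof. by rewrite card_imset//; exact: set2_inj. Qed.

Lemma nbh_subset G G' v : G \subset G' -> nbh G v \subset nbh G' v.
Proof.
move=> GG'; apply/fintype.subsetP => u; rewrite !inE => /andP[->] /=.
exact: (fintype.subsetP GG').
Qed.

Lemma nbhU G G' v : nbh (G :|: G') v = nbh G v :|: nbh G' v.
Proof. by apply/setP => u; rewrite !inE; case: (u != v). Qed.

Lemma deg_le G v : (deg G v <= #|V|.-1)%N.
Proof.
have -> : #|V|.-1 = #|[set~ v]| by rewrite cardsC1.
by apply: subset_leq_card; apply/fintype.subsetP => u; rewrite !inE => /andP[].
Qed.

Lemma num_stars_mono r G G' : G \subset G' -> (num_stars r G <= num_stars r G')%N.
Proof.
move=> GG'; apply: leq_sum => v _; apply: leq_bin2l.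
exact/subset_leq_card/nbh_subset.
Qed.

Lemma sum_stars_at r v (F : V * {set V} -> nat) :
  (\sum_(s | is_star r s && (s.1 == v)) F s =
  \sum_(A : {set V} | (v \notin A) && (#|A| == r)) F (v, A))%N.
Proof.
rewrite (reindex_onto (fun A => (v, A)) (fun s => s.2))/=; last first.
  by case=> w A /= /andP[_ /eqP->].
by apply: eq_bigl => A; rewrite /is_star/= !eqxx !andbT.
Qed.

Lemma card_leaves r G v :
  #|[set A : {set V} | (A \subset nbh G v) && (#|A| == r)]| = 'C(deg G v, r).
Proof. by rewrite cards_draws. Qed.

Lemma notin_leaves G v (A : {set V}) : A \subset nbh G v -> v \notin A.
Proof. by move/fintype.subsetP => AN; apply/negP => /AN; rewrite inE eqxx. Qed.

Lemma bin_degE r G v :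
  ('C(deg G v, r) =
   \sum_(A : {set V} | (v \notin A) && (#|A| == r)) (star_at (v, A) \subset G))%N.
Proof.
rewrite -card_leaves -sum1_card big_mkcond [RHS]big_mkcond.
apply: eq_bigr => A _; rewrite inE.
case: (boolP (v \in A)) => [vA|vA] /=.
  by case: ifP => // /andP[/notin_leaves]; rewrite vA.
by rewrite star_at_subset//=; case: (A \subset _); case: (_ == r).
Qed.

Lemma num_starsE r G :
  (num_stars r G = \sum_(s | is_star r s) (star_at s \subset G))%N.
Proof.
rewrite (partition_big (fun s => s.1) predT)//=; apply: eq_bigr => v _.
by rewrite sum_stars_at bin_degE.
Qed.

Lemma card_is_star r : #|[set s : V * {set V} | is_star r s]| = (#|V| * 'C(#|V|.-1, r))%N.
Proof.
rewrite -sum1_card (eq_bigl (is_star r)); last by move=> s; rewrite inE.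
rewrite (partition_big (fun s => s.1) predT)//= -sum_nat_const; apply: eq_bigr => v _.
rewrite sum_stars_at sum1_card -(cardsC1 v) -cards_draws; apply: eq_card => A.
rewrite !inE; congr (_ && _).
apply/idP/fintype.subsetP => [vA a aA|vA]; last by apply/negP => /vA; rewrite !inE eqxx.
by rewrite !inE; apply: contraNneq vA => <-.
Qed.

(** With at least two leaves the edge set determines the centre; a single edge could be centred at
    either end. *)
Lemma star_at_inj r : (2 <= r)%N ->
  {in [pred s | is_star r s] &, injective star_at}.
Proof.
move=> r2 [v A] [w B]; rewrite !inE /is_star /= => /andP[vA /eqP cA] /andP[wB _] E.
have vw : v = w.
  apply/eqP/negPn/negP => vw.
  (* If the centres [v] and [w] differ, every edge at [v] must also contain [w], which leaves room
     for one leaf only. *)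
  have eqw a : a \in A -> a = w.
    move=> aA; have : [set v; a] \in star_at (w, B) by rewrite -E; exact: imset_f.
    case/imsetP => b bB /setP /(_ w); rewrite !inE eqxx/= eq_sym (negPf vw)/=.
    by move/eqP.
  have : (#|A| <= 1)%N.
    rewrite -(cards1 w); apply: subset_leq_card; apply/fintype.subsetP => a /eqw ->.
    by rewrite inE.
  by rewrite cA leqNgt r2.
subst w; congr (_, _).
have sub (C D : {set V}) : star_at (v, C) = star_at (v, D) -> C \subset D.
  move=> CD; apply/fintype.subsetP => a aC.
  have : [set v; a] \in star_at (v, D) by rewrite -CD; exact: imset_f.
  by case/imsetP => b bD /set2_inj ->.
by apply/eqP; rewrite eqEsubset !sub.
Qed.

(** A copy is given by exactly one pair of a centre and a leaf set; this replaces embeddings by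
    binomials of degrees. *)
Lemma card_copies_star r (G : sgraph V) : (2 <= r)%N ->
  #|copies (star r) G| = num_stars r (edges G).
Proof.
move=> r2.
pose D := [set s : V * {set V} | is_star r s && (star_at s \subset edges G)].
have -> : copies (star r) G = [set (s.1 |: s.2, star_at s) | s in D].
  apply/setP => S; rewrite inE; apply/andP/imsetP => [[SG /existsP[f]]|[s]].
    case/and3P => /injectiveP finj /eqP S1 /eqP S2.
    pose s := (f None, [set f (Some i) | i : 'I_r]).
    have S2E : S.2 = star_at s.
      rewrite S2; apply/setP => e; apply/imsetP/imsetP => [[_ /imsetP[i _ ->] ->]|[_ /imsetP[i _ ->] ->]].
        by exists (f (Some i)); [exact: imset_f|rewrite imsetU1 imset_set1].
      by exists [set None; Some i]; [exact: imset_f|rewrite imsetU1 imset_set1].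
    exists s; last first.
      rewrite (surjective_pairing S) S2E S1; congr (_, _); apply/setP => x.
      rewrite !inE; apply/imsetP/orP => [[[i|] _ ->]|[/eqP->|/imsetP[i _ ->]]].
      - by right; apply: imset_f.
      - by left.
      - by exists None.
      - by exists (Some i).
    rewrite inE -S2E SG andbT /is_star /= card_imset; last by move=> i j /finj[].
    rewrite card_ord eqxx andbT; apply/imsetP => -[i _ /finj] //.
  rewrite inE => /andP[/andP[vA /eqP cA] sG] ->; split=> //=.
  apply/existsP.
  pose g := [ffun o => if o is Some i then enum_val (cast_ord (esym cA) i) else s.1].
  have gN : g None = s.1 by rewrite ffunE.
  have gS i : g (Some i) = enum_val (cast_ord (esym cA) i) by rewrite ffunE.
  exists g.
  have fS : [set enum_val (cast_ord (esym cA) i) | i : 'I_r] = s.2.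
    apply/setP => a; apply/imsetP/idP => [[i _ ->]|aA]; first exact: enum_valP.
    exists (cast_ord cA (enum_rank_in aA a)) => //.
    by rewrite cast_ordK enum_rankK_in.
  apply/and3P; split.
  - apply/injectiveP => -[i|] [j|]; rewrite ?gN ?gS //.
    + by move/enum_val_inj/cast_ord_inj => ->.
    + by move=> E; move: vA; rewrite -E enum_valP.
    + by move=> E; move: vA; rewrite E enum_valP.
  - apply/eqP/setP => x; rewrite !inE -{1}fS.
    apply/orP/imsetP => [[/eqP->|/imsetP[i _ ->]]|[[i|] _ ->]].
    + by exists None; rewrite ?gN ?inE.
    + by exists (Some i); rewrite ?gS ?inE.
    + by rewrite ?gN ?gS; right; apply: imset_f.
    + by rewrite ?gN ?gS; left.
  - apply/eqP/setP => e; apply/imsetP/imsetP => [[a]|[_ /imsetP[i _ ->] ->]].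
      rewrite -{1}fS => /imsetP[i _ ->] ->.
      by exists [set None; Some i]; [exact: imset_f|rewrite imsetU1 imset_set1 ?gN ?gS].
    rewrite imsetU1 imset_set1 ?gN ?gS.
    by exists (enum_val (cast_ord (esym cA) i)) => //; exact: enum_valP.
rewrite card_in_imset; last first.
  move=> s s'; rewrite !inE => /andP[s1 _] /andP[s2 _] [_].
  exact: (star_at_inj r2).
rewrite num_starsE -sum1_card big_mkcond [RHS]big_mkcond; apply: eq_bigr => s _.
by rewrite inE; case: is_star => //=; case: (_ \subset _).
Qed.

End Stars.

(** * Moments of the number of stars *)

Section StarMoments.
Context {R : realType} {V : finType}.
Implicit Types (A G : {set {set V}}) (v : V) (s : V * {set V}) (r : nat) (p : R).

(** Probability 0 outside the two-element sets makes the random graph a random subset of [{set V}],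
    with no separate type of edges. *)
Definition edge_prob p (e : {set V}) : R := if e \in complete_edges V then p else 0.

Lemma edge_prob01 p : 0 <= p <= 1 -> forall e, 0 <= edge_prob p e <= 1.
Proof. by move=> p01 e; rewrite /edge_prob; case: ifP; rewrite ?lexx ?ler01. Qed.

Lemma weight_edges p (G : sgraph V) : weight (edge_prob p) (edges G) = gnp p G.
Proof.
rewrite /weight /gnp [RHS]big_mkcond/=; apply: eq_bigr => e _.
rewrite /edge_prob /bernoulli_pmf; case: (boolP (e \in complete_edges V)) => //= eU.
by case: ifP => [/(fintype.subsetP (edges_complete G))|_]; rewrite ?subr0// (negPf eU).
Qed.

Lemma gnp_meanE p (X : sgraph V -> R) (f : {set {set V}} -> R) :
  (forall G : sgraph V, X G = f (edges G)) -> gnp_mean p X = expect (edge_prob p) f.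
Proof.
move=> Xf; rewrite /expect (bigID (fun A => A \subset complete_edges V))/=.
rewrite [X in _ = _ + X]big1 ?addr0; last first.
  move=> A /fintype.subsetPn[e eA eU]; rewrite /weight (bigD1 e)//= eA /edge_prob.
  by rewrite (negPf eU) !mul0r.
rewrite (reindex_omap (@edges V) (fun A => insub A : option (sgraph V)))/=; last first.
  by move=> A AU; rewrite insubT.
apply: eq_big => [G|G _]; last by rewrite Xf weight_edges.
by rewrite edges_complete (valK G : insub (edges G) = Some G) eqxx.
Qed.

Lemma gnp_prE p (P : pred (sgraph V)) (P' : pred {set {set V}}) :
  (forall G : sgraph V, P G = P' (edges G)) -> gnp_pr p P = prob (edge_prob p) P'.
Proof.
move=> PP'; rewrite /prob -(@gnp_meanE _ (fun G : sgraph V => (P G)%:R)); last by move=> G; rewrite PP'.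
rewrite /gnp_pr /gnp_mean big_mkcond; apply: eq_bigr => G _.
by case: (P G); rewrite ?mulr1 ?mulr0.
Qed.

Lemma prod_edge_prob p (F : {set {set V}}) : F \subset complete_edges V ->
  \prod_(e in F) edge_prob p e = p ^+ #|F|.
Proof.
move=> /fintype.subsetP FU; rewrite -prodr_const; apply: eq_bigr => e /FU.
by rewrite /edge_prob => ->.
Qed.

Lemma prod_star p r s : is_star r s -> \prod_(e in star_at s) edge_prob p e = p ^+ r.
Proof.
move=> /andP[sA /eqP cA].
by rewrite prod_edge_prob ?star_at_complete// card_star_at cA.
Qed.

Lemma expect_subset_star p r s : is_star r s ->
  expect (edge_prob p) (fun A => (star_at s \subset A)%:R) = p ^+ r.
Proof.
by move=> rs; rewrite expect_contains (prod_star _ rs).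
Qed.

Lemma expect_bin_deg p r v :
  expect (edge_prob p) (fun A => 'C(deg A v, r)%:R) = 'C(#|V|.-1, r)%:R * p ^+ r.
Proof.
under eq_expect do rewrite bin_degE natr_sum.
rewrite expect_sum (eq_bigr (fun=> p ^+ r)); last first.
  by move=> A rA; apply: expect_subset_star.
rewrite sumr_const mulr_natl; congr (_ *+ _).
rewrite -(cardsC1 v) -cards_draws; apply: eq_card => A; rewrite !inE.
congr (_ && _); apply/idP/fintype.subsetP => [vA a aA|vA].
  by rewrite !inE; apply: contraNneq vA => <-.
by apply/negP => /vA; rewrite !inE eqxx.
Qed.

Lemma expect_num_stars p r :
  expect (edge_prob p) (fun A => (num_stars r A)%:R) =
  (#|V| * 'C(#|V|.-1, r))%:R * p ^+ r.
Proof.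
under eq_expect do rewrite natr_sum.
rewrite expect_sum (eq_bigr _ (fun v _ => expect_bin_deg p r v)) sumr_const.
by rewrite natrM -mulrA [RHS]mulr_natl; congr (_ *+ _).
Qed.

Definition mean_stars p r : R := (#|V| * 'C(#|V|.-1, r))%:R * p ^+ r.

Definition var_stars p r : R := expect_variance (edge_prob p) (fun A => (num_stars r A)%:R).

Lemma mean_starsE p r : mean_stars p r = \sum_(s : V * {set V} | is_star r s) p ^+ r.
Proof.
rewrite /mean_stars sumr_const mulr_natl -card_is_star; congr (_ *+ _).
by apply: eq_card => s; rewrite inE.
Qed.

Lemma var_stars_pairs p r :
  var_stars p r = \sum_(s : V * {set V} | is_star r s)
    \sum_(s' : V * {set V} | is_star r s')
      (p ^+ #|star_at s :|: star_at s'| - p ^+ (r + r)).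
Proof.
rewrite /var_stars expect_varianceE expect_num_stars -/(mean_stars p r).
under eq_bigr do rewrite big_split/=.
rewrite big_split/=; congr (_ + _).
  under eq_expect do rewrite num_starsE natr_sum mulr_suml.
  rewrite expect_sum; apply: eq_bigr => s rs.
  under eq_expect do rewrite mulr_sumr.
  rewrite expect_sum; apply: eq_bigr => s' rs'.
  rewrite -prod_edge_prob.
    rewrite -expect_contains; apply: eq_expect => A.
    by rewrite subUset -natrM mulnb.
  by rewrite subUset !star_at_complete//; [case/andP: rs'|case/andP: rs].
rewrite expr2 mean_starsE mulr_suml -sumrN; apply: eq_bigr => s _.
by rewrite mulr_sumr -sumrN; apply: eq_bigr => s' _; rewrite exprD.
Qed.

(** Since all covariances are nonnegative, any subfamily of pairs of stars bounds the variance from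
    below. *)
Lemma var_stars_term_ge0 p r s s' : 0 <= p <= 1 -> is_star r s -> is_star r s' ->
  0 <= p ^+ #|star_at s :|: star_at s'| - p ^+ (r + r).
Proof.
move=> /andP[p0 p1] /andP[_ /eqP cs] /andP[_ /eqP cs']; rewrite subr_ge0 ler_wiXn2l//.
rewrite -{1}cs -cs' -!card_star_at -cardsUI; exact: leq_addr.
Qed.

(** Diagonal pairs alone; this is the relevant order when n p is small. *)
Lemma var_stars_ge_mean p r : 0 <= p <= 1 -> (0 < r)%N ->
  mean_stars p r * (1 - p) <= var_stars p r.
Proof.
move=> p01 r0; have /andP[p0 p1] := p01.
rewrite var_stars_pairs mean_starsE mulr_suml; apply: ler_sum => s rs.
rewrite (bigD1 s)//= ler_wpDr//.
  by apply: sumr_ge0 => s' /andP[rs' _]; exact: var_stars_term_ge0.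
have cs : #|star_at s| = r by rewrite card_star_at; case/andP: rs => _ /eqP.
rewrite setUid cs exprD -{2}[p ^+ r]mulr1 -mulrBr ler_wpM2l ?exprn_ge0//.
by rewrite lerD2l lerN2; rewrite -{2}(expr1 p) ler_wiXn2l.
Qed.

(** Keeps the pairs with the same centre and one prescribed common leaf [a]: they share an edge, so
    their union has at most 2r - 1 edges. *)
Lemma var_stars_ge p r : 0 <= p <= 1 -> (0 < r)%N ->
  mean_stars p r * ('C(#|V|.-2, r.-1)%:R * p ^+ r.-1 * (1 - p)) <= var_stars p r.
Proof.
move=> p01 r0; have /andP[p0 p1] := p01.
rewrite var_stars_pairs mean_starsE mulr_suml; apply: ler_sum => -[v B] rs.
have /andP[/= vB /eqP cB] := rs.
have /card_gt0P[a aB] : (0 < #|B|)%N by rewrite cB.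
pose D := [set s : V * {set V} | [&& is_star r s, s.1 == v & a \in s.2]].
have cD : ('C(#|V|.-2, r.-1) <= #|D|)%N.
  have av : a != v by apply: contraNneq vB => <-.
  have -> : #|V|.-2 = #|~: [set v; a]|.
    by rewrite cardsCs setCK cards2 eq_sym av subn2.
  rewrite -cards_draws.
  rewrite -(@card_in_imset _ _ (fun C : {set V} => (v, a |: C))); last first.
    move=> C C'; rewrite !inE => /andP[/fintype.subsetP C1 _] /andP[/fintype.subsetP C2 _] [E].
    have aC : a \notin C by apply/negP => /C1; rewrite !inE eqxx orbT.
    have aC' : a \notin C' by apply/negP => /C2; rewrite !inE eqxx orbT.
    by rewrite -(setU1K aC) E setU1K.
  apply: subset_leq_card; apply/fintype.subsetP => s /imsetP[C].
  rewrite !inE => /andP[/fintype.subsetP C1 /eqP cC] ->.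
  have aC : a \notin C by apply/negP => /C1; rewrite !inE eqxx orbT.
  rewrite /is_star /= !inE !eqxx/= negb_or eq_sym av/= cardsU1 aC cC add1n prednK// eqxx.
  by rewrite !andbT; apply/negP => /C1; rewrite !inE eqxx.
have -> : p ^+ r * ('C(#|V|.-2, r.-1)%:R * p ^+ r.-1 * (1 - p)) =
    'C(#|V|.-2, r.-1)%:R * (p ^+ (r + r.-1) - p ^+ (r + r)).
  rewrite !exprD -(prednK r0) [in p ^+ r.-1.+1]exprS /=; ring.
apply: (@le_trans _ _ (\sum_(s in D) (p ^+ (r + r.-1) - p ^+ (r + r)))).
  rewrite sumr_const -[leRHS]mulr_natl ler_wpM2r ?ler_nat//.
  by rewrite subr_ge0 ler_wiXn2l// leq_add2l leq_pred.
rewrite [leRHS](bigID (fun s => s \in D))/= ler_wpDr//.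
  by apply: sumr_ge0 => s' /andP[rs' _]; exact: var_stars_term_ge0.
rewrite (eq_bigl (fun s => is_star r s && (s \in D))); last first.
  by move=> s; rewrite inE; case: is_star.
apply: ler_sum => -[w C] /andP[rs']; rewrite inE /= => /and3P[_ /eqP -> aC].
rewrite lerD2r ler_wiXn2l// -ltnS -addnS prednK//.
have cs : #|star_at (v, B)| = r by rewrite card_star_at.
have cs' : #|star_at (v, C)| = r by rewrite card_star_at; case/andP: rs' => _ /eqP.
rewrite -{1}cs -cs' -cardsUI -addn1 leq_add2l; apply/card_gt0P.
by exists [set v; a]; rewrite inE; apply/andP; split; exact: imset_f.
Qed.

End StarMoments.
Arguments mean_stars {R} V.
Arguments var_stars {R} V.

(** * Truncated counts and the variance from above *)

Lemma leq_expl m n e : (m <= n)%N -> (m ^ e <= n ^ e)%N.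
Proof. by case: e => // e mn; rewrite leq_exp2r. Qed.

Lemma sum_bin r : (\sum_(j < r.+1) 'C(r, j) = 2 ^ r)%N.
Proof.
by rewrite -[2%N]/(1 + 1)%N expnDn; apply: eq_bigr => j _; rewrite !exp1n !muln1.
Qed.

Lemma leq_card_bigcup (T I : finType) (P : pred I) (F : I -> {set T}) :
  (#|\bigcup_(i | P i) F i| <= \sum_(i | P i) #|F i|)%N.
Proof.
elim/big_rec2: _ => [|i k X _ IH]; first by rewrite cards0.
by apply: leq_trans (leq_card_setU _ _) _; rewrite leq_add2l.
Qed.

Lemma ffact_le_exp n m : (n ^_ m <= n ^ m)%N.
Proof.
elim: m n => // m IH n; rewrite ffactnS expnS leq_mul2l; apply/orP; right.
by apply: leq_trans (IH _) _; apply: leq_expl; exact: leq_pred.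
Qed.

Lemma bin_le_exp n m : ('C(n, m) <= n ^ m)%N.
Proof.
by apply: leq_trans (ffact_le_exp n m); rewrite -bin_ffact leq_pmulr// fact_gt0.
Qed.

Section TruncatedStars.
Context {V : finType}.
Implicit Types (A G : {set {set V}}) (v : V) (s : V * {set V}) (r D : nat).

Definition trunc_stars r D G : nat := (\sum_v 'C(minn (deg G v) D, r))%N.

Lemma card_leaves_mem r (N : {set V}) a D : (#|N| <= D)%N -> (0 < r)%N ->
  (#|[set A : {set V} | [&& A \subset N, #|A| == r & a \in A]]| <= D ^ r.-1)%N.
Proof.
move=> ND r0; pose f (A : {set V}) := A :\ a.
rewrite -(@card_in_imset _ _ f); last first.
  move=> A B; rewrite !inE => /and3P[_ _ aA] /and3P[_ _ aB] E.
  by rewrite -(setD1K aA) -/(f A) E setD1K.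
apply: (@leq_trans 'C(#|N|, r.-1)); last first.
  by apply: leq_trans (leq_bin2l _ ND) _; exact: bin_le_exp.
rewrite -cards_draws; apply: subset_leq_card; apply/fintype.subsetP => B /imsetP[A].
rewrite inE => /and3P[AN /eqP cA aA] ->; rewrite inE (subset_trans (subD1set _ _) AN)/=.
by move: cA; rewrite (cardsD1 a) aA => <-.
Qed.

(** Each vertex keeps at most [D] of its neighbours, and only leaf sets among these are used. A star
    sharing the edge va with the star (v, A) is centred at v with leaf a, or at a with leaf v. This
    makes 2r possibilities, each with at most D^(r-1) completions. *)
Lemma trunc_stars_family r D G : (0 < r)%N ->
  exists J : {set V * {set V}},
    [/\ forall s, s \in J -> is_star r s && (star_at s \subset G),
        forall s, s \in J ->
          (#|[set s' in J | ~~ [disjoint star_at s' & star_at s]]| <= 2 * r * D ^ r.-1)%N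
      & trunc_stars r D G = #|J|].
Proof.
move=> r0.
have subN v : exists N : {set V}, (N \subset nbh G v) && (#|N| == minn (deg G v) D).
  have : (0 < #|[set N : {set V} | (N \subset nbh G v) && (#|N| == minn (deg G v) D)]|)%N.
    by rewrite cards_draws bin_gt0 geq_minl.
  by move=> /card_gt0P[N]; rewrite inE; exists N.
pose N v := xchoose (subN v).
have NG v : N v \subset nbh G v by case/andP: (xchooseP (subN v)).
have cN v : #|N v| = minn (deg G v) D by case/andP: (xchooseP (subN v)) => _ /eqP.
have ND v : (#|N v| <= D)%N by rewrite cN geq_minr.
pose J := [set s : V * {set V} | (s.2 \subset N s.1) && (#|s.2| == r)].
have Jnotin s : s \in J -> s.1 \notin s.2.
  by rewrite inE => /andP[sN _]; apply: (notin_leaves (subset_trans sN (NG _))).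
exists J; split.
- move=> s sJ; have sA := Jnotin s sJ; rewrite star_at_subset// /is_star sA.
  by move: sJ; rewrite inE => /andP[sN ->]; rewrite (subset_trans sN).
- move=> [v A] sJ; have vA := Jnotin _ sJ.
  pose J1 a := [set s : V * {set V} | [&& s.1 == v, s.2 \subset N v, #|s.2| == r & a \in s.2]].
  pose J2 a := [set s : V * {set V} | [&& s.1 == a, s.2 \subset N a, #|s.2| == r & v \in s.2]].
  have cJ1 a : (#|J1 a| <= D ^ r.-1)%N.
    apply: leq_trans (card_leaves_mem a (ND v) r0).
    rewrite -(@card_in_imset _ _ (fun s => s.2)); last first.
      by move=> [? ?] [? ?]; rewrite !inE => /andP[/= /eqP-> _] /andP[/= /eqP -> _] /= ->.
    apply: subset_leq_card; apply/fintype.subsetP => _ /imsetP[s sJ1 ->].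
    by move: sJ1; rewrite !inE => /andP[].
  have cJ2 a : (#|J2 a| <= D ^ r.-1)%N.
    apply: leq_trans (card_leaves_mem v (ND a) r0).
    rewrite -(@card_in_imset _ _ (fun s => s.2)); last first.
      by move=> [? ?] [? ?]; rewrite !inE => /andP[/= /eqP-> _] /andP[/= /eqP -> _] /= ->.
    apply: subset_leq_card; apply/fintype.subsetP => _ /imsetP[s sJ2 ->].
    by move: sJ2; rewrite !inE => /andP[].
  apply: (@leq_trans #|\bigcup_(a in A) (J1 a :|: J2 a)|).
    apply: subset_leq_card; apply/fintype.subsetP => -[u B]; rewrite !inE /=.
    case/andP => /andP[BN cB]; rewrite -setI_eq0 => /set0Pn[e]; rewrite inE.
    case/andP => /imsetP[b bB /= ->] /imsetP[a aA /= E].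
    apply/bigcupP; exists a => //; rewrite !inE /=.
    have : u \in [set v; a] by rewrite -E !inE eqxx.
    rewrite !inE => /orP[/eqP uv|/eqP ua].
      by apply/orP; left; rewrite -uv eqxx BN cB/=; move: E; rewrite uv => /set2_inj <-.
    apply/orP; right; rewrite -ua eqxx BN cB /=.
    have : v \in [set u; b] by rewrite E !inE eqxx.
    rewrite !inE ua => /orP[/eqP va|/eqP -> //]; first by move: vA; rewrite /= va aA.
  apply: leq_trans (leq_card_bigcup _ _) _.
  have /eqP cA : #|A| == r by move: sJ; rewrite inE => /andP[].
  apply: (@leq_trans (\sum_(a in A) (2 * D ^ r.-1)))%N; last first.
    by rewrite sum_nat_const cA mulnCA mulnA.
  apply: leq_sum => a _; rewrite mul2n -addnn.
  by apply: leq_trans (leq_card_setU _ _) (leq_add (cJ1 a) (cJ2 a)).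
- rewrite -sum1_card (partition_big (fun s => s.1) predT)//=; apply: eq_bigr => v _.
  rewrite -cN -cards_draws -sum1_card.
  rewrite (reindex_onto (fun A : {set V} => (v, A)) (fun s => s.2))/=; last first.
    by case=> w A /= /andP[_ /eqP->].
  by apply: eq_bigl => A; rewrite !inE /= !eqxx !andbT.
Qed.

End TruncatedStars.

Section StarVariance.
Context {R : realType} {V : finType}.
Implicit Types (A G : {set {set V}}) (v : V) (s : V * {set V}) (r : nat) (p : R).
Local Notation n := (#|V|).

(* A member of the truncated family meets at most [2 r D^(r-1)] others. *)
Lemma prob_trunc_stars p r D m (a b : R) : 0 <= p <= 1 -> (0 < r)%N -> 0 <= a ->
  a + (m.-1 * (2 * r * D ^ r.-1))%:R <= b ->
  prob (edge_prob p) (fun A => b <= (trunc_stars r D A)%:R) * a ^+ m <=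
  mean_stars V p r ^+ m.
Proof.
move=> p01 r0 a0 ab.
have := @prob_large_family R _ _ (is_star r) (@star_at V) (edge_prob p)
  (fun A => b <= (trunc_stars r D A)%:R) (2 * r * D ^ r.-1) m a b (edge_prob01 p01) a0.
rewrite (eq_bigr (fun=> p ^+ r)); last by move=> s; exact: prod_star.
rewrite -mean_starsE; apply => // A bA.
have [J [J1 J2 JE]] := trunc_stars_family D A r0.
by exists J; split=> //; rewrite -JE.
Qed.

(** Adding a star changes the degrees of its r + 1 vertices only, each by at most r; Vandermonde's
    identity expands C(r + d, r). *)
Lemma num_stars_add_star r s A : is_star r s ->
  (num_stars r (star_at s :|: A) <=
   \sum_v ('C(deg A v, r) + (v \in s.1 |: s.2) *
           \sum_(j < r) 'C(r, j.+1) * 'C(deg A v, r - j.+1)))%N.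
Proof.
move=> /andP[s1 /eqP cs]; apply: leq_sum => v _.
have degU : (deg (star_at s :|: A) v <= deg (star_at s) v + deg A v)%N.
  by rewrite /deg nbhU; exact: leq_card_setU.
have degS : (deg (star_at s) v <= r)%N.
  rewrite /deg -cs -card_star_at -(card_imset (mem (nbh (star_at s) v)) (@set2_inj V v)); apply: subset_leq_card.
  by apply/fintype.subsetP => _ /imsetP[u uN ->]; move: uN; rewrite inE => /andP[].
case: (boolP (v \in _)) => [_|vs]; rewrite ?mul1n ?mul0n ?addn0.
  apply: (@leq_trans 'C(r + deg A v, r)).
    by apply: leq_bin2l; apply: leq_trans degU _; rewrite leq_add2r.
  by rewrite -binomial.Vandermonde big_ord_recl bin0 mul1n subn0.
apply: leq_bin2l; apply: leq_trans degU _; rewrite -[leqRHS]add0n leq_add2r leqn0 cards_eq0.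
apply/eqP/setP => u; rewrite !inE; apply/negP => /andP[_ /imsetP[a aA E]].
move: vs; have : v \in [set s.1; a] by rewrite -E !inE eqxx.
by rewrite !inE => /orP[/eqP->|/eqP->]; rewrite ?eqxx ?aA ?orbT.
Qed.

(** E X^2 is the sum over stars s of p^r times the mean of X after adding s. Hence the variance is
    at most mu times the largest increase of the mean caused by one added star. Since n p >= 1, the
    power r - 1 of n p dominates the lower ones. *)
Lemma var_stars_le p r : 0 <= p <= 1 -> (0 < r)%N -> 1 <= n%:R * p ->
  var_stars V p r <= mean_stars V p r * ((r.+1 * 2 ^ r)%:R * (n%:R * p) ^+ r.-1).
Proof.
move=> p01 r0 np1; have /andP[p0 p1] := p01.
rewrite /var_stars expect_varianceE expect_num_stars -/(mean_stars V p r).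
have -> : expect (edge_prob p) (fun A => (num_stars r A)%:R * (num_stars r A)%:R) =
    \sum_(s : V * {set V} | is_star r s)
      p ^+ r * expect (edge_prob p) (fun A => (num_stars r (star_at s :|: A))%:R).
  under eq_expect do rewrite {1}num_starsE natr_sum mulr_suml.
  by rewrite expect_sum; apply: eq_bigr => s rs; rewrite expect_subset (prod_star _ rs).
have inc s : is_star r s ->
    expect (edge_prob p) (fun A => (num_stars r (star_at s :|: A))%:R) <=
    mean_stars V p r + (r.+1 * 2 ^ r)%:R * (n%:R * p) ^+ r.-1.
  move=> rs; have /andP[s1 /eqP cs] := rs.
  pose f A : R := \sum_v ('C(deg A v, r)%:R + (v \in s.1 |: s.2)%:R *
           \sum_(j < r) 'C(r, j.+1)%:R * 'C(deg A v, r - j.+1)%:R).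
  apply: (@le_trans _ _ (expect (edge_prob p) f)).
    apply: ler_expect => [|A]; first exact: edge_prob01.
    have := num_stars_add_star A rs; rewrite -(ler_nat R) => /le_trans; apply.
    rewrite natr_sum; apply: ler_sum => v _; rewrite natrD natrM natr_sum lerD2l.
    by apply: ler_wpM2l => //; apply: ler_sum => j _; rewrite natrM.
  rewrite expect_sum /mean_stars -(expect_num_stars p r).
  under [X in _ <= X + _]eq_expect do rewrite natr_sum.
  rewrite expect_sum; under eq_bigr do rewrite expectD expectZ expect_sum.
  rewrite big_split/= lerD2l.
  have -> : (r.+1 * 2 ^ r)%:R * (n%:R * p) ^+ r.-1 =
      \sum_v (v \in s.1 |: s.2)%:R * ((2 ^ r)%:R * (n%:R * p) ^+ r.-1).
    rewrite -mulr_suml -natr_sum -big_mkcond/= sum1_card cardsU1 s1 cs add1n.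
    by rewrite natrM mulrA.
  apply: ler_sum => v _; apply: ler_wpM2l => //.
  rewrite -sum_bin natr_sum mulr_suml big_ord_recl/= ler_wpDl//.
    by rewrite mulr_ge0// exprn_ge0// (le_trans _ np1).
  apply: ler_sum => j _; rewrite expectZ expect_bin_deg; apply: ler_wpM2l => //.
  apply: (@le_trans _ _ ((n%:R * p) ^+ (r - j.+1))).
    rewrite exprMn ler_wpM2r ?exprn_ge0// -natrX ler_nat.
    apply: leq_trans (bin_le_exp _ _) _; apply: leq_expl; exact: leq_pred.
  by rewrite ler_weXn2l// -subn1 leq_sub2l.
rewrite lerBlDr; apply: (le_trans (ler_sum _ (fun s rs => ler_wpM2l (exprn_ge0 r p0) (inc s rs)))).
by rewrite -mulr_suml -mean_starsE mulrDr addrC expr2.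
Qed.

End StarVariance.

(** * Exponential moments of degrees *)

Section DegreeTail.
Context {R : realType} {V : finType}.
Implicit Types (A G : {set {set V}}) (v : V) (S : {set V}) (r : nat) (p : R).
Local Notation n := (#|V|).

Lemma sum_card_cap S (B : {set {set V}}) :
  (\sum_(e in B) #|e :&: S| = \sum_(v in S) #|[set e in B | v \in e]|)%N.
Proof.
transitivity (\sum_(e in B) \sum_(v in S) (v \in e))%N.
  apply: eq_bigr => e _; rewrite -sum1_card big_mkcond [RHS]big_mkcond.
  by apply: eq_bigr => v _; rewrite inE; case: (v \in e); case: (v \in S).
rewrite exchange_big; apply: eq_bigr => v _.
rewrite -sum1_card big_mkcond [RHS]big_mkcond.
by apply: eq_bigr => e _; rewrite inE; case: (e \in B); case: (v \in e).
Qed.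

(** Markov's inequality for y to the total degree of [S]. The degrees are dependent, but their sum
    is the sum of |e :&: S| over the edges e, which are independent; an edge inside [S] counts
    twice, whence y^2. *)
Lemma prob_high_degrees_in p S d (y : R) : 0 <= p <= 1 -> 1 <= y ->
  prob (edge_prob p) (fun A => [forall v in S, (d <= deg A v)%N]) * y ^+ (#|S| * d) <=
  expR (p * (#|S| * n)%:R * y ^+ 2).
Proof.
move=> p01 y1; have /andP[p0 p1] := p01; have y0 : 0 <= y by lra.
have q01 := @edge_prob01 R V p p01.
apply: (@le_trans _ _ (expect (edge_prob p) (fun A => \prod_(e in A) y ^+ #|e :&: S|))).
  rewrite mulrC -expectZ; apply: ler_expect => // A.
  case: (boolP [forall v in S, _]) => [/forall_inP Sd|_]; last first.
    by rewrite mulr0 prodr_ge0// => *; rewrite exprn_ge0.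
  rewrite mulr1 prodrXr ler_weXn2l// sum_card_cap -sum_nat_const; apply: leq_sum => v vS.
  apply: leq_trans (Sd v vS) _; rewrite /deg -(card_imset (mem (nbh A v)) (@set2_inj V v)).
  apply: subset_leq_card; apply/fintype.subsetP => _ /imsetP[u uN ->].
  by move: uN; rewrite !inE eqxx andbT => /andP[].
rewrite expect_prod.
apply: (@le_trans _ _ (\prod_e expR (edge_prob p e * (y ^+ #|e :&: S| - 1)))).
  apply: ler_prod => e _; rewrite expR_ge1Dx andbT.
  have /andP[e0 e1] := q01 e.
  have : 1 <= y ^+ #|e :&: S| by rewrite exprn_ege1.
  by move=> h; rewrite addr_ge0// mulr_ge0// subr_ge0.
rewrite -expR_sum ler_expR.
apply: (@le_trans _ _ (\sum_(e in complete_edges V) p * (#|e :&: S|%:R * y ^+ 2))).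
  rewrite [leRHS]big_mkcond; apply: ler_sum => e _; rewrite /edge_prob.
  case: ifP => [|_]; last by rewrite mul0r.
  rewrite inE => /eqP ce; apply: ler_wpM2l => //.
  have : (#|e :&: S| <= 2)%N by rewrite -ce subset_leq_card// subsetIl.
  case: #|_| => [|[|[|//]]] _; rewrite ?expr0 ?expr1 ?mul0r ?mul1r ?subrr//; nra.
rewrite -mulr_sumr -mulr_suml mulrA ler_wpM2r ?sqr_ge0// ler_wpM2l// -natr_sum ler_nat.
rewrite sum_card_cap -sum_nat_const; apply: leq_sum => v _.
apply: (@leq_trans #|[set [set v; u] | u in [set: V]]|).
  apply: subset_leq_card; apply/fintype.subsetP => e; rewrite !inE => /andP[/cards2P[a [b [_ ->]]]].
  rewrite !inE => /orP[/eqP->|/eqP->]; first exact: imset_f.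
  by rewrite setUC; exact: imset_f.
by apply: leq_trans (leq_imset_card _ _) _; rewrite cardsT.
Qed.

Lemma prob_high_degrees p k d (y : R) : 0 <= p <= 1 -> 1 <= y ->
  prob (edge_prob p) (fun A => (k <= #|[set v | (d <= deg A v)%N]|)%N) * y ^+ (k * d) <=
  (n ^ k)%:R * expR (p * (k * n)%:R * y ^+ 2).
Proof.
move=> p01 y1; have q01 := @edge_prob01 R V p p01.
have y0 : 0 <= y by lra.
pose P' S A := (#|S| == k) && [forall v in S, (d <= deg A v)%N].
apply: (@le_trans _ _ ((\sum_S prob (edge_prob p) (P' S)) * y ^+ (k * d))).
  apply: ler_wpM2r; first exact: exprn_ge0.
  apply: prob_union => // A kA.
  have : (0 < #|[set S : {set V} | (S \subset [set v | (d <= deg A v)%N]) && (#|S| == k)]|)%N.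
    by rewrite cards_draws bin_gt0.
  move=> /card_gt0P[S]; rewrite inE => /andP[SA cS]; exists S; rewrite /P' cS/=.
  by apply/forall_inP => v vS; have := fintype.subsetP SA v vS; rewrite inE.
rewrite mulr_suml.
apply: (@le_trans _ _ (\sum_(S in [set S : {set V} | #|S| == k]) expR (p * (k * n)%:R * y ^+ 2))).
  rewrite [leRHS]big_mkcond; apply: ler_sum => S _; rewrite inE.
  case: eqP => [<-|kS].
    apply: le_trans (prob_high_degrees_in S d p01 y1); rewrite ler_wpM2r ?exprn_ge0//.
    by apply: le_prob => // A /andP[].
  rewrite /prob (@eq_expect _ _ _ _ (fun=> 0)) ?expect_cst ?mul0r// => A.
  by rewrite /P'; case: eqP.
rewrite sumr_const card_draws -[leLHS]mulr_natl ler_wpM2r ?expR_ge0// ler_nat.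
exact: bin_le_exp.
Qed.

Lemma bin_telescope r D x : (0 < r)%N -> (D <= x)%N ->
  ('C(x, r) = 'C(D, r) + \sum_(D <= i < x) 'C(i, r.-1))%N.
Proof.
move=> r0; elim: x => [|x IH]; first by rewrite leqn0 => /eqP ->; rewrite big_nil addn0.
rewrite leq_eqVlt => /orP[/eqP->|Dx]; first by rewrite big_geq ?addn0.
rewrite big_nat_recr//= addnA -IH//.
by rewrite -{1 2}(prednK r0) binS.
Qed.

(** Summation by parts: when a degree grows from i to i + 1, its vertex gains C(i, r-1) stars. *)
Lemma num_stars_le_trunc r D G : (0 < r)%N ->
  (num_stars r G <= trunc_stars r D G +
    \sum_(D <= i < n) #|[set v | (i < deg G v)%N]| * 'C(i, r.-1))%N.
Proof.
move=> r0.
have -> : (\sum_(D <= i < n) #|[set v | (i < deg G v)%N]| * 'C(i, r.-1) =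
   \sum_v \sum_(D <= i < n) (i < deg G v) * 'C(i, r.-1))%N.
  rewrite exchange_big/=; apply: eq_bigr => i _.
  rewrite -big_distrl/=; congr (_ * _)%N.
  by rewrite -sum1_card big_mkcond; apply: eq_bigr => v _; rewrite inE; case: leqP.
rewrite /num_stars /trunc_stars -big_split/=; apply: leq_sum => v _.
have [dD|/ltnW Dd] := leqP (deg G v) D; first exact: leq_addr.
rewrite (bin_telescope r0 Dd) leq_add2l.
have dn : (deg G v <= n)%N by rewrite (leq_trans (deg_le _ _))// leq_pred.
rewrite [leqRHS](big_cat_nat _ dn)//= -[leqLHS]addn0; apply: leq_add => //.
rewrite [leqRHS]big_nat_cond [leqLHS]big_nat_cond.
by apply: leq_sum => i /andP[/andP[_ ->] _]; rewrite mul1n.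
Qed.

End DegreeTail.

(** * Planting edges and tilting the edge probability *)

Section Planting.
Context {R : realType} {V : finType}.
Implicit Types (A G : {set {set V}}) (v : V) (S : {set V}) (r : nat) (p : R).
Local Notation n := (#|V|).

Lemma prob_contains p (F : {set {set V}}) (P : pred {set {set V}}) :
  0 <= p <= 1 -> F \subset complete_edges V ->
  p ^+ #|F| * prob (edge_prob p) (fun A => P (F :|: A)) <= prob (edge_prob p) P.
Proof.
move=> p01 FU; rewrite -(prod_edge_prob p FU) -(expect_subset _ _ (fun A => (P A)%:R)).
apply: ler_expect => [|A]; first exact: edge_prob01.
by case: (F \subset A); rewrite ?mul1r ?mul0r.
Qed.

(** At a vertex of [S] the new degree is only known to be at least [D], so the stars formerly
    centred there are given up; they form the sum on the right. *)
Lemma exists_planted r S D : (D <= n.-1)%N -> exists F : {set {set V}},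
  [/\ F \subset complete_edges V, (#|F| <= #|S| * D)%N &
   forall A, (num_stars r A + #|S| * 'C(D, r) <=
     num_stars r (F :|: A) + \sum_(v in S) 'C(deg A v, r))%N].
Proof.
move=> Dn.
have subN v : exists N : {set V}, (N \subset [set~ v]) && (#|N| == D).
  have : (0 < #|[set N : {set V} | (N \subset [set~ v]) && (#|N| == D)]|)%N.
    by rewrite cards_draws bin_gt0 cardsC1.
  by move=> /card_gt0P[N]; rewrite inE; exists N.
pose N v := xchoose (subN v).
have Nv v : v \notin N v.
  by apply/negP; case/andP: (xchooseP (subN v)) => /fintype.subsetP h _ /h; rewrite !inE eqxx.
have cN v : #|N v| = D by case/andP: (xchooseP (subN v)) => _ /eqP.
exists (\bigcup_(v in S) star_at (v, N v)); split.
- by apply/bigcupsP => v _; apply: star_at_complete; exact: Nv.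
- apply: leq_trans (leq_card_bigcup _ _) _; rewrite -sum_nat_const; apply: leq_sum => v _.
  by rewrite card_star_at cN.
- move=> A; rewrite /num_stars -sum_nat_const [X in (_ + X <= _)%N]big_mkcond.
  rewrite [X in (_ <= _ + X)%N]big_mkcond -!big_split/=; apply: leq_sum => v _.
  case: ifP => vS; last first.
    by rewrite !addn0; apply/leq_bin2l/subset_leq_card/nbh_subset/subsetUr.
  rewrite addnC leq_add2r; apply: leq_bin2l; rewrite -(cN v); apply: subset_leq_card.
  have := @star_at_subset _ (v, N v) (\bigcup_(v in S) star_at (v, N v) :|: A) (Nv v).
  by move=> /= <-; apply: subset_trans (subsetUl _ _); exact: (finset.bigcup_sup v).
Qed.

Lemma prob_planted p r k D (b s y : R) : 0 <= p <= 1 ->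
  (k <= n)%N -> (D <= n.-1)%N -> 0 < s -> 0 < y ->
  b <= mean_stars V p r - s - y + (k * 'C(D, r))%:R ->
  p ^+ (k * D) * (1 - var_stars V p r / s ^+ 2 - (k * 'C(n.-1, r))%:R * p ^+ r / y) <=
  prob (edge_prob p) (fun A => b <= (num_stars r A)%:R).
Proof.
move=> p01 kn Dn s0 y0 bb; have /andP[p0 p1] := p01; have q01 := @edge_prob01 R V p p01.
have [S cS] : exists S : {set V}, #|S| = k.
  have : (0 < #|[set S : {set V} | #|S| == k]|)%N by rewrite card_draws bin_gt0.
  by move=> /card_gt0P[S]; rewrite inE => /eqP; exists S.
have [F [FU cF FA]] := exists_planted r S Dn.
pose Y A : R := \sum_(v in S) 'C(deg A v, r)%:R.
have EY : expect (edge_prob p) Y = (k * 'C(n.-1, r))%:R * p ^+ r.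
  rewrite expect_sum (eq_bigr _ (fun v _ => expect_bin_deg p r v)) sumr_const cS.
  by rewrite natrM -mulrA [RHS]mulr_natl.
pose bad A := ((num_stars r A)%:R <= mean_stars V p r - s) || (y <= Y A).
have pbad : prob (edge_prob p) bad <= var_stars V p r / s ^+ 2 + (k * 'C(n.-1, r))%:R * p ^+ r / y.
  apply: le_trans (prob_union2 q01 (fun A => id)) _; apply: lerD.
    rewrite ler_pdivlMr ?exprn_gt0//.
    by have := chebyshev_below (fun A => (num_stars r A)%:R) q01 (ltW s0); rewrite expect_num_stars.
  rewrite ler_pdivlMr// -EY; apply: markov_ineq => // A.
  exact: sumr_ge0.
have good : 1 - prob (edge_prob p) bad <=
    prob (edge_prob p) (fun A => b <= (num_stars r (F :|: A))%:R).
  rewrite -probC; apply: le_prob => // A /=; rewrite negb_or -!ltNge => /andP[X1 Y1].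
  have := FA A; rewrite cS -(ler_nat R) !natrD natr_sum -/(Y A) => H.
  by lra.
have pF : p ^+ (k * D) <= p ^+ #|F| by rewrite ler_wiXn2l// -cS.
apply: le_trans (prob_contains (fun A => b <= (num_stars r A)%:R) p01 FU).
apply: (@le_trans _ _ (p ^+ (k * D) *
   prob (edge_prob p) (fun A => b <= (num_stars r (F :|: A))%:R))).
  apply: ler_wpM2l; first exact: exprn_ge0.
  by apply: le_trans good; rewrite -addrA -opprD lerD2l lerN2.
by rewrite ler_wpM2r// prob_ge0.
Qed.

(** Fallback for deviations that would require planting at more than n vertices. *)
Lemma prob_full p r (b : R) : 0 <= p <= 1 ->
  b <= (num_stars r (complete_edges V))%:R ->
  p ^+ (n ^ 2) <= prob (edge_prob p) (fun A => b <= (num_stars r A)%:R).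
Proof.
move=> p01 bX; have /andP[p0 p1] := p01.
apply: le_trans (prob_contains (fun A => b <= (num_stars r A)%:R) p01 (subxx _)).
rewrite (_ : prob _ _ = 1); last first.
  apply: etrans (@expect_cst R _ (@edge_prob R V p) 1); apply: eq_expect => A.
  by rewrite (le_trans bX)// ler_nat; exact/num_stars_mono/subsetUl.
rewrite mulr1 ler_wiXn2l// /complete_edges card_draws; exact: bin_le_exp.
Qed.

Lemma tilted_prob p p' (P : pred {set {set V}}) : 0 < p < 1 -> 0 <= p' <= 1 ->
  prob (edge_prob p') P ^+ 2 <=
  prob (edge_prob p) P * expR (n%:R ^+ 2 * ((p' - p) ^+ 2 / (p * (1 - p)))).
Proof.
move=> p01 p'01; have /andP[p0 p1] := p01.
have pp : 0 <= p <= 1 by rewrite !ltW.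
have x0 : 0 <= (p' - p) ^+ 2 / (p * (1 - p)).
  by rewrite divr_ge0 ?sqr_ge0// mulr_ge0 ?subr_ge0 ?ltW.
apply: (le_trans (@change_of_measure _ _ (edge_prob p) (edge_prob p') P _ _ _)).
- exact: edge_prob01.
- exact: edge_prob01.
- by move=> e; rewrite /edge_prob; case: ifP => _; [right|left].
apply: ler_wpM2l; first by apply: prob_ge0; exact: edge_prob01.
apply: (@le_trans _ _ (\prod_(e in complete_edges V) expR ((p' - p) ^+ 2 / (p * (1 - p))))).
  rewrite [leRHS]big_mkcond; apply: ler_prod => e _; rewrite /edge_prob.
  case: ifP => _; last by rewrite subrr expr0n mul0r addr0 ler01 lexx.
  by rewrite expR_ge1Dx andbT addr_ge0.
rewrite prodr_const -expRM_natl ler_expR ler_wpM2r// -natrX ler_nat.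
rewrite /complete_edges card_draws; exact: bin_le_exp.
Qed.

End Planting.

(** * Tails of truncated counts and of high degrees *)

Section RealLemmas.
Context {R : realType}.
Implicit Types x y a b l : R.

Lemma ln_le_subr1 x : 0 < x -> ln x <= x - 1.
Proof.
move=> x0; have := @le_ln1Dx R (x - 1); rewrite [1 + _](_ : _ = x); last by ring.
by apply; lra.
Qed.

Lemma sum_inv_sqrt_le N x : 0 <= x ->
  \sum_(i < N | i.+1%:R <= x) (Num.sqrt i.+1%:R)^-1 <= 2 * Num.sqrt x.
Proof.
move=> x0.
(* The minimum with [N] makes the bound inductive: the right side grows only while terms are
   added. *)
suff : \sum_(i < N | i.+1%:R <= x) (Num.sqrt i.+1%:R)^-1 <= 2 * Num.sqrt (Num.min N%:R x).
  move/le_trans; apply; rewrite ler_pM2l// ler_wsqrtr// ge_min lexx orbT//.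
elim: N => [|N IH]; first by rewrite big_ord0 mulr_ge0// sqrtr_ge0.
rewrite big_mkcond big_ord_recr/= -big_mkcond/=.
have [Nx|xN] := lerP N.+1%:R x; last first.
  rewrite addr0; apply: (le_trans IH); rewrite ler_pM2l// ler_wsqrtr//.
  by rewrite ge_min lexx orbT.
have Nx' : N%:R <= x by rewrite (le_trans _ Nx)// ler_nat.
move: IH; rewrite min_l// => IH.
set u := Num.sqrt N.+1%:R; set w := Num.sqrt N%:R in IH *.
have u0 : 0 < u by rewrite sqrtr_gt0.
have w0 : 0 <= w by rewrite sqrtr_ge0.
have uE : u ^+ 2 = w ^+ 2 + 1 by rewrite !sqr_sqrtr// natr1.
(* Because u^2 - w^2 = 1, the right side is 2 / (u + w), and w <= u. *)
have : u^-1 <= 2 * (u - w).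
  rewrite -[_^-1]mul1r ler_pdivrMr//; nra.
lra.
Qed.

(** From ln x <= x - 1 and l >= 2. With a = sqrt d and b = sqrt m it replaces the logarithm at level
    d by the one at level m, at the price of a factor sqrt (m / d). *)
Lemma ln_interpolate a b l : 0 < a -> a <= b -> 2 <= l ->
  a * (l + 2 * ln (b / a)) <= l * b.
Proof.
move=> a0 ab l2; have ba : 0 < b / a by rewrite divr_gt0//; lra.
have h := ln_le_subr1 ba.
have : a * ln (b / a) <= b - a.
  apply: (@le_trans _ _ (a * (b / a - 1))); first by rewrite ler_pM2l.
  by rewrite mulrBr mulr1 mulrCA divff ?mulr1// gt_eqF.
nra.
Qed.

End RealLemmas.

Section TailBounds.
Context {R : realType} {V : finType}.
Implicit Types (A G : {set {set V}}) (v : V) (r : nat) (p t : R).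
Local Notation n := (#|V|).

Lemma bulk_tail p r D t : 0 <= p <= 1 -> (0 < r)%N -> (0 < D)%N -> 0 < t ->
  prob (edge_prob p) (fun A => mean_stars V p r + t / 2 <= (trunc_stars r D A)%:R) <=
  expR (- (t ^+ 2 / (32 * r%:R * D%:R ^+ r.-1 * (mean_stars V p r + t)))).
Proof.
move=> p01 r0 D0 t0; have /andP[p0 p1] := p01.
set mu := mean_stars V p r.
have mu0 : 0 <= mu by rewrite mulr_ge0// exprn_ge0.
set P := prob _ _.
have P0 : 0 <= P by apply: prob_ge0; exact: edge_prob01.
pose C := (2 * r * D ^ r.-1)%N.
have C0 : 0 < C%:R :> R by rewrite ltr0n !muln_gt0 r0 expn_gt0 D0.
have CE : C%:R = 2 * r%:R * D%:R ^+ r.-1 :> R by rewrite /C !natrM natrX.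
(* Half of the excess t / 2 is spent on the stars spoiled by the greedy choice, (m - 1) C <= t / 4;
   the other half leaves mu + t / 4 candidates at every step. *)
pose x := t / (4 * C%:R).
have x0 : 0 < x by rewrite divr_gt0// mulr_gt0.
have xC : x * C%:R = t / 4 by rewrite /x; field; rewrite gt_eqF.
pose m := (Num.truncn x).+1.
have xm : x <= m%:R by rewrite ltW// truncnS_gt.
have mx : m.-1%:R <= x by rewrite /m/= truncn_le ltW.
have a0 : 0 < mu + t / 4 by lra.
have H : P * (mu + t / 4) ^+ m <= mu ^+ m.
  apply: (@prob_trunc_stars R V p r D m (mu + t / 4) (mu + t / 2)) => //; first exact: ltW.
  rewrite -/C natrM.
  have : m.-1%:R * C%:R <= x * C%:R by rewrite ler_pM2r.
  rewrite xC; lra.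
set z := t / 4 / (mu + t / 4).
have zE : mu = (1 - z) * (mu + t / 4) by rewrite /z mulrBl divfK ?gt_eqF//; ring.
have z1 : 0 <= 1 - z by rewrite -(pmulr_lge0 _ a0) -zE.
have {}H : P <= expR (- z) ^+ m.
  rewrite -(ler_pM2r (exprn_gt0 m a0)); apply: (le_trans H).
  rewrite {1}zE exprMn ler_pM2r ?exprn_gt0//.
  by rewrite lerXn2r ?nnegrE ?expR_ge0// expR_ge1Dx.
apply: (le_trans H); rewrite -expRM_natl ler_expR mulrN lerN2.
have z0 : 0 <= z by rewrite divr_ge0//; lra.
apply: (@le_trans _ _ (x * z)); last by rewrite ler_wpM2r.
rewrite /x /z.
have -> : 32 * r%:R * D%:R ^+ r.-1 * (mu + t) = 16 * C%:R * (mu + t) by rewrite CE; ring.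
have -> : t / (4 * C%:R) * (t / 4 / (mu + t / 4)) = t ^+ 2 / (16 * C%:R * (mu + t / 4)).
  by field; rewrite !gt_eqF//; lra.
have mt : 0 < mu + t by lra.
rewrite ler_wpM2l ?sqr_ge0// lef_pV2 ?posrE ?mulr_gt0//.
by rewrite ler_pM2l ?mulr_gt0//; lra.
Qed.

(** With y^2 = d / (np) the exponential moment contributes exp (kd), against a gain of exp (- kdl /
    2). The two lower bounds on l make kd, k ln n and one more ln n small parts of kdl. The spare
    factor 1 / n pays for a union bound over n degree levels. *)
Lemma prob_num_high p k d : 0 < p <= 1 -> (0 < n)%N -> (0 < k)%N -> (0 < d)%N ->
  let l := ln (d%:R / (n%:R * p)) in
  8 <= l -> 16 * ln n%:R <= d%:R * l ->
  prob (edge_prob p) (fun A => (k <= #|[set v | (d <= deg A v)%N]|)%N) <=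
  n%:R^-1 * expR (- (k%:R * d%:R * l / 8)).
Proof.
move=> /andP[p0 p1] n0 k0 d0 l l8 ln16.
have p01 : 0 <= p <= 1 by rewrite ltW.
have nR : 0 < n%:R :> R by rewrite ltr0n.
have dR : 0 < d%:R :> R by rewrite ltr0n.
have np0 : 0 < n%:R * p by rewrite mulr_gt0.
have lE : expR l = d%:R / (n%:R * p) by rewrite lnK// posrE divr_gt0.
clearbody l.
have y1 : 1 <= expR (l / 2) by rewrite -[leLHS]expR0 ler_expR; lra.
have := @prob_high_degrees R V p k d (expR (l / 2)) p01 y1.
set P := prob _ _.
have y2 : expR (l / 2) ^+ 2 = d%:R / (n%:R * p).
  rewrite -expRM_natl (_ : 2%:R * (l / 2) = l); last by field.
  exact: lE.
rewrite y2 -expRM_natl.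
have -> : p * (k * n)%:R * (d%:R / (n%:R * p)) = k%:R * d%:R :> R.
  by rewrite natrM; field; rewrite !gt_eqF.
have -> : (n ^ k)%:R = expR (k%:R * ln n%:R) :> R.
  by rewrite expRM_natl lnK// natrX.
rewrite -expRD natrM.
have -> : n%:R^-1 = expR (- ln n%:R) :> R by rewrite expRN lnK.
rewrite -expRD => H.
rewrite -(ler_pM2r (expR_gt0 (k%:R * d%:R * (l / 2)))) -expRD.
apply: (le_trans H); rewrite ler_expR.
have k1 : 1 <= k%:R :> R by rewrite ler1n.
have ln0 : 0 <= ln n%:R :> R by rewrite ln_ge0// ler1n.
have : 16 * (k%:R * ln n%:R) <= k%:R * d%:R * l.
  by rewrite mulrCA -mulrA ler_pM2l// ltr0n.
have : ln n%:R <= k%:R * ln n%:R :> R by rewrite ler_peMl.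
have : k%:R * d%:R * 8 <= k%:R * d%:R * l by rewrite ler_wpM2l// mulr_ge0.
lra.
Qed.

End TailBounds.

Section HighDegrees.
Context {R : realType} {V : finType}.
Implicit Types (A G : {set {set V}}) (v : V) (r : nat) (p t : R).
Local Notation n := (#|V|).

(** The fraction is the threshold for the number of vertices at level d. Multiplied by d l it equals
    (M / 4) l sqrt (m / d) (m / d)^(r-2), and the square root raises l to [lm]. *)
Lemma high_level_exponent r d (t m M l lm : R) : (2 <= r)%N -> (0 < d)%N ->
  d%:R <= m -> 0 < t -> M * m ^+ r.-1 = t -> 2 <= l ->
  lm = l + ln (m / d%:R) ->
  M * lm / 4 <= t / (4 * (Num.sqrt m * (Num.sqrt d%:R * d%:R ^+ r.-1))) * d%:R * l.
Proof.
move=> r2 d0 dm t0 tE l2 lmE.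
have dR : 0 < d%:R :> R by rewrite ltr0n.
have m0 : 0 < m by lra.
set a := Num.sqrt d%:R; set b := Num.sqrt m.
have a0 : 0 < a by rewrite sqrtr_gt0.
have b0 : 0 < b by rewrite sqrtr_gt0.
have aE : d%:R = a ^+ 2 by rewrite sqr_sqrtr// ltW.
have bE : m = b ^+ 2 by rewrite sqr_sqrtr// ltW.
have ab : a <= b by rewrite ler_wsqrtr.
have M0 : 0 < M.
  by rewrite -(pmulr_lgt0 _ (exprn_gt0 r.-1 m0)) tE.
have H : a * lm <= l * b.
  have := ln_interpolate a0 ab l2; rewrite lmE aE bE -expr_div_n lnXn ?divr_gt0//.
  by rewrite mulr_natl.
rewrite -tE aE bE.
have [k rk] : exists k, r = k.+2 by exists r.-2; case: (r) r2 => [|[]].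
rewrite rk /=.
have abk : (a ^+ 2) ^+ k <= (b ^+ 2) ^+ k 
  by rewrite lerXn2r ?nnegrE ?sqr_ge0// lerXn2r ?nnegrE ?(ltW a0) ?(ltW b0).
have ak0 : 0 < (a ^+ 2) ^+ k by rewrite !exprn_gt0.
have -> : M * (b ^+ 2) ^+ k.+1 / (4 * (b * (a * (a ^+ 2) ^+ k.+1))) * a ^+ 2 * l =
   M * ((l * b / a) * ((b ^+ 2) ^+ k / (a ^+ 2) ^+ k)) / 4.
  rewrite [(b ^+ 2) ^+ k.+1]exprS [(a ^+ 2) ^+ k.+1]exprS.
  have := lt0r_neq0 ak0; move: ((a ^+ 2) ^+ k) ((b ^+ 2) ^+ k) => Y X Y0.
  by field; rewrite Y0 !lt0r_neq0.
rewrite ler_pM2r ?invr_gt0// ler_pM2l//.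
have h1 : lm <= l * b / a by rewrite ler_pdivlMr// mulrC.
apply: (le_trans h1); rewrite ler_peMr//.
  by rewrite divr_ge0 ?mulr_ge0// ?ltW//; lra.
by rewrite ler_pdivlMr// mul1r.
Qed.

(** Level d <= m may hold at most [b d] vertices and levels above m none. If this is respected, the
    excess is at most t / (4 sqrt m) times the sum of d^(-1/2) over d <= m, hence at most t / 2.
    Above m a single vertex already costs enough, because d > m >= M there. *)
Lemma high_part p r D (t m M K : R) : 0 < p <= 1 -> (0 < n)%N -> (2 <= r)%N ->
  0 < t -> 0 < m -> M * m ^+ r.-1 = t -> (m < n%:R -> M <= m) -> 0 <= K ->
  (forall d, (D < d <= n)%N -> let l := ln (d%:R / (n%:R * p)) in
     8 <= l /\ 16 * ln n%:R <= d%:R * l) ->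
  (forall x : R, m <= x -> D%:R <= x -> K <= ln (x / (n%:R * p))) ->
  prob (edge_prob p) (fun A => (trunc_stars r D A)%:R + t / 2 < (num_stars r A)%:R) <=
  expR (- (K * M / 32)).
Proof.
move=> p01 n0 r2 t0 m0 tE Mm K0 HD HK; have /andP[p0 p1] := p01.
have r0 : (0 < r)%N by apply: leq_trans r2.
have pp : 0 <= p <= 1 by rewrite ltW.
have q01 := @edge_prob01 R V p pp.
have nR : 0 < n%:R :> R by rewrite ltr0n.
have np0 : 0 < n%:R * p by rewrite mulr_gt0.
have M0 : 0 < M.
  by rewrite -(pmulr_lgt0 _ (exprn_gt0 r.-1 m0)) tE.
pose N A i := #|[set v | (i < deg A v)%N]|.
pose b (d : nat) : R := t / (4 * (Num.sqrt m * (Num.sqrt d%:R * d%:R ^+ r.-1))).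
have b0 d : (0 < d)%N -> 0 < b d.
  by move=> d0; rewrite divr_gt0// !mulr_gt0// ?sqrtr_gt0// ?exprn_gt0// ltr0n.
(* Index [i] stands for the degree level i + 1, since [N A i] counts the degrees exceeding i. *)
pose E (i : 'I_n) A := (D <= i)%N &&
  (if i.+1%:R <= m then b i.+1 < (N A i)%:R else (0 < N A i)%N).
have PE (i : 'I_n) : prob (edge_prob p) (E i) <= n%:R^-1 * expR (- (K * M / 32)).
  have [Di|Di] := leqP D i; last first.
    rewrite /prob (@eq_expect _ _ _ _ (fun=> 0)) ?expect_cst; last first.
      by move=> A; rewrite /E leqNgt Di.
    by rewrite mulr_ge0 ?invr_ge0 ?expR_ge0.
  have [l8 l16] : 8 <= ln (i.+1%:R / (n%:R * p)) /\
      16 * ln n%:R <= i.+1%:R * ln (i.+1%:R / (n%:R * p)) by apply: HD; rewrite ltnS Di ltn_ord.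
  have key k : (0 < k)%N ->
      K * M / 32 <= k%:R * i.+1%:R * ln (i.+1%:R / (n%:R * p)) / 8 ->
      (forall A, E i A -> (k <= N A i)%N) ->
      prob (edge_prob p) (E i) <= n%:R^-1 * expR (- (K * M / 32)).
    move=> k0 kK Ek; apply: (@le_trans _ _ _ _ _ (le_prob q01 Ek)).
    apply: (le_trans (prob_num_high p01 n0 k0 (ltn0Sn i) l8 l16)).
    by rewrite ler_pM2l ?invr_gt0// ler_expR lerN2.
  have [im|mi] := lerP i.+1%:R m; last first.
    apply: (key 1%N) => // [|A]; last by rewrite /E leNgt mi Di.
    have Kl : K <= ln (i.+1%:R / (n%:R * p)).
      by apply: HK; [exact: ltW|rewrite ler_nat ltnW].
    have MiM : M <= i.+1%:R.
      by rewrite (le_trans (Mm _)) ?ltW// (lt_le_trans mi)// ler_nat ltn_ord.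
    have : M * K <= i.+1%:R * ln (i.+1%:R / (n%:R * p)) by apply: ler_pM => //; exact: ltW.
    have : 0 <= M * K by rewrite mulr_ge0// ltW.
    by rewrite mul1r; lra.
  pose k := (Num.truncn (b i.+1)).+1.
  have bk : b i.+1 <= k%:R by rewrite ltW// truncnS_gt.
  apply: (key k) => // [|A]; last first.
    rewrite /E im => /andP[_ bN]; rewrite ltnNge; apply/negP => Nk.
    have := truncn_le (b i.+1); rewrite (ltW (b0 _ _))// => h.
    move: bN; rewrite ltNge (le_trans _ h)// ler_nat//.
  have i0 : 0 < i.+1%:R :> R by [].
  have mK : K <= ln (m / (n%:R * p)).
    by apply: HK => //; apply: le_trans im; rewrite ler_nat ltnW.
  have lmE : ln (m / (n%:R * p)) = ln (i.+1%:R / (n%:R * p)) + ln (m / i.+1%:R).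
    rewrite -lnM ?posrE ?divr_gt0//; congr ln; field; rewrite ?lt0r_neq0//.
  have l2 : 2 <= ln (i.+1%:R / (n%:R * p)) by lra.
  have := high_level_exponent r2 (ltn0Sn i) im t0 tE l2 lmE.
  rewrite -/(b i.+1) => H.
  have h1 : M * K <= M * ln (m / (n%:R * p)) by rewrite ler_pM2l.
  have h2 : b i.+1 * (i.+1%:R * ln (i.+1%:R / (n%:R * p))) <=
            k%:R * (i.+1%:R * ln (i.+1%:R / (n%:R * p))).
    by apply: ler_wpM2r => //; rewrite mulr_ge0//; lra.
  move: H h1 h2; rewrite !mulrA; lra.
apply: (@le_trans _ _ (\sum_(i < n) prob (edge_prob p) (E i))).
  apply: prob_union => // A; move=> XA; apply: contrapT => noE; move: XA.
  have {}noE (i : 'I_n) : ~~ E i A by apply/negP => Ei; apply: noE; exists i.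
  apply/negP; rewrite -leNgt.
  have := num_stars_le_trunc D A r0; rewrite -(ler_nat R) natrD => /le_trans; apply.
  rewrite lerD2l natr_sum.
  apply: (@le_trans _ _ (\sum_(i < n | i.+1%:R <= m) t / (4 * Num.sqrt m) * (Num.sqrt i.+1%:R)^-1)).
    rewrite (big_nat_widenl _ 0)//= big_mkord big_mkcond [leRHS]big_mkcond.
    apply: ler_sum => i _; have := noE i; rewrite /E negb_and.
    case: (D <= i)%N => /=; last by case: ifP => // im _; rewrite mulr_ge0 ?invr_ge0 ?sqrtr_ge0// divr_ge0// ?ltW// mulr_ge0// sqrtr_ge0.
    case: ifP => im; last by rewrite lt0n negbK -/(N A i) => /eqP ->; rewrite mul0n.
    rewrite -leNgt natrM -/(N A i) => Nb.
    have ci : 'C(i, r.-1)%:R <= i.+1%:R ^+ r.-1 :> R.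
      by rewrite -natrX ler_nat (leq_trans (bin_le_exp _ _))// leq_expl.
    apply: (@le_trans _ _ (b i.+1 * i.+1%:R ^+ r.-1)); first by apply: ler_pM.
    rewrite /b le_eqVlt; apply/orP; left; apply/eqP.
    have : i.+1%:R ^+ r.-1 != 0 :> R by rewrite expf_neq0.
    have : Num.sqrt i.+1%:R != 0 :> R by rewrite gt_eqF// sqrtr_gt0.
    have : Num.sqrt m != 0 by rewrite gt_eqF// sqrtr_gt0.
    move: (Num.sqrt m) (Num.sqrt _) (_ ^+ r.-1) => x y z x0 y0 z0.
    by field; rewrite x0 y0 z0.
  rewrite -mulr_sumr.
  apply: (@le_trans _ _ (t / (4 * Num.sqrt m) * (2 * Num.sqrt m))).
    rewrite ler_wpM2l ?sum_inv_sqrt_le ?ltW// divr_gt0// mulr_gt0// sqrtr_gt0//.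
  rewrite le_eqVlt; apply/orP; left; apply/eqP; field.
  by rewrite gt_eqF// sqrtr_gt0.
apply: (le_trans (ler_sum _ (fun i _ => PE i))).
rewrite sumr_const card_ord -[leLHS]mulr_natl mulrA divff ?mul1r// gt_eqF//.
Qed.

End HighDegrees.

(** * Orders of magnitude of the mean and the variance *)

Lemma ffact_ge_exp n k : (k <= n)%N -> ((n - k).+1 ^ k <= n ^_ k)%N.
Proof.
move=> kn; rewrite ffact_prod -[X in (_ ^ X <= _)%N](card_ord k) -prod_nat_const.
apply: leq_prod => i _; rewrite -subSn// ; have := ltn_ord i; lia.
Qed.

(** For 0 < r < n one has n <= 2r (n - r), which explains (2r)^r; the factorial turns a falling
    factorial into a binomial. *)
Definition bin_const r : nat := ((2 * r) ^ r * r`!)%N.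

Lemma bin_const_gt0 r : (0 < r)%N -> (0 < bin_const r)%N.
Proof. by move=> r0; rewrite /bin_const muln_gt0 fact_gt0 expn_gt0 muln_gt0 r0. Qed.

Lemma exp_le_bin n r : (0 < r < n)%N -> (n ^ r <= bin_const r * 'C(n.-1, r))%N.
Proof.
move=> /andP[r0 rn]; rewrite /bin_const -mulnA [(_`! * _)%N]mulnC bin_ffact.
apply: (@leq_trans ((2 * r) ^ r * (n - r) ^ r)).
  by rewrite -expnMn leq_expl//; nia.
rewrite leq_mul2l; apply/orP; right.
have -> : (n - r = (n.-1 - r).+1)%N by lia.
apply: ffact_ge_exp; lia.
Qed.

Lemma exp_le_bin_pred n r : (0 < r < n)%N ->
  (n ^ r.-1 <= bin_const r * 'C(n.-2, r.-1))%N.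
Proof.
move=> /andP[r0 rn]; have n0 : (0 < n)%N by lia.
rewrite -(leq_pmul2l n0) -expnS prednK//.
apply: leq_trans (@exp_le_bin n r _) _; first by rewrite r0.
have := mul_bin_diag n.-1 r.-1; rewrite prednK// => E.
rewrite mulnCA leq_mul2l; apply/orP; right.
apply: leq_trans (leq_pmull _ r0) _; rewrite -E leq_mul2r leq_pred orbT//.
Qed.

Section MomentBounds.
Context {R : realType} {V : finType} (r : nat) (p xi : R).
Hypothesis r2 : (2 <= r)%N.
Hypothesis rn : (r < #|V|)%N.
Hypothesis p_gt0 : 0 < p.
Hypothesis p_le : p <= 1 - xi.
Hypothesis xi01 : 0 < xi < 1.
Local Notation n := (#|V|).
Local Notation N := (n%:R : R).
Local Notation lam := (N * p).
Local Notation mu := (mean_stars V p r).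
Local Notation v := (var_stars V p r).
Local Notation B := ((bin_const r)%:R : R).

Let p01 : 0 <= p <= 1.
Proof. by have := p_gt0; have := p_le; case/andP: xi01 => x0 x1 ? ?; apply/andP; split; lra. Qed.
Let r0 : (0 < r)%N. Proof. exact: leq_trans r2. Qed.
Let N_gt0 : 0 < N. Proof. by rewrite ltr0n (leq_trans _ rn). Qed.
Let B_gt0 : 0 < B. Proof. by rewrite ltr0n bin_const_gt0. Qed.

Lemma mean_stars_le : mu <= N * lam ^+ r.
Proof.
rewrite /mean_stars natrM exprMn mulrA ler_wpM2r ?exprn_ge0 ?(ltW p_gt0)//.
rewrite ler_pM2l// -natrX ler_nat; apply: leq_trans (bin_le_exp _ _) _.
by rewrite leq_expl// leq_pred.
Qed.

Lemma mean_stars_ge : N * lam ^+ r <= B * mu.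
Proof.
rewrite /mean_stars natrM exprMn !mulrA ler_wpM2r ?exprn_ge0 ?(ltW p_gt0)//.
rewrite [B * N]mulrC -mulrA ler_pM2l// -natrX -natrM ler_nat exp_le_bin//.
by rewrite r0.
Qed.

Lemma var_stars_mean : xi * mu <= v.
Proof.
apply: le_trans (@var_stars_ge_mean R V p r p01 r0); rewrite mulrC ler_wpM2l//; last by have := p_le; lra.
by rewrite mulr_ge0 ?exprn_ge0// ltW.
Qed.

Lemma var_stars_lower : xi / B ^+ 2 * (N * lam ^+ r * lam ^+ r.-1) <= v.
Proof.
apply: le_trans (@var_stars_ge R V p r p01 r0).
have U : N * lam ^+ r / B <= mu by rewrite ler_pdivrMr// [mu * _]mulrC mean_stars_ge.
have W : lam ^+ r.-1 / B <= 'C(n.-2, r.-1)%:R * p ^+ r.-1.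
  rewrite ler_pdivrMr// exprMn [leRHS]mulrAC ler_wpM2r ?exprn_ge0 ?(ltW p_gt0)//.
  by rewrite -natrX -natrM ler_nat mulnC exp_le_bin_pred// r0.
have lam0 : 0 < lam by rewrite mulr_gt0.
have -> : xi / B ^+ 2 * (N * lam ^+ r * lam ^+ r.-1) =
    N * lam ^+ r / B * (lam ^+ r.-1 / B * xi) by field; rewrite gt_eqF.
apply: ler_pM => //.
- by rewrite divr_ge0 ?mulr_ge0 ?exprn_ge0// ltW.
- by rewrite mulr_ge0 ?divr_ge0 ?exprn_ge0// ?ltW//; case/andP: xi01.
- apply: ler_pM => //; last by have := p_le; lra.
    by rewrite divr_ge0 ?exprn_ge0// ltW.
  by case/andP: xi01; lra.
Qed.

End MomentBounds.

Lemma var_stars_upper (R : realType) (V : finType) (r : nat) (p : R) :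
  (0 < r)%N -> 0 <= p <= 1 -> 1 <= #|V|%:R * p ->
  var_stars V p r <= (r.+1 * 2 ^ r)%:R *
    (#|V|%:R * (#|V|%:R * p) ^+ r * (#|V|%:R * p) ^+ r.-1).
Proof.
move=> r0 p01 lam1; apply: (le_trans (@var_stars_le R V p r p01 r0 lam1)).
rewrite mulrCA ler_wpM2l// ler_wpM2r ?exprn_ge0//; first by lra.
rewrite /mean_stars natrM exprMn mulrA ler_wpM2r ?exprn_ge0//; first by case/andP: p01.
rewrite ler_wpM2l// -natrX ler_nat; apply: leq_trans (bin_le_exp _ _) _.
by rewrite leq_expl// leq_pred.
Qed.

(** * Comparison of the rates *)

Lemma leq_pred_double r : (2 <= r)%N -> (r <= r.-1 * 2)%N.
Proof. lia. Qed.

Section RealComparisons.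
Context {R : realType}.
Implicit Types (N p t tau c x y : R) (r k : nat).

(** This is M(t), with [tau] in the role of t^(1/r) so that no real power occurs. It is the order of
    the number of edges needed for t stars: with m = min (tau, N), take t / m^r vertices of degree
    m, in all t / m^(r-1) edges. *)
Definition upper_rate r N tau t : R := Num.max tau (t / N ^+ r.-1).

Lemma upper_rateE r N tau t : 0 < N -> 0 < tau -> (0 < r)%N -> t = tau ^+ r ->
  upper_rate r N tau t * (Num.min tau N) ^+ r.-1 = t.
Proof.
move=> N0 tau0 r0 ->; rewrite /upper_rate; have [tN|Nt] := leP tau N.
  rewrite max_l; first by rewrite -exprS prednK.
  by rewrite ler_pdivrMr ?exprn_gt0// -{1}(prednK r0) exprS ler_pM2l// lerXn2r ?nnegrE// ltW.
rewrite max_r; first by rewrite divfK// expf_neq0// gt_eqF.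
rewrite ler_pdivlMr ?exprn_gt0// -{2}(prednK r0) exprS ler_pM2l// lerXn2r ?nnegrE// ltW//.
Qed.

Lemma upper_rate_small r N tau t : 0 < N -> 0 < tau -> (0 < r)%N -> t = tau ^+ r ->
  Num.min tau N < N -> upper_rate r N tau t <= Num.min tau N.
Proof.
move=> N0 tau0 r0 tE; rewrite gt_min ltxx orbF => tN.
rewrite min_l ?(ltW tN)// /upper_rate ge_max lexx/= tE.
by rewrite ler_pdivrMr ?exprn_gt0// -{1}(prednK r0) exprS ler_pM2l// lerXn2r ?nnegrE// ltW.
Qed.

Lemma upper_rate_mul_le r N tau t y K : 0 < N -> 0 < tau -> (0 < r)%N -> t = tau ^+ r ->
  0 <= y -> y <= K * tau ^+ r.-1 -> y <= K * N ^+ r.-1 ->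
  upper_rate r N tau t * y <= K * t.
Proof.
move=> N0 tau0 r0 tE y0 h1 h2; rewrite /upper_rate; case: (leP tau) => _.
  rewrite mulrAC ler_pdivrMr ?exprn_gt0// mulrAC mulrC ler_wpM2r// tE exprn_ge0// ltW//.
by rewrite tE -(prednK r0) exprS /= mulrCA ler_pM2l.
Qed.

Lemma log_inv_mul_le1 p : 0 < p -> p * (1 - ln p) <= 1.
Proof.
move=> p0; have : ln p^-1 <= p^-1 - 1 by apply: ln_le_subr1; rewrite invr_gt0.
rewrite lnV ?posrE// => h.
have : p * (- ln p) <= p * (p^-1 - 1) by rewrite ler_pM2l.
by rewrite mulrBr divff ?gt_eqF//; lra.
Qed.

Lemma log_inv_ge1 p : 0 < p <= 1 -> 1 <= 1 - ln p.
Proof. by case/andP=> p0 p1; have := ln_le0 p1; lra. Qed.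

Lemma log_inv_le_sqrt N p : 0 < p -> 1 <= N * p -> 1 - ln p <= 2 * Num.sqrt N.
Proof.
move=> p0 Np; have N0 : 0 < N by rewrite -(pmulr_lgt0 _ p0); lra.
have : 0 <= ln (N * p) by exact: ln_ge0.
rewrite lnM ?posrE// => h.
have s0 : 0 < Num.sqrt N by rewrite sqrtr_gt0.
have : ln N = 2 * ln (Num.sqrt N).
  by rewrite -{1}(sqr_sqrtr (ltW N0)) lnXn// mulr_natl.
have := ln_le_subr1 s0; lra.
Qed.

(** Makes log (x / (np)) comparable with log (e/p). With lam = N p, the lower bound on t^2 =
    tau^(2r) is c lam^(2r) / p, so (tau / lam)^(2r) >= c / p; and x >= N gives x / lam >= 1 / p
    directly. *)
Lemma log_ratio r N p t tau c x : 0 < c <= 1 -> 0 < p <= 1 -> 0 < N -> 0 < tau ->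
  (0 < r)%N -> t = tau ^+ r ->
  c * (N * (N * p) ^+ r * (N * p) ^+ r.-1) <= t ^+ 2 ->
  Num.min tau N <= x -> 1 <= ln (x / (N * p)) ->
  1 - ln p <= (2 * r%:R + 1 - ln c) * ln (x / (N * p)).
Proof.
move=> /andP[c0 c1] /andP[p0 p1] N0 tau0 r0 tE tc mx l1.
set lam := N * p in tc l1 *.
have lam0 : 0 < lam by rewrite mulr_gt0.
have m0 : 0 < Num.min tau N by rewrite lt_min tau0.
have x0 : 0 < x by lra.
have xl : 0 < x / lam by rewrite divr_gt0.
have H : c / p <= (x / lam) ^+ (r + r).
  move: mx; rewrite ge_min => /orP[tx|Nx].
    rewrite expr_div_n ler_pdivlMr ?exprn_gt0//.
    apply: (@le_trans _ _ (t ^+ 2)).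
      apply: le_trans tc; rewrite le_eqVlt; apply/orP; left; apply/eqP.
      rewrite exprD -{2}(prednK r0) exprS /lam; field; rewrite gt_eqF//.
    by rewrite tE -exprM muln2 -addnn lerXn2r ?nnegrE// ltW.
  apply: (@le_trans _ _ (p^-1 ^+ (r + r))).
    apply: (@le_trans _ _ p^-1); first by rewrite ler_piMl// invr_ge0 ltW.
    have p1' : 1 <= p^-1 by rewrite invf_ge1.
    by rewrite -{1}[p^-1]expr1 ler_weXn2l// addn_gt0 r0.
  rewrite lerXn2r ?nnegrE ?invr_ge0 ?(ltW p0) ?(ltW xl)//.
  by rewrite /lam ler_pdivlMr// mulrCA mulVf ?gt_eqF// mulr1.
have : ln (c / p) <= ln ((x / lam) ^+ (r + r)).
  by rewrite ler_ln ?posrE ?divr_gt0 ?exprn_gt0.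
rewrite ln_div ?posrE// lnXn// -[X in _ <= X]mulr_natl natrD.
have lc : 0 <= - ln c by rewrite oppr_ge0 ln_le0.
move: l1 lc; set l := ln (x / lam); set lnc := ln c => l1 lc h.
have : (- lnc) <= (- lnc) * l by rewrite ler_peMr.
lra.
Qed.

(** Beyond the mean the bulk exponent is of order t / (np)^(r-1), and this is enough. Indeed y = tau
    / (np) satisfies y^r >= c N, so y^(r-1) >= c sqrt N because r <= 2 (r - 1), while log (e/p) <= 2
    sqrt N. *)
Lemma large_deviation_rate r N p t tau c : (2 <= r)%N -> 0 < c <= 1 -> 0 < p <= 1 ->
  1 <= N * p -> 0 < tau -> t = tau ^+ r -> c * (N * (N * p) ^+ r) <= t ->
  upper_rate r N tau t * (1 - ln p) <= 2 / c * (t / (N * p) ^+ r.-1).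
Proof.
move=> r2 /andP[c0 c1] /andP[p0 p1] lam1 tau0 tE ct.
have r0 : (0 < r)%N by exact: leq_trans r2.
have N0 : 0 < N by rewrite -(pmulr_lgt0 _ p0); lra.
set lam := N * p in lam1 ct *.
have lam0 : 0 < lam by lra.
have N1 : 1 <= N by apply: le_trans lam1 _; rewrite ler_piMr// ltW.
have L1 : 1 <= 1 - ln p by rewrite log_inv_ge1// p0.
have Ls := log_inv_le_sqrt p0 lam1.
have lamr : 0 < lam ^+ r.-1 by rewrite exprn_gt0.
have c2 : 2 <= 2 / c by rewrite ler_pdivlMr//; lra.
rewrite [2 / c * _]mulrA ler_pdivlMr// -[leLHS]mulrA; apply: upper_rate_mul_le => //.
- by rewrite mulr_ge0//; lra.
- have s1 : 1 <= Num.sqrt N by rewrite -[leLHS]sqrtr1 ler_wsqrtr.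
  have sE : Num.sqrt N ^+ 2 = N by rewrite sqr_sqrtr// ltW.
  pose y := tau / lam.
  have y0 : 0 < y by rewrite divr_gt0.
  have yr : c * N <= y ^+ r by rewrite expr_div_n ler_pdivlMr ?exprn_gt0// -tE -mulrA.
  have key : c * Num.sqrt N <= y ^+ r.-1.
    have [y1|y1] := leP 1 y.
      have cs0 : 0 <= c * Num.sqrt N by rewrite mulr_ge0//; lra.
      have yr0 : 0 <= y ^+ r.-1 by rewrite exprn_ge0//; lra.
      rewrite -(ler_pXn2r (ltn0Sn 1))//.
      rewrite exprMn sE -exprM; apply: (@le_trans _ _ (c * N)).
        by rewrite ler_pM2r// expr2 ler_piMr// ltW.
      by apply: (le_trans yr); rewrite ler_weXn2l// leq_pred_double.
    apply: (@le_trans _ _ (c * N)); first by rewrite ler_pM2l// -{2}sE expr2 ler_peMr//; lra.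
    apply: (le_trans yr); rewrite -{1}(prednK r0) exprS.
    by rewrite ler_piMl ?exprn_ge0// ltW.
  have -> : tau ^+ r.-1 = y ^+ r.-1 * lam ^+ r.-1 by rewrite expr_div_n divfK// gt_eqF.
  rewrite mulrA ler_pM2r//; apply: (le_trans Ls).
  apply: (@le_trans _ _ (2 / c * (c * Num.sqrt N))); last by rewrite ler_pM2l// divr_gt0.
  by rewrite mulrA divfK ?gt_eqF.
- apply: (@le_trans _ _ (N ^+ r.-1)); last by rewrite ler_peMl ?exprn_ge0 ?(ltW N0)//; lra.
  rewrite /lam exprMn mulrCA ler_piMr ?exprn_ge0 ?(ltW N0)//.
  apply: le_trans (log_inv_mul_le1 p0); rewrite mulrC ler_wpM2r//; first lra.
  by rewrite -{2}[p]expr1 ler_wiXn2l ?(ltW p0)// -ltnS prednK.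
Qed.

Lemma ln_pow_le k N : 1 <= N -> (0 < k)%N -> ln N ^+ k <= k%:R ^+ k * N.
Proof.
move=> N1 k0; have N0 : 0 < N by lra.
have kR : 0 < k%:R :> R by rewrite ltr0n.
have l0 : 0 <= ln N by exact: ln_ge0.
have : (ln N / k%:R) ^+ k <= expR (ln N / k%:R) ^+ k.
  rewrite lerXn2r ?nnegrE ?expR_ge0 ?divr_ge0// ?ltW//.
  by have := expR_ge1Dx (ln N / k%:R); lra.
rewrite -expRM_natl mulrCA divff ?gt_eqF// mulr1 lnK ?posrE// expr_div_n.
by rewrite ler_pdivrMr ?exprn_gt0// mulrC.
Qed.

(** A lower bound on the order of the mean keeps p above a power of 1 / N, so log (e/p) = O(log
    N). *)
Lemma log_inv_le_log r N p xi : (0 < r)%N -> 0 < p -> 0 < xi < 1 -> 0 < N -> 1 <= ln N ->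
  xi <= N * (N * p) ^+ r -> 1 - ln p <= (3 - ln xi) * ln N.
Proof.
move=> r0 p0 /andP[x0 x1] N0 l1 H.
have : ln xi <= ln (N * (N * p) ^+ r).
  by rewrite ler_ln ?posrE ?mulr_gt0 ?exprn_gt0 ?mulr_gt0.
rewrite lnM ?posrE ?exprn_gt0 ?mulr_gt0// lnXn ?mulr_gt0// -mulr_natl lnM ?posrE// => h.
have lx : ln xi <= 0 by rewrite ln_le0// ltW.
have rR : 1 <= r%:R :> R by rewrite ler1n.
move: l1 h lx; set l := ln N; set a := ln p; set b := ln xi => l1 h lx.
have : r%:R * (- a) <= r%:R * (2 * l - b) by nra.
rewrite ler_pM2l; last by lra.
nra.
Qed.

End RealComparisons.

(** * Upper bounds on the tail *)

Section UpperBound.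
Context {R : realType}.
Implicit Types (V : finType) (r : nat) (p t tau xi c : R).

Definition upper_tail V p r t : R :=
  prob (edge_prob p) (fun A : {set {set V}} => mean_stars V p r + t <= (num_stars r A)%:R).

(** The excess t is shared equally between the truncated count and the remainder. [D] stays free
    because its order depends on the range of p; the two conditions on it are those of
    [prob_num_high] at levels above [D]. *)
Lemma upper_tail_split V r D p t tau c : (2 <= r)%N -> 0 < p <= 1 -> (0 < #|V|)%N ->
  (0 < D)%N -> 0 < tau -> t = tau ^+ r -> 0 < c <= 1 ->
  let N := #|V|%:R : R in
  c * (N * (N * p) ^+ r * (N * p) ^+ r.-1) <= t ^+ 2 ->
  expR 8 * (N * p) <= D%:R ->
  (forall d, (D < d)%N -> 16 * ln N <= d%:R * ln (d%:R / (N * p))) ->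
  upper_tail V p r t <=
    expR (- (t ^+ 2 / (32 * r%:R * D%:R ^+ r.-1 * (mean_stars V p r + t)))) +
    expR (- (upper_rate r N tau t * (1 - ln p) / (32 * (2 * r%:R + 1 - ln c)))).
Proof.
move=> r2 p01 n0 D0 tau0 tE c01 N tc DE HD; have /andP[p0 p1] := p01.
have r0 : (0 < r)%N by exact: leq_trans r2.
have N0 : 0 < N by rewrite ltr0n.
have lam0 : 0 < N * p by rewrite mulr_gt0.
have pp : 0 <= p <= 1 by rewrite ltW.
have q01 := @edge_prob01 R V p pp.
have t0 : 0 < t by rewrite tE exprn_gt0.
have m0 : 0 < Num.min tau N by rewrite lt_min tau0.
have E8 x : D%:R <= x -> 8 <= ln (x / (N * p)).
  move=> Dx; rewrite -[leLHS](expRK (8 : R)) ler_ln ?posrE ?expR_gt0 ?divr_gt0//.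
    by rewrite ler_pdivlMr// (le_trans DE).
  by rewrite (lt_le_trans _ Dx)// ltr0n.
have c1 : 1 <= 2 * r%:R + 1 - ln c.
  have : ln c <= 0 by case/andP: c01 => _ c1; exact: ln_le0.
  have : 0 <= r%:R :> R by [].
  lra.
pose K := (1 - ln p) / (2 * r%:R + 1 - ln c).
have K0 : 0 <= K by rewrite divr_ge0//; [have := log_inv_ge1 p01; lra|lra].
have -> : upper_rate r N tau t * (1 - ln p) / (32 * (2 * r%:R + 1 - ln c)) =
    K * upper_rate r N tau t / 32.
  by rewrite /K; field; rewrite gt_eqF//; lra.
apply: (@le_trans _ _ (prob (edge_prob p) (fun A => mean_stars V p r + t / 2 <= (trunc_stars r D A)%:R)
   + prob (edge_prob p) (fun A : {set {set V}} => (trunc_stars r D A)%:R + t / 2 < (num_stars r A)%:R))).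
  apply: prob_union2 => // A X1; apply/orP.
  case: (lerP (mean_stars V p r + t / 2) (trunc_stars r D A)%:R) => [|X2]; [by left|right].
  by lra.
apply: lerD; first exact: bulk_tail.
apply: (@high_part R V p r D t (Num.min tau N)) => //.
- exact: upper_rateE.
- exact: upper_rate_small.
- move=> d /andP[Dd _]; split; last exact: HD.
  by apply: E8; rewrite ler_nat ltnW.
- move=> x mx Dx; rewrite /K ler_pdivrMr; last by lra.
  rewrite mulrC; apply: (@log_ratio R r N p t tau c x) => //.
  by have := E8 x Dx; lra.
Qed.

Lemma upper_tail_cantelli V r p t xi : 0 <= p <= 1 -> 0 < t -> 0 < xi ->
  xi ^+ 2 * var_stars V p r <= t ^+ 2 ->
  upper_tail V p r t <= (1 + xi ^+ 2)^-1.
Proof.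
move=> p01 t0 x0 tv; have q01 := @edge_prob01 R V p p01.
have := @cantelli_above R _ (edge_prob p) (fun A : {set {set V}} => (num_stars r A)%:R) t q01 t0.
rewrite expect_num_stars -/(mean_stars V p r) -/(upper_tail V p r t) -/(var_stars V p r).
have P0 : 0 <= upper_tail V p r t by exact: prob_ge0.
have v0 : 0 <= var_stars V p r by exact: expect_variance_ge0.
have x20 : 0 < xi ^+ 2 by rewrite exprn_gt0.
move: P0 v0 tv x20; set P := upper_tail _ _ _ _; set v := var_stars _ _ _; set z := xi ^+ 2 => P0 v0 tv z0 H.
rewrite -[leRHS]mul1r ler_pdivlMr; last by lra.
have t20 : 0 < t ^+ 2 by rewrite exprn_gt0.
have [v00|v1] := leP v 0.
  have : P * t ^+ 2 <= 0.
    by apply: (le_trans _ (le_trans H v00)); rewrite ler_wpM2l//; lra.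
  rewrite pmulr_lle0// => P00; nra.
rewrite -(ler_pM2r v1) mul1r; apply: le_trans H.
by rewrite -mulrA ler_wpM2l//; lra.
Qed.

(** The bound 2 exp (- x) says nothing for small x, where the bound strictly below 1 from
    [upper_tail_cantelli] is used instead. The ranges are separated at x = 2 ln 2: above it the
    factor 2 costs half of the exponent, and below it k x <= ln (1 + xi^2). *)
Lemma absorb_constant xi : 0 < xi -> exists2 k : R, 0 < k &
  forall q x : R, 0 <= x -> q <= 2 * expR (- x) -> q <= (1 + xi ^+ 2)^-1 ->
  q <= expR (- (k * x)).
Proof.
move=> xi0; have x20 : 0 < xi ^+ 2 by rewrite exprn_gt0.
have a0 : 0 < ln (1 + xi ^+ 2) by rewrite ln_gt0//; lra.
have l2 : 0 < ln 2 :> R by rewrite ln_gt0// ltr1n.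
have thE : (1 + xi ^+ 2)^-1 = expR (- ln (1 + xi ^+ 2)).
  by rewrite expRN lnK// posrE; lra.
rewrite thE; move: (ln (1 + xi ^+ 2)) a0 {thE} => a a0.
have kE : a / (2 * (ln 2 + a)) <= 1 / 2 by rewrite ler_pdivrMr//; lra.
have k0 : 0 < a / (2 * (ln 2 + a)) by rewrite divr_gt0//; lra.
exists (a / (2 * (ln 2 + a))) => // q x x0 q1 q2.
have [xl|xl] := leP (2 * ln 2) x.
  apply: (le_trans q1); rewrite -{1}[2 : R]lnK ?posrE// -expRD ler_expR.
  have := ler_wpM2r x0 kE; lra.
apply: (le_trans q2); rewrite ler_expR lerN2.
apply: (@le_trans _ _ (a / (2 * (ln 2 + a)) * (2 * ln 2))); first by rewrite ler_pM2l// ltW.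
rewrite mulrAC ler_pdivrMr; last by lra.
by rewrite ler_pM2l//; lra.
Qed.

End UpperBound.

Section DenseUpperBound.
Context {R : realType}.
Implicit Types (V : finType) (r : nat) (p t tau xi c : R).

(** Both parts come from mu + t <= 2 max (U, t). *)
Lemma bulk_exponent_ge (t mu U a A : R) : 0 < t -> 0 <= mu <= U -> 0 < a <= A ->
  (t <= U -> t ^+ 2 / (2 * A * U) <= t ^+ 2 / (a * (mu + t))) /\
  (U <= t -> t / (2 * A) <= t ^+ 2 / (a * (mu + t))).
Proof.
move=> t0 /andP[mu0 muU] /andP[a0 aA].
have mt : 0 < mu + t by lra.
have amt : 0 < a * (mu + t) by rewrite mulr_gt0.
split=> h.
  rewrite ler_wpM2l ?sqr_ge0// lef_pV2 ?posrE//; last by rewrite !mulr_gt0//; lra.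
  apply: (@le_trans _ _ (A * (2 * U))); last by rewrite le_eqVlt; apply/orP; left; apply/eqP; ring.
  by apply: ler_pM => //; lra.
rewrite ler_pdivlMr// mulrAC ler_pdivrMr ?mulr_gt0//; last lra.
have : a * (mu + t) <= A * (2 * t) by apply: ler_pM => //; lra.
move=> /(ler_wpM2l (ltW t0)); rewrite expr2; lra.
Qed.

(** U = N (N p)^r is the order of the mean. For t <= U the bound U (N p)^(r-1) = O(v) gives t^2 / v;
    for larger t, [large_deviation_rate] gives the other term of the minimum. *)
Lemma dense_bulk_exponent r N p t tau v mu a A c3 : (2 <= r)%N -> 0 < p <= 1 ->
  1 <= N * p -> 0 < tau -> t = tau ^+ r -> 0 <= mu <= N * (N * p) ^+ r ->
  0 < c3 -> c3 * (N * (N * p) ^+ r * (N * p) ^+ r.-1) <= v ->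
  0 < A -> 0 < a <= A * (N * p) ^+ r.-1 ->
  Num.min (c3 / (2 * A)) (1 / (4 * A)) *
    Num.min (t ^+ 2 / v) (upper_rate r N tau t * (1 - ln p)) <= t ^+ 2 / (a * (mu + t)).
Proof.
move=> r2 p01 lam1 tau0 tE muU c30 vW A0 aA.
have t0 : 0 < t by rewrite tE exprn_gt0.
have lam0 : 0 < N * p by lra.
have N0 : 0 < N by case/andP: p01 => p0 _; rewrite -(pmulr_lgt0 _ p0).
have [h1 h2] := bulk_exponent_ge t0 muU aA.
have H : N * (N * p) ^+ r <= t ->
    upper_rate r N tau t * (1 - ln p) <= 2 / 1 * (t / (N * p) ^+ r.-1).
  move=> Ut; apply: large_deviation_rate => //; first by rewrite ltr01 lexx.
  by rewrite mul1r.
have rate0 : 0 <= upper_rate r N tau t * (1 - ln p).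
  rewrite mulr_ge0//; first by rewrite le_max ltW.
  by have := log_inv_ge1 p01; lra.
move: (upper_rate _ _ _ _ * _) rate0 H => Q Q0 H.
have U0 : 0 < N * (N * p) ^+ r by rewrite mulr_gt0// exprn_gt0.
have lamr : 0 < (N * p) ^+ r.-1 by rewrite exprn_gt0.
move: ((N * p) ^+ r.-1) lamr (N * (N * p) ^+ r) U0 vW muU aA h1 h2 H => l l0 U U0 vW _ _ h1 h2 H.
have W0 : 0 < U * l by rewrite mulr_gt0.
have v0 : 0 < v by apply: lt_le_trans vW; rewrite mulr_gt0.
have a1 : 0 < c3 / (2 * A) by rewrite divr_gt0// mulr_gt0.
have a2 : 0 < 1 / (4 * A) by rewrite divr_gt0// mulr_gt0.
have tv : 0 <= t ^+ 2 / v by rewrite divr_ge0 ?sqr_ge0 ?(ltW v0).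
have m0 : 0 <= Num.min (t ^+ 2 / v) Q by rewrite le_min tv.
have m1 : 0 <= Num.min (c3 / (2 * A)) (1 / (4 * A)) by rewrite le_min (ltW a1) (ltW a2).
have [tU|Ut] := lerP t U.
  apply: le_trans (h1 tU); apply: (@le_trans _ _ (c3 / (2 * A) * (t ^+ 2 / v))).
    by apply: ler_pM => //; rewrite ge_min lexx.
  have -> : c3 / (2 * A) * (t ^+ 2 / v) = t ^+ 2 / (2 * A) * (c3 / v) by ring.
  have -> : t ^+ 2 / (2 * (A * l) * U) = t ^+ 2 / (2 * A) * (1 / (U * l)).
    by field; rewrite !gt_eqF.
  apply: ler_wpM2l; first by rewrite divr_ge0 ?sqr_ge0// mulr_ge0// ltW.
  by rewrite ler_pdivlMr// mulrAC ler_pdivrMr// mul1r.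
apply: le_trans (h2 (ltW Ut)); apply: (@le_trans _ _ (1 / (4 * A) * Q)).
  by apply: ler_pM => //; rewrite ge_min lexx orbT.
have {H} := H (ltW Ut); rewrite divr1 => H.
apply: (@le_trans _ _ (1 / (4 * A) * (2 * (t / l)))); first by rewrite ler_wpM2l// ltW.
by rewrite le_eqVlt; apply/orP; left; apply/eqP; field; rewrite !gt_eqF.
Qed.

Lemma dense_upper_bound r xi : (2 <= r)%N -> 0 < xi < 1 -> exists2 c : R, 0 < c &
  forall V p tau t, (r < #|V|)%N -> 0 < p <= 1 - xi -> 0 < tau -> t = tau ^+ r ->
  let N := #|V|%:R : R in let v := var_stars V p r in
  1 <= ln N -> ln N <= N * p -> xi ^+ 2 * v <= t ^+ 2 ->
  upper_tail V p r t <=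
    expR (- (c * Num.min (t ^+ 2 / v) (upper_rate r N tau t * (1 - ln p)))).
Proof.
move=> r2 xi01; have /andP[x0 x1] := xi01.
have r0 : (0 < r)%N by exact: leq_trans r2.
have B1 : 1 <= (bin_const r)%:R :> R by rewrite ler1n bin_const_gt0.
have [c3 /andP[c30 c31] c3E] : exists2 c3, 0 < c3 <= 1 & c3 = xi / (bin_const r)%:R ^+ 2.
  have B2 : 1 <= (bin_const r)%:R ^+ 2 :> R by rewrite exprn_ege1.
  have B20 : 0 < (bin_const r)%:R ^+ 2 :> R by apply: lt_le_trans B2.
  by eexists => //; rewrite divr_gt0//= ler_pdivrMr// mul1r (le_trans (ltW x1)).
have [c c01 cE] : exists2 c, 0 < c <= 1 & c = xi ^+ 2 * c3.
  eexists => //; rewrite mulr_gt0 ?exprn_gt0//= mulr_ile1// ?exprn_ge0 ?exprn_ile1 ?(ltW c30) ?(ltW x0) ?(ltW x1)//.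
have [E8 E80 E8E] : exists2 E8 : R, 9 <= E8 & E8 = expR 8.
  by exists (expR 8) => //; have := expR_ge1Dx (8 : R); lra.
have rR : 1 <= r%:R :> R by rewrite ler1n.
have [A A0 AE] : exists2 A, 0 < A & A = 32 * r%:R * (E8 + 1) ^+ r.-1.
  exists (32 * r%:R * (E8 + 1) ^+ r.-1) => //.
  by rewrite !mulr_gt0 ?exprn_gt0//; lra.
have [G G0 GE] : exists2 G, 0 < G & G = 32 * (2 * r%:R + 1 - ln c).
  exists (32 * (2 * r%:R + 1 - ln c)) => //.
  have : ln c <= 0 by case/andP: c01 => _; exact: ln_le0.
  by clear -rR; lra.
have [k k0 kP] := absorb_constant x0.
have [c1 c10 c1E] : exists2 c1, 0 < c1 & c1 = Num.min (c3 / (2 * A)) (1 / (4 * A)).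
  exists (Num.min (c3 / (2 * A)) (1 / (4 * A))) => //.
  by rewrite lt_min !divr_gt0// mulr_gt0.
exists (k * Num.min c1 G^-1); first by rewrite mulr_gt0// lt_min c10 invr_gt0.
move=> V p tau t rn /andP[p0 px] tau0 tE N v l1 lN tv.
have p1 : p <= 1 by clear -px x0; lra.
have p01 : 0 < p <= 1 by rewrite p0.
have pp : 0 <= p <= 1 by rewrite ltW.
have n0 : (0 < #|V|)%N by apply: leq_trans rn.
have lam1 : 1 <= N * p by apply: le_trans lN.
have lam0 : 0 < N * p by apply: lt_le_trans lam1.
have t0 : 0 < t by rewrite tE exprn_gt0.
have muU : 0 <= mean_stars V p r <= N * (N * p) ^+ r.
  rewrite (mean_stars_le rn p0) andbT /mean_stars mulr_ge0// exprn_ge0// ltW//.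
have vW : c3 * (N * (N * p) ^+ r * (N * p) ^+ r.-1) <= v.
  by rewrite c3E; exact: (@var_stars_lower R V r p xi r2 rn p0 px xi01).
have v0 : 0 <= v by apply: le_trans vW; rewrite !mulr_ge0 ?exprn_ge0// ltW.
have tc : c * (N * (N * p) ^+ r * (N * p) ^+ r.-1) <= t ^+ 2.
  by apply: le_trans tv; rewrite cE -[leLHS]mulrA ler_wpM2l// exprn_ge0// ltW.
(* Truncation at about e^8 n p makes log (d / np) >= 8 above [D]; since n p >= ln n, the condition
   16 ln n <= d log (d / np) follows with room to spare. *)
have D1 : E8 * (N * p) <= (Num.truncn (E8 * (N * p))).+1%:R by rewrite ltW// truncnS_gt.
have D2 : (Num.truncn (E8 * (N * p))).+1%:R <= (E8 + 1) * (N * p).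
  have : (Num.truncn (E8 * (N * p)))%:R <= E8 * (N * p).
    by rewrite truncn_le mulr_ge0 ?(ltW lam0)//; clear -E80; lra.
  by rewrite -natr1 mulrDl mul1r => h; apply: lerD.
move: (Num.truncn _).+1 (ltn0Sn (Num.truncn (E8 * (N * p)))) D1 D2 => D D0 D1 D2.
have HD d : (D < d)%N -> 16 * ln N <= d%:R * ln (d%:R / (N * p)).
  move=> Dd; have Dd' : D%:R <= d%:R :> R by rewrite ler_nat ltnW.
  have d0 : 0 < d%:R :> R by rewrite ltr0n (leq_trans _ Dd).
  have l8 : 8 <= ln (d%:R / (N * p)).
    rewrite -[leLHS](expRK (8 : R)) ler_ln ?posrE ?expR_gt0 ?divr_gt0//.
    by rewrite ler_pdivlMr// -E8E (le_trans D1).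
  have d9 : 9 * (N * p) <= d%:R.
    by apply: le_trans (le_trans D1 Dd'); rewrite ler_wpM2r// ltW.
  have : (9 * (N * p)) * 8 <= d%:R * ln (d%:R / (N * p)).
    by apply: ler_pM => //; rewrite mulr_ge0// ltW.
  by move: lN l1 lam0; move: (N * p) (ln N) (_ * ln _) => x y z; lra.
have Dr0 : 0 < 32 * r%:R * D%:R ^+ r.-1 :> R.
  by rewrite !mulr_gt0 ?exprn_gt0 ?ltr0n.
have Dle : 0 < 32 * r%:R * D%:R ^+ r.-1 :> R /\ 32 * r%:R * D%:R ^+ r.-1 <= A * (N * p) ^+ r.-1.
  split=> //.
  rewrite AE -[leRHS]mulrA ler_wpM2l ?mulr_ge0// -exprMn.
  by apply: lerXn2r; rewrite ?nnegrE// (le_trans _ D2).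
have rate0 : 0 <= upper_rate r N tau t * (1 - ln p).
  rewrite mulr_ge0//; first by rewrite le_max ltW.
  by rewrite (le_trans ler01)// log_inv_ge1.
have Psi0 : 0 <= Num.min (t ^+ 2 / v) (upper_rate r N tau t * (1 - ln p)).
  by rewrite le_min rate0 divr_ge0 ?sqr_ge0.
have c00 : 0 <= Num.min c1 G^-1 by rewrite le_min (ltW c10) invr_ge0 ltW.
have e1 := @dense_bulk_exponent r N p t tau v _ _ A c3 r2 p01 lam1 tau0 tE muU c30 vW A0 (introT andP Dle).
have E8D : expR 8 * (N * p) <= D%:R by rewrite -E8E.
have := @upper_tail_split R V r D p t tau c r2 p01 n0 D0 tau0 tE c01 tc E8D HD.
rewrite -GE -/N => split.
rewrite -mulrA; apply: kP; first by rewrite mulr_ge0.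
  apply: (le_trans split); rewrite [leRHS]mulr_natl mulr2n; apply: lerD; rewrite ler_expR lerN2.
    apply: le_trans e1; rewrite -c1E ler_wpM2r//.
    by rewrite ge_min lexx.
  rewrite [leRHS]mulrC; apply: ler_pM => //; first by rewrite ge_min lexx orbT.
  by rewrite ge_min lexx orbT.
exact: upper_tail_cantelli.
Qed.

End DenseUpperBound.

Section SparseUpperBound.
Context {R : realType}.
Implicit Types (V : finType) (r : nat) (N p t tau xi b c z : R).

(** Here [y] is the order of D^(r-1) and [Y] the power of log n provided by the hypothesis of (ii).
    For t <= mu that power pays for [y], through v >= xi mu; for t > mu a separate comparison of Q y
    with t is required. *)
Lemma sparse_bulk_exponent (t mu v Q a A y Y K xi : R) : 0 < t -> 0 < xi -> 0 < mu ->
  xi * mu <= v -> 0 <= Q -> v * (Q * Y) <= t ^+ 2 -> 0 < A -> 0 < y -> y <= Y ->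
  0 < a <= A * y -> 0 < K -> (mu <= t -> Q * y <= K * t) ->
  Num.min (xi / (2 * A)) (1 / (2 * A * K)) * Q <= t ^+ 2 / (a * (mu + t)).
Proof.
move=> t0 x0 mu0 muv Q0 tQ A0 y0 yY aA K0 HK.
have mumu : 0 <= mu <= mu by rewrite ltW/=.
have [h1 h2] := bulk_exponent_ge t0 mumu aA.
have [tm|mt] := lerP t mu.
  apply: le_trans (h1 tm); apply: (@le_trans _ _ (xi / (2 * A) * Q)).
    by rewrite ler_wpM2r// ge_min lexx.
  have Ay : 0 < 2 * (A * y) * mu by rewrite !mulr_gt0.
  rewrite ler_pdivlMr//; apply: le_trans tQ.
  have -> : xi / (2 * A) * Q * (2 * (A * y) * mu) = (xi * mu) * (Q * y).
    by field; rewrite gt_eqF.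
  by apply: ler_pM => //; rewrite ?mulr_ge0 ?ler_wpM2l ?(ltW x0) ?(ltW mu0) ?(ltW y0).
apply: le_trans (h2 (ltW mt)); apply: (@le_trans _ _ (1 / (2 * A * K) * Q)).
  by rewrite ler_wpM2r// ge_min lexx orbT.
rewrite ler_pdivlMr ?mulr_gt0//.
have -> : 1 / (2 * A * K) * Q * (2 * (A * y)) = Q * y / K.
  by field; rewrite !gt_eqF.
by rewrite ler_pdivrMr// mulrC [_ * K]mulrC mulrC HK// ltW.
Qed.

(** [ln_pow_le] with exponent 4r, followed by a fourth root. *)
Lemma ln_pow_le_fourth r N z b : (0 < r)%N -> 1 <= N -> 0 <= b * z -> N <= (b * z) ^+ 4 ->
  ln N ^+ r <= (4 * r%:R) ^+ r * b * z.
Proof.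
move=> r0 N1 bz Nz.
have l0 : 0 <= ln N by exact: ln_ge0.
have w0 : 0 <= (4 * r%:R) ^+ r * (b * z) by rewrite mulr_ge0// exprn_ge0// mulr_ge0.
have lr0 : 0 <= ln N ^+ r by rewrite exprn_ge0.
rewrite -mulrA -(ler_pXn2r (ltn0Sn 3))//.
rewrite exprMn -!exprM [(r * 4)%N]mulnC.
apply: (le_trans (ln_pow_le N1 _)); first by rewrite muln_gt0 r0.
by rewrite natrM ler_wpM2l// exprn_ge0// mulr_ge0.
Qed.

(** When t is at least of order sqrt N, powers of log N are negligible: tau^(r-1) is then at least
    of order N^(1/4), because tau^(2(r-1)) >= t for tau >= 1. *)
Lemma sparse_rate_polynomial r N tau t b : (2 <= r)%N -> 1 <= N -> 0 < tau ->
  t = tau ^+ r -> 1 <= b -> N <= (b * t) ^+ 2 ->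
  upper_rate r N tau t * ln N ^+ r <= (4 * r%:R) ^+ r * b * t.
Proof.
move=> r2 N1 tau0 tE b1 Nt.
have r0 : (0 < r)%N by exact: leq_trans r2.
have N0 : 0 < N by lra.
have b0 : 0 < b by lra.
have t0 : 0 < t by rewrite tE exprn_gt0.
apply: upper_rate_mul_le => //; first by rewrite exprn_ge0// ln_ge0.
  apply: ln_pow_le_fourth => //; first by rewrite mulr_ge0 ?exprn_ge0 ?ltW.
  have -> : (b * tau ^+ r.-1) ^+ 4 = (b * b * (tau ^+ r.-1 * tau ^+ r.-1)) ^+ 2 by ring.
  have [tau1|tau1] := lerP 1 tau.
    apply: (le_trans Nt); apply: lerXn2r; rewrite ?nnegrE ?mulr_ge0 ?exprn_ge0 ?(ltW b0) ?(ltW t0) ?(ltW tau0)//.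
    apply: ler_pM => //; rewrite ?(ltW b0) ?(ltW t0)//; first by rewrite ler_peMr// ltW.
    by rewrite tE -exprD addnn -muln2 ler_weXn2l// leq_pred_double.
  apply: (@le_trans _ _ (((b * t) ^+ 2) ^+ 2)).
    have : 1 <= (b * t) ^+ 2 by apply: le_trans Nt.
    by move: Nt; set w := (b * t) ^+ 2 => Nt w1; apply: (le_trans Nt); rewrite expr2 ler_peMr//; lra.
  have tt : t <= tau ^+ r.-1 by rewrite tE ler_wiXn2l ?leq_pred// ltW.
  apply: lerXn2r; rewrite ?nnegrE ?mulr_ge0 ?exprn_ge0 ?(ltW b0) ?(ltW t0) ?(ltW tau0)//.
  have -> : (b * t) ^+ 2 = b * b * (t * t) by ring.
  by rewrite ler_wpM2l ?mulr_ge0 ?(ltW b0)// ler_pM// ltW.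
apply: ln_pow_le_fourth => //; first by rewrite mulr_ge0 ?exprn_ge0 ?ltW.
have NN : N <= b * N ^+ r.-1.
  apply: (@le_trans _ _ (N ^+ r.-1)); last by rewrite ler_peMl// exprn_ge0// ltW.
  by rewrite -{1}[N]expr1 ler_weXn2l// -ltnS prednK.
apply: (le_trans NN); rewrite -{1}[b * _]expr1 ler_weXn2l//.
by apply: le_trans NN.
Qed.

(** The power of the logarithm in the hypothesis gives tau^(2r-1) >= xi^2 (ln N)^(2r), hence tau >=
    xi^2 ln N. So tau^(r-1) is at least of order ln N. *)
Lemma sparse_rate_logarithmic r N tau t xi : (2 <= r)%N -> 1 <= ln N -> 0 < N -> 0 < tau ->
  t = tau ^+ r -> 0 < xi < 1 -> xi ^+ 2 * (tau * ln N ^+ (2 * r)) <= t ^+ 2 ->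
  upper_rate r N tau t * ln N <= (xi ^+ 2) ^- r.-1 * t.
Proof.
move=> r2 l1 N0 tau0 tE /andP[x0 x1] H.
have r0 : (0 < r)%N by exact: leq_trans r2.
have r1 : (0 < r.-1)%N by rewrite -ltnS prednK.
have x20 : 0 < xi ^+ 2 by rewrite exprn_gt0.
have x21 : xi ^+ 2 <= 1 by rewrite exprn_ile1// ltW.
have xr0 : 0 < (xi ^+ 2) ^+ r.-1 by rewrite exprn_gt0.
have l0 : 0 < ln N by lra.
have lN : ln N <= N by exact/ltW/ln_sublinear.
have N1 : 1 <= N by lra.
have tl : xi ^+ 2 * ln N <= tau.
  have e : (2 * r = (r + r.-1).+1)%N by rewrite mul2n -addnn -{2}(prednK r0) addnS.
  have : (xi ^+ 2 * ln N) ^+ (r + r.-1) <= tau ^+ (r + r.-1).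
    rewrite -(ler_pM2l tau0) -exprS -e mulnC exprM -tE; apply: le_trans H.
    rewrite mulrCA ler_pM2l// exprMn; apply: ler_pM.
    - by rewrite exprn_ge0// ltW.
    - by rewrite exprn_ge0// ltW.
    - by rewrite -{2}[xi ^+ 2]expr1 ler_wiXn2l ?(ltW x20)// addn_gt0 r0.
    - by rewrite ler_weXn2l// e.
  by rewrite ler_pXn2r ?nnegrE ?addn_gt0 ?r0 ?mulr_ge0 ?(ltW x0) ?(ltW l0) ?(ltW tau0).
apply: upper_rate_mul_le => //; first by exact: ltW.
  rewrite mulrC ler_pdivlMr//; apply: (@le_trans _ _ ((xi ^+ 2 * ln N) ^+ r.-1)).
    rewrite [(_ * ln N) ^+ _]exprMn [leLHS]mulrC ler_pM2l// -{1}[ln N]expr1 ler_weXn2l//.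
  by apply: lerXn2r => //; rewrite nnegrE ?mulr_ge0 ?(ltW x0) ?(ltW l0) ?(ltW tau0).
apply: (le_trans lN); apply: (@le_trans _ _ (N ^+ r.-1)).
  by rewrite -{1}[N]expr1 ler_weXn2l.
rewrite ler_peMl ?exprn_ge0 ?(ltW N0)// invf_ge1// exprn_ile1// ltW//.
Qed.

Lemma sparse_upper_bound r xi : (2 <= r)%N -> 0 < xi < 1 -> exists2 c : R, 0 < c &
  forall V p tau t, (r < #|V|)%N -> 0 < p <= 1 - xi -> 0 < tau -> t = tau ^+ r ->
  let N := #|V|%:R : R in let v := var_stars V p r in
  1 <= ln N -> N * p <= ln N -> xi <= mean_stars V p r -> xi ^+ 2 * v <= t ^+ 2 ->
  v * (upper_rate r N tau t * (1 - ln p) * ln N ^+ (2 * r)) <= t ^+ 2 ->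
  upper_tail V p r t <= expR (- (c * (upper_rate r N tau t * (1 - ln p)))).
Proof.
move=> r2 xi01; have /andP[x0 x1] := xi01.
have r0 : (0 < r)%N by exact: leq_trans r2.
have B1 : 1 <= (bin_const r)%:R :> R by rewrite ler1n bin_const_gt0.
have [c3 /andP[c30 c31] c3E] : exists2 c3, 0 < c3 <= 1 & c3 = xi / (bin_const r)%:R ^+ 2.
  have B2 : 1 <= (bin_const r)%:R ^+ 2 :> R by rewrite exprn_ege1.
  have B20 : 0 < (bin_const r)%:R ^+ 2 :> R by apply: lt_le_trans B2.
  by eexists => //; rewrite divr_gt0//= ler_pdivrMr// mul1r (le_trans (ltW x1)).
have [c c01 cE] : exists2 c, 0 < c <= 1 & c = xi ^+ 2 * c3.
  eexists => //; rewrite mulr_gt0 ?exprn_gt0//= mulr_ile1// ?exprn_ge0 ?exprn_ile1 ?(ltW c30) ?(ltW x0) ?(ltW x1)//.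
have [E8 E80 E8E] : exists2 E8 : R, 9 <= E8 & E8 = expR 8.
  by exists (expR 8) => //; have := expR_ge1Dx (8 : R); lra.
have rR : 1 <= r%:R :> R by rewrite ler1n.
have [A A0 AE] : exists2 A, 0 < A & A = 32 * r%:R * (E8 + 1) ^+ r.-1.
  exists (32 * r%:R * (E8 + 1) ^+ r.-1) => //.
  by rewrite !mulr_gt0 ?exprn_gt0//; lra.
(* A constant level, for N lam^(2r) < 1 with lam = N p. There ln N <= 2r ln (1 / lam), so a degree d
   >= 32 r satisfies 16 ln N <= d ln (1 / lam). *)
pose D2 := ((Num.truncn E8).+1 + 32 * r)%N.
have [A2 A20 A2E] : exists2 A2 : R, 0 < A2 & A2 = 32 * r%:R * D2%:R ^+ r.-1.
  by exists (32 * r%:R * D2%:R ^+ r.-1) => //; rewrite !mulr_gt0 ?exprn_gt0 ?ltr0n.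
have [G G0 GE] : exists2 G, 0 < G & G = 32 * (2 * r%:R + 1 - ln c).
  exists (32 * (2 * r%:R + 1 - ln c)) => //.
  have : ln c <= 0 by case/andP: c01 => _; exact: ln_le0.
  by clear -rR; lra.
have [b b0 bE] : exists2 b, 0 < b & b = 3 - ln xi.
  exists (3 - ln xi) => //; have : ln xi < 0 by exact: ln_lt0.
  by move=> h; lra.
have [K1 K10 K1E] : exists2 K1, 0 < K1 & K1 = b * ((4 * r%:R) ^+ r * (bin_const r)%:R).
  exists (b * ((4 * r%:R) ^+ r * (bin_const r)%:R)) => //.
  by rewrite !mulr_gt0 ?exprn_gt0 ?mulr_gt0 ?ltr0n ?bin_const_gt0.
have [K2 K20 K2E] : exists2 K2, 0 < K2 & K2 = b * (xi ^+ 2) ^- r.-1.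
  by exists (b * (xi ^+ 2) ^- r.-1) => //; rewrite mulr_gt0 ?invr_gt0 ?exprn_gt0.
have [k k0 kP] := absorb_constant x0.
have [c1 c10 c1E] : exists2 c1, 0 < c1 & c1 = Num.min (xi / (2 * A)) (1 / (2 * A * K1)).
  exists (Num.min (xi / (2 * A)) (1 / (2 * A * K1))) => //.
  by rewrite lt_min !divr_gt0// !mulr_gt0.
have [c2 c20 c2E] : exists2 c2, 0 < c2 & c2 = Num.min (xi / (2 * A2)) (1 / (2 * A2 * K2)).
  exists (Num.min (xi / (2 * A2)) (1 / (2 * A2 * K2))) => //.
  by rewrite lt_min !divr_gt0// !mulr_gt0.
exists (k * Num.min (Num.min c1 c2) G^-1); first by rewrite mulr_gt0// !lt_min c10 c20 invr_gt0.
move=> V p tau t rn /andP[p0 px] tau0 tE N v l1 lN xmu tv tQ.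
have p1 : p <= 1 by clear -px x0; lra.
have p01 : 0 < p <= 1 by rewrite p0.
have pp : 0 <= p <= 1 by rewrite ltW.
have n0 : (0 < #|V|)%N by apply: leq_trans rn.
have N0 : 0 < N by rewrite ltr0n.
have N1 : 1 <= N by rewrite ler1n.
have lam0 : 0 < N * p by rewrite mulr_gt0.
have t0 : 0 < t by rewrite tE exprn_gt0.
have l0 : 0 < ln N by apply: lt_le_trans l1.
have mu0 : 0 < mean_stars V p r by apply: lt_le_trans xmu.
have Umu : N * (N * p) ^+ r <= (bin_const r)%:R * mean_stars V p r by exact: mean_stars_ge.
have xv : xi * mean_stars V p r <= v by exact: var_stars_mean.
have xU : xi <= N * (N * p) ^+ r by apply: le_trans xmu _; exact: mean_stars_le.
have vW : c3 * (N * (N * p) ^+ r * (N * p) ^+ r.-1) <= v.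
  by rewrite c3E; exact: (@var_stars_lower R V r p xi r2 rn p0 px xi01).
have tc : c * (N * (N * p) ^+ r * (N * p) ^+ r.-1) <= t ^+ 2.
  by apply: le_trans tv; rewrite cE -[leLHS]mulrA ler_wpM2l// exprn_ge0// ltW.
have Lb : 1 - ln p <= b * ln N by rewrite bE; exact: (log_inv_le_log r0).
have L1 : 1 <= 1 - ln p by exact: log_inv_ge1.
have M0 : 0 <= upper_rate r N tau t by rewrite le_max ltW.
have Mtau : tau <= upper_rate r N tau t by rewrite le_max lexx.
have rate0 : 0 <= upper_rate r N tau t * (1 - ln p).
  by rewrite mulr_ge0// (le_trans ler01).
have c00 : 0 <= Num.min (Num.min c1 c2) G^-1 by rewrite !le_min (ltW c10) (ltW c20) invr_ge0 ltW.
rewrite -[k * _ * _]mulrA; apply: kP; [by rewrite mulr_ge0| |exact: upper_tail_cantelli].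
have finish D : (0 < D)%N -> E8 * (N * p) <= D%:R ->
    (forall d, (D < d)%N -> 16 * ln N <= d%:R * ln (d%:R / (N * p))) ->
    Num.min c1 c2 * (upper_rate r N tau t * (1 - ln p)) <=
      t ^+ 2 / (32 * r%:R * D%:R ^+ r.-1 * (mean_stars V p r + t)) ->
    upper_tail V p r t <= 2 * expR (- (Num.min (Num.min c1 c2) G^-1 * (upper_rate r N tau t * (1 - ln p)))).
  move=> D0 DE HD e1; rewrite E8E in DE.
  have := @upper_tail_split R V r D p t tau c r2 p01 n0 D0 tau0 tE c01 tc DE HD.
  rewrite -GE -/N => split.
  apply: (le_trans split); rewrite [leRHS]mulr_natl mulr2n; apply: lerD; rewrite ler_expR lerN2.
    by apply: le_trans e1; rewrite ler_wpM2r// ge_min lexx.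
  rewrite [leRHS]mulrC; apply: ler_wpM2r => //; first by rewrite ge_min lexx orbT.
(* In the first case the squared order of the mean, (N lam^r)^2, is at least N, so truncation at
   order log n is affordable when t >= mu. In the second, lam is below N^(-1/(2r)) and the constant
   [D2] suffices. *)
have [big|small] := lerP 1 (N * (N * p) ^+ (r + r)).
  have D1 : E8 * ln N <= (Num.truncn (E8 * ln N)).+1%:R by rewrite ltW// truncnS_gt.
  have D1' : (Num.truncn (E8 * ln N)).+1%:R <= (E8 + 1) * ln N.
    have : (Num.truncn (E8 * ln N))%:R <= E8 * ln N.
      by rewrite truncn_le mulr_ge0 ?(ltW l0)//; clear -E80; lra.
    by rewrite -natr1 mulrDl mul1r => h; apply: lerD.
  move: (Num.truncn _).+1 (ltn0Sn (Num.truncn (E8 * ln N))) D1 D1' => D D0 D1 D1'.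
  have DE : E8 * (N * p) <= D%:R by apply: le_trans D1; rewrite ler_wpM2l//; clear -E80; lra.
  apply: (finish D) => // [d Dd|].
    have Dd' : D%:R <= d%:R :> R by rewrite ler_nat ltnW.
    have d0 : 0 < d%:R :> R by rewrite ltr0n (leq_trans _ Dd).
    have l8 : 8 <= ln (d%:R / (N * p)).
      rewrite -[leLHS](expRK (8 : R)) ler_ln ?posrE ?expR_gt0 ?divr_gt0//.
      by rewrite ler_pdivlMr// -E8E (le_trans DE).
    have d9 : 9 * ln N <= d%:R.
      by apply: le_trans (le_trans D1 Dd'); rewrite ler_wpM2r// ltW.
    have : (9 * ln N) * 8 <= d%:R * ln (d%:R / (N * p)).
      by apply: ler_pM => //; rewrite mulr_ge0// ltW.
    by move: l0; move: (d%:R * ln (d%:R / _)) (ln N) => y z; lra.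
  apply: (@le_trans _ _ (c1 * (upper_rate r N tau t * (1 - ln p)))).
    by rewrite ler_wpM2r// ge_min lexx.
  rewrite c1E; apply: (@sparse_bulk_exponent _ _ v _ _ A (ln N ^+ r.-1) (ln N ^+ (2 * r))) => //.
  - by rewrite exprn_gt0.
  - by rewrite ler_weXn2l// (leq_trans (leq_pred _))// leq_pmull.
  - apply/andP; split; first by rewrite !mulr_gt0 ?exprn_gt0 ?ltr0n.
    rewrite AE -[leRHS]mulrA ler_wpM2l ?mulr_ge0// -exprMn.
    by apply: lerXn2r; rewrite ?nnegrE// (le_trans _ D1').
  move=> mt; apply: (@le_trans _ _ (b * (upper_rate r N tau t * ln N ^+ r))).
    have lE : ln N ^+ r = ln N * ln N ^+ r.-1 by rewrite -exprS prednK.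
    have -> : b * (upper_rate r N tau t * ln N ^+ r) =
        upper_rate r N tau t * (b * ln N) * ln N ^+ r.-1 by rewrite lE; ring.
    by rewrite ler_wpM2r ?exprn_ge0 ?(ltW l0)// ler_wpM2l.
  rewrite K1E -[leRHS]mulrA ler_pM2l//; apply: sparse_rate_polynomial => //.
  have UBt : N * (N * p) ^+ r <= (bin_const r)%:R * t.
    by apply: (le_trans Umu); rewrite ler_wpM2l.
  apply: (@le_trans _ _ ((N * (N * p) ^+ r) ^+ 2)).
    rewrite exprMn -exprM muln2 -addnn expr2 -mulrA.
    by rewrite ler_peMr// ltW.
  by apply: lerXn2r; rewrite ?nnegrE ?mulr_ge0 ?exprn_ge0 ?(ltW N0) ?(ltW lam0) ?(ltW t0).
have lamle : N * p <= 1.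
  rewrite leNgt; apply/negP => lam1; move: small; rewrite ltNge => /negP; apply.
  by rewrite mulr_ege1// exprn_ege1// ltW.
have nl : ln N <= (2 * r)%:R * - ln (N * p).
  have : ln (N * (N * p) ^+ (r + r)) <= 0 by rewrite ln_le0// ltW.
  rewrite lnM ?posrE ?exprn_gt0// lnXn// -[_ *+ _]mulr_natl addnn -mul2n.
  by move=> h; rewrite mulrN -subr_le0 opprK.
have D2E : E8 <= D2%:R.
  by rewrite /D2 natrD ler_wpDr// ltW// truncnS_gt.
apply: (finish D2) => // [|d Dd|].
- apply: le_trans D2E; rewrite ler_piMr//; clear -E80; lra.
- have d0 : 0 < d%:R :> R by rewrite ltr0n (leq_trans _ Dd).
  have d1 : 1 <= d%:R :> R by rewrite ler1n (leq_trans _ Dd).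
  have d32 : (32 * r)%:R <= d%:R :> R.
    by rewrite ler_nat (leq_trans _ (ltnW Dd))// leq_addl.
  have h : - ln (N * p) <= ln (d%:R / (N * p)).
    by rewrite ln_div ?posrE// lerBrDr addNr; exact: ln_ge0.
  have h0 : 0 <= - ln (N * p) by rewrite oppr_ge0 ln_le0.
  apply: (@le_trans _ _ ((32 * r)%:R * - ln (N * p))); last by apply: ler_pM.
  rewrite (_ : (32 * r = 16 * (2 * r))%N); last by rewrite mulnA.
  by rewrite natrM -mulrA ler_pM2l.
- apply: (@le_trans _ _ (c2 * (upper_rate r N tau t * (1 - ln p)))).
    by rewrite ler_wpM2r// ge_min lexx orbT.
  rewrite c2E; apply: (@sparse_bulk_exponent _ _ v _ _ A2 1 (ln N ^+ (2 * r))) => //.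
  + by rewrite exprn_ege1.
  + apply/andP; split; first by rewrite !mulr_gt0 ?exprn_gt0 ?ltr0n.
    by rewrite A2E mulr1.
  move=> _; rewrite mulr1; apply: (@le_trans _ _ (b * (upper_rate r N tau t * ln N))).
    by rewrite [b * _]mulrCA ler_wpM2l.
  rewrite K2E -[leRHS]mulrA ler_pM2l//; apply: sparse_rate_logarithmic => //.
  apply: le_trans tQ; apply: ler_pM => //.
  + by rewrite exprn_ge0// ltW.
  + by rewrite mulr_ge0 ?exprn_ge0// ltW.
  + by apply: le_trans xv; rewrite expr2 ler_pM2l.
  + rewrite ler_wpM2r ?exprn_ge0 ?(ltW l0)//; apply: (le_trans Mtau).
    by rewrite ler_peMr.
Qed.

End SparseUpperBound.

(** * Lower bounds on the tail *)

Section PlantedLowerBound.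
Context {R : realType}.
Implicit Types (V : finType) (r k D e : nat) (N p t tau xi c H Q : R).

(** Chebyshev fails with probability at most xi / 4 and Markov with probability at most 1 - xi / 2,
    which leaves xi / 4. The Markov threshold must stay this close to the mean it controls: at full
    degree the planted stars exceed that mean only by the factor p^(-r). *)
Lemma planted_upper_tail V r p t xi k D : (2 <= r)%N -> (r < #|V|)%N -> 0 < xi < 1 ->
  0 < p <= 1 - xi -> 0 < t -> xi ^+ 2 * var_stars V p r <= t ^+ 2 ->
  (0 < k <= #|V|)%N -> (D <= #|V|.-1)%N ->
  (1 + 2 / xi ^+ 2) * t + (k * 'C(#|V|.-1, r))%:R * p ^+ r / (1 - xi / 2) <= (k * 'C(D, r))%:R ->
  p ^+ (k * D) * (xi / 4) <= upper_tail V p r t.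
Proof.
move=> r2 rn /andP[x0 x1] /andP[p0 px] t0 tv /andP[k0 kn] Dn H.
have p1 : p <= 1 by lra.
have pp : 0 <= p <= 1 by rewrite ltW.
have x20 : 0 < xi ^+ 2 by rewrite exprn_gt0.
have v0 : 0 < var_stars V p r.
  have mu0 : 0 < mean_stars V p r.
    rewrite /mean_stars mulr_gt0 ?exprn_gt0// ltr0n muln_gt0 bin_gt0 (leq_trans _ rn)//=.
    by rewrite -ltnS prednK// (leq_trans _ rn).
  have := @var_stars_mean R V r p xi r2 p0 px; rewrite x0 x1 => /(_ isT).
  by apply: lt_le_trans; rewrite mulr_gt0.
move: (var_stars V p r) v0 tv (@prob_planted R V p r k D (mean_stars V p r + t)) => v v0 tv plant.
pose s := Num.sqrt (4 * v / xi).
have s2 : s ^+ 2 = 4 * v / xi by rewrite sqr_sqrtr// divr_ge0// ?mulr_ge0// ltW.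
have s0 : 0 < s by rewrite sqrtr_gt0 divr_gt0// mulr_gt0.
have st : s <= 2 / xi ^+ 2 * t.
  have y0 : 0 <= 2 / xi ^+ 2 * t by rewrite mulr_ge0 ?divr_ge0// ltW.
  rewrite -(ler_pXn2r (ltn0Sn 1)) ?nnegrE ?(ltW s0)// s2 exprMn.
  have -> : (2 / xi ^+ 2) ^+ 2 * t ^+ 2 = 4 / xi * (t ^+ 2 / xi ^+ 3) by field; rewrite gt_eqF.
  have -> : 4 * v / xi = 4 / xi * v by ring.
  rewrite ler_wpM2l ?divr_ge0 ?(ltW x0)// ler_pdivlMr ?exprn_gt0//.
  apply: le_trans tv; rewrite mulrC ler_wpM2r ?(ltW v0)// ler_wiXn2l ?(ltW x0) ?(ltW x1)//.
have C0 : 0 < (k * 'C(#|V|.-1, r))%:R * p ^+ r.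
  rewrite mulr_gt0 ?exprn_gt0// ltr0n muln_gt0 k0 bin_gt0.
  by rewrite -ltnS prednK// (leq_trans _ rn).
have xh : 0 < 1 - xi / 2 by lra.
move: ((k * 'C(#|V|.-1, r))%:R * p ^+ r) C0 H plant => Z Z0 H plant.
have y0 : 0 < Z / (1 - xi / 2) by rewrite divr_gt0.
apply: le_trans (plant s (Z / (1 - xi / 2)) pp kn Dn s0 y0 _); last first.
  move: ((k * 'C(D, r))%:R) H => W H.
  rewrite mulrDl mul1r in H.
  move: (Z / _) (2 / _ * t) st H => a b st H; lra.
rewrite ler_wpM2l ?exprn_ge0 ?(ltW p0)// s2.
have -> : v / (4 * v / xi) = xi / 4 by field; rewrite !gt_eqF.
have -> : Z / (Z / (1 - xi / 2)) = 1 - xi / 2 by rewrite invf_div mulrCA divff ?mulr1// gt_eqF.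
lra.
Qed.

Lemma exp_power_lower p xi H M c0 e q : 0 < p <= 1 -> 0 < xi < 1 -> 0 < c0 -> c0 <= M ->
  0 <= H -> e%:R <= H * M -> p ^+ e * (xi / 4) <= q ->
  expR (- ((H + ln (4 / xi) / c0) * (M * (1 - ln p)))) <= q.
Proof.
move=> p01 /andP[x0 x1] c00 cM H0 eM; apply: le_trans; have /andP[p0 p1] := p01.
have L1 := log_inv_ge1 p01.
have M0 : 0 < M by lra.
have x4 : 0 < xi / 4 by rewrite divr_gt0.
have lx : 0 <= ln (4 / xi) by rewrite ln_ge0// ler_pdivlMr//; lra.
have pE : p ^+ e = expR (ln (p ^+ e)) by rewrite lnK// posrE exprn_gt0.
have xE : xi / 4 = expR (- ln (4 / xi)) by rewrite expRN lnK ?invf_div// posrE divr_gt0.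
rewrite pE xE -expRD ler_expR lnXn//.
rewrite -[ln p *+ e]mulr_natl mulrDl.
have h1 : e%:R * - ln p <= H * (M * (1 - ln p)).
  rewrite mulrA; apply: ler_pM => //; last lra.
  by rewrite oppr_ge0 ln_le0.
have h2 : ln (4 / xi) <= ln (4 / xi) / c0 * (M * (1 - ln p)).
  rewrite mulrAC ler_pdivlMr// ler_wpM2l//.
  by apply: (le_trans cM); rewrite ler_peMr// ltW.
by rewrite mulrN in h1; lra.
Qed.

(** From C(D, r) r! >= (D - r + 1)^r: the summand r in [D] offsets the shift, and the r-th power of
    r! A >= 1 covers both r! and A. *)
Lemma bin_ge_rate r tau t A : (0 < r)%N -> 0 <= tau -> t = tau ^+ r -> 1 <= A ->
  let D := (r + (Num.truncn (r`!%:R * A * tau)).+1)%N in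
  A * t <= 'C(D, r)%:R /\ D%:R <= r.+1%:R + r`!%:R * A * tau.
Proof.
move=> r0 tau0 tE A1 D.
have f1 : 1 <= r`!%:R :> R by rewrite ler1n fact_gt0.
have H1 : 1 <= r`!%:R * A by rewrite mulr_ege1.
have x0 : 0 <= r`!%:R * A * tau by rewrite mulr_ge0//; lra.
split.
  have : ((D - r).+1 ^ r <= 'C(D, r) * r`!)%N by rewrite bin_ffact ffact_ge_exp// leq_addr.
  rewrite -(ler_nat R) natrM natrX => h.
  rewrite -(ler_pM2r (_ : 0 < r`!%:R)); last by lra.
  apply: le_trans h; apply: (@le_trans _ _ ((r`!%:R * A * tau) ^+ r)).
    rewrite exprMn -tE mulrAC [A * _]mulrC ler_wpM2r ?tE ?exprn_ge0//.
    by rewrite -{1}[r`!%:R * A]expr1 ler_weXn2l.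
  apply: lerXn2r; rewrite ?nnegrE// /D addKn.
  apply: (@le_trans _ _ (Num.truncn (r`!%:R * A * tau)).+1%:R); first by rewrite ltW// truncnS_gt.
  by rewrite ler_nat.
have h : (Num.truncn (r`!%:R * A * tau))%:R <= r`!%:R * A * tau by rewrite truncn_le.
by rewrite /D natrD -!natr1; lra.
Qed.

(** One vertex of degree of order tau if this fits below n; otherwise tau is at least of order n,
    and about t / n^r vertices of full degree are planted; if that exceeds n vertices, the complete
    graph. Each choice uses O(M(t)) edges. *)
Lemma planted_lower_bound r xi c0 : (2 <= r)%N -> 0 < xi < 1 -> 0 < c0 ->
  exists2 C : R, 0 < C &
  forall V p tau t, (r < #|V|)%N -> 0 < p <= 1 - xi -> c0 <= tau -> t = tau ^+ r ->
  xi ^+ 2 * var_stars V p r <= t ^+ 2 ->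
  mean_stars V p r + t <= (num_stars r (complete_edges V))%:R ->
  expR (- (C * (upper_rate r #|V|%:R tau t * (1 - ln p)))) <= upper_tail V p r t.
Proof.
move=> r2 xi01 c00; have /andP[x0 x1] := xi01.
have r0 : (0 < r)%N by exact: leq_trans r2.
have B1 : 1 <= (bin_const r)%:R :> R by rewrite ler1n bin_const_gt0.
have B0 : 0 < (bin_const r)%:R :> R by rewrite ltr0n bin_const_gt0.
have [c /andP[c0' c1] cE] : exists2 c, 0 < c <= 1 & c = xi ^+ 2 * (xi / (bin_const r)%:R ^+ 2).
  have B2 : 1 <= (bin_const r)%:R ^+ 2 :> R by rewrite exprn_ege1.
  have B20 : 0 < (bin_const r)%:R ^+ 2 :> R by apply: lt_le_trans B2.
  have x20 : 0 < xi ^+ 2 by rewrite exprn_gt0.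
  have h1 : 0 < xi / (bin_const r)%:R ^+ 2 by rewrite divr_gt0.
  have h2 : xi / (bin_const r)%:R ^+ 2 <= 1 by rewrite ler_pdivrMr// mul1r (le_trans (ltW x1)).
  eexists => //; rewrite mulr_gt0//= mulr_ile1// ?exprn_ile1// ltW//.
have [A' A'1 A'E] : exists2 A', 1 <= A' & A' = 1 + 2 / xi ^+ 2.
  by exists (1 + 2 / xi ^+ 2) => //; rewrite lerDl divr_ge0// exprn_ge0// ltW.
(* [A'] covers t and the Chebyshev loss, 2 / c the Markov loss at a single planted vertex. *)
have [A A1 AE] : exists2 A, 1 <= A & A = A' + 2 / c.
  by exists (A' + 2 / c) => //; rewrite ler_wpDr// divr_ge0// ltW.
have [H1 H10 H1E] : exists2 H, 0 < H & H = r.+1%:R / c0 + r`!%:R * A.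
  exists (r.+1%:R / c0 + r`!%:R * A) => //.
  by rewrite addr_gt0 ?divr_gt0// mulr_gt0 ?ltr0n ?fact_gt0//; lra.
have [H2 H20 H2E] : exists2 H, 0 < H & H = 2 * A' * (bin_const r)%:R / xi + H1 ^+ r.
  exists (2 * A' * (bin_const r)%:R / xi + H1 ^+ r) => //.
  by rewrite addr_gt0 ?exprn_gt0// divr_gt0// !mulr_gt0//; lra.
have lx : 0 <= ln (4 / xi) by rewrite ln_ge0// ler_pdivlMr//; lra.
exists (H1 + H2 + ln (4 / xi) / c0); first by rewrite ltr_pwDl ?addr_gt0// divr_ge0// ltW.
move=> V p tau t rn pxi ctau tE tv Xt; have /andP[p0 px] := pxi.
have tau0 : 0 < tau by apply: lt_le_trans ctau.
have t0 : 0 < t by rewrite tE exprn_gt0.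
have n0 : (0 < #|V|)%N by apply: leq_trans rn.
have p1 : p <= 1 by clear -px x0; lra.
have p01 : 0 < p <= 1 by rewrite p0.
have pp : 0 <= p <= 1 by rewrite ltW.
have vW := @var_stars_lower R V r p xi r2 rn p0 px xi01.
have bN := @exp_le_bin #|V| r; rewrite r0 rn -(ler_nat R) natrM natrX in bN.
have {}bN := bN isT.
set N := #|V|%:R : R in vW bN *.
have N0 : 0 < N by rewrite ltr0n.
set M := upper_rate r N tau t.
have Mtau : tau <= M by rewrite le_max lexx.
have Mt : t / N ^+ r.-1 <= M by rewrite le_max lexx orbT.
have M0 : 0 < M by apply: lt_le_trans Mtau.
have lam0 : 0 < N * p by rewrite mulr_gt0.
have lamN : N * p <= N by rewrite ler_piMr// ltW.
(* The mean number of stars at one vertex is O(t): since N p <= N, the power (N p)^(2r) is at most N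
   (N p)^(2r-1) = O(v). *)
have lamt : (N * p) ^+ r <= t / c.
  rewrite ler_pdivlMr// -(ler_pXn2r (ltn0Sn 1)) ?nnegrE ?mulr_ge0 ?exprn_ge0 ?(ltW c0') ?(ltW lam0) ?(ltW t0)//.
  apply: le_trans tv; apply: (@le_trans _ _ (c * (N * (N * p) ^+ r * (N * p) ^+ r.-1))); last first.
    by rewrite cE -[leLHS]mulrA ler_wpM2l// exprn_ge0// ltW.
  have lr : (N * p) ^+ r = (N * p) ^+ r.-1 * (N * p) by rewrite -exprSr prednK.
  rewrite lr; have : 0 <= (N * p) ^+ r.-1 by rewrite exprn_ge0// ltW.
  move: ((N * p) ^+ r.-1) => l l_ge0.
  have -> : (l * (N * p) * c) ^+ 2 = c * (l * (N * p) * l) * (c * (N * p)) by ring.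
  have -> : c * (N * (l * (N * p)) * l) = c * (l * (N * p) * l) * N by ring.
  rewrite ler_wpM2l ?mulr_ge0 ?(ltW c0') ?(ltW N0) ?(ltW p0)//.
  by apply: le_trans lamN; rewrite ler_piMl// ltW.
have final e : e%:R <= (H1 + H2) * M -> p ^+ e * (xi / 4) <= upper_tail V p r t ->
    expR (- ((H1 + H2 + ln (4 / xi) / c0) * (M * (1 - ln p)))) <= upper_tail V p r t.
  move=> eM pe; apply: (exp_power_lower p01 xi01 c00 _ _ eM pe).
    exact: le_trans Mtau.
  by rewrite addr_ge0// ltW.
have [DA DH] := bin_ge_rate r0 (ltW tau0) tE A1.
move: (r + _)%N DA DH => D DA DH.
have D1 : D%:R <= H1 * tau.
  apply: (le_trans DH); rewrite H1E mulrDl lerD2r.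
  by rewrite mulrAC ler_pdivlMr// ler_wpM2l.
have xh : 0 < 1 - xi / 2 by clear -x1; lra.
have [Dn|nD] := leqP D #|V|.-1.
  apply: (final (1 * D)%N).
    rewrite mul1n (le_trans D1)//; apply: ler_pM; rewrite ?(ltW tau0) ?(ltW H10)//.
    by rewrite lerDl ltW.
  apply: planted_upper_tail => //; rewrite !mul1n; apply: le_trans DA.
  rewrite AE -A'E [leRHS]mulrDl lerD2l.
  have h : 'C(#|V|.-1, r)%:R * p ^+ r <= (N * p) ^+ r.
    rewrite exprMn ler_wpM2r ?exprn_ge0 ?(ltW p0)// -natrX ler_nat.
    by apply: leq_trans (bin_le_exp _ _) _; rewrite leq_expl// leq_pred.
  rewrite ler_pdivrMr//; apply: (le_trans h); apply: (le_trans lamt).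
  have -> : 2 / c * t * (1 - xi / 2) = t / c * (2 - xi) by field; rewrite gt_eqF.
  by rewrite ler_peMr ?divr_ge0 ?(ltW t0) ?(ltW c0')//; clear -x1; lra.
have ND : N <= H1 * tau by apply: le_trans D1; rewrite ler_nat -ltnS -(prednK n0).
have NHt : N ^+ r <= H1 ^+ r * t.
  by rewrite tE -exprMn; apply: lerXn2r; rewrite ?nnegrE ?mulr_ge0 ?(ltW N0) ?(ltW H10) ?(ltW tau0).
have Nr0 : 0 < N ^+ r by rewrite exprn_gt0.
(* After the Markov loss at least a fraction xi / 2 of the k C(n-1, r) planted stars is gained; [x]
   makes this cover A' t. *)
pose x := 2 * A' * (bin_const r)%:R * t / (xi * N ^+ r).
have x_ge0 : 0 <= x by rewrite !(mulr_ge0, divr_ge0, invr_ge0) ?(ltW x0) ?(ltW t0) ?(ltW Nr0)//; clear -A'1; lra.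
have kx : x <= (Num.truncn x).+1%:R by rewrite ltW// truncnS_gt.
have kH : (Num.truncn x).+1%:R <= H2 * (t / N ^+ r).
  have : (Num.truncn x)%:R <= x by rewrite truncn_le.
  have : 1 <= H1 ^+ r * (t / N ^+ r) by rewrite mulrA ler_pdivlMr// mul1r.
  have -> : H2 * (t / N ^+ r) = x + H1 ^+ r * (t / N ^+ r).
    by rewrite H2E /x; field; rewrite !gt_eqF.
  by rewrite -natr1 => h1 h2; apply: lerD.
move: (Num.truncn x).+1 (ltn0Sn (Num.truncn x)) kx kH => k k0 kx kH.
have kN : k%:R * N <= H2 * M.
  apply: (@le_trans _ _ (H2 * (t / N ^+ r.-1))); last by rewrite ler_pM2l.
  have -> : t / N ^+ r.-1 = t / N ^+ r * N by rewrite -{2}(prednK r0) exprS; field; rewrite ?expf_neq0 gt_eqF.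
  by rewrite mulrA ler_pM2r.
have HM : H2 * M <= (H1 + H2) * M by rewrite ler_pM2r// lerDr ltW.
have [kn|nk] := leqP k #|V|.
  apply: (final (k * #|V|.-1)%N).
    by apply: le_trans HM; apply: le_trans kN; rewrite natrM ler_wpM2l// ler_nat leq_pred.
  apply: planted_upper_tail => //; first by rewrite k0.
  rewrite -A'E.
  have pr : p ^+ r <= (1 - xi / 2) ^+ 2.
    apply: (@le_trans _ _ (1 - xi)); last by clear; rewrite expr2; nra.
    by apply: le_trans px; rewrite -{2}[p]expr1 ler_wiXn2l ?(ltW p0).
  have h1 : (k * 'C(#|V|.-1, r))%:R * p ^+ r / (1 - xi / 2) <= (k * 'C(#|V|.-1, r))%:R * (1 - xi / 2).
    by rewrite ler_pdivrMr// -mulrA -expr2 ler_wpM2l.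
  have h2 : A' * t <= (k * 'C(#|V|.-1, r))%:R * (xi / 2).
    rewrite -(ler_pM2l (_ : 0 < 2 * (bin_const r)%:R / xi)); last by rewrite divr_gt0// mulr_gt0.
    have -> : 2 * (bin_const r)%:R / xi * (A' * t) = x * N ^+ r.
      by rewrite /x; field; rewrite !gt_eqF.
    have -> : 2 * (bin_const r)%:R / xi * ((k * 'C(#|V|.-1, r))%:R * (xi / 2)) =
        k%:R * ((bin_const r)%:R * 'C(#|V|.-1, r)%:R) by rewrite natrM; field; rewrite gt_eqF.
    by apply: ler_pM => //; exact: ltW.
  move: h1 h2; move: ((k * 'C(#|V|.-1, r))%:R : R) => W; move: (W * _ / _) => a; lra.
apply: (final (#|V| ^ 2)%N).
  apply: le_trans HM; apply: le_trans kN; rewrite natrX expr2 ler_pM2r// ler_nat ltnW//.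
apply: le_trans (prob_full pp Xt); rewrite ler_piMr ?exprn_ge0 ?(ltW p0)//.
by clear -x1; lra.
Qed.

End PlantedLowerBound.

Section TiltedLowerBound.
Context {R : realType}.
Implicit Types (V : finType) (r : nat) (N p t tau xi c d : R).

Lemma mean_stars_tilted V r p d : (2 <= r)%N -> 0 <= p -> 0 <= d ->
  mean_stars V p r * (1 + 2 * d) <= mean_stars V (p * (1 + d)) r.
Proof.
move=> r2 p0 d0; rewrite /mean_stars exprMn mulrA ler_wpM2l ?mulr_ge0 ?exprn_ge0//.
apply: (@le_trans _ _ ((1 + d) ^+ 2)); last by rewrite ler_weXn2l//; lra.
by rewrite expr2; nra.
Qed.

(** With the relative increase K t / mu the exponent is K^2 t^2 N^2 p / (mu^2 (1 - p)), and mu^2 /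
    (N^2 p) is at least of order N (N p)^(2r-1), which bounds the variance from above. *)
Lemma tilted_exponent V r p xi K t : (2 <= r)%N -> (r < #|V|)%N -> 0 < p <= 1 - xi ->
  0 < xi < 1 -> 1 <= #|V|%:R * p -> 0 < t ->
  #|V|%:R ^+ 2 * ((p * (1 + K * t / mean_stars V p r) - p) ^+ 2 / (p * (1 - p))) <=
  K ^+ 2 * (bin_const r)%:R ^+ 2 * (r.+1 * 2 ^ r)%:R / xi * (t ^+ 2 / var_stars V p r).
Proof.
move=> r2 rn /andP[p0 px] /andP[x0 x1] lam1 t0; set mu := mean_stars V p r.
have r0 : (0 < r)%N by exact: leq_trans r2.
have p1 : p <= 1 by lra.
have pp : 0 <= p <= 1 by rewrite ltW.
have U := @mean_stars_ge R V r p r2 rn p0.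
have vmu : xi * mean_stars V p r <= var_stars V p r.
  by apply: (@var_stars_mean R V r p xi r2 p0 px); rewrite x0.
have vW := @var_stars_upper R V r p r0 pp lam1.
rewrite -/mu in U vmu.
move: (var_stars V p r) vmu vW => v vmu vW.
have n0 : (0 < #|V|)%N by apply: leq_trans rn.
have N0 : 0 < #|V|%:R :> R by rewrite ltr0n.
move: (#|V|%:R : R) N0 lam1 U vW => N N0 lam1 U vW.
have lam0 : 0 < N * p by rewrite mulr_gt0.
have B0 : 0 < (bin_const r)%:R :> R by rewrite ltr0n bin_const_gt0.
move: ((bin_const r)%:R : R) B0 U => B B0 U.
have U0 : 0 < N * (N * p) ^+ r by rewrite mulr_gt0// exprn_gt0.
have mu0 : 0 < mu by rewrite -(pmulr_rgt0 _ B0); apply: lt_le_trans U.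
have v0 : 0 < v by apply: lt_le_trans vmu; rewrite mulr_gt0.
clearbody mu.
have c40 : 0 < (r.+1 * 2 ^ r)%:R :> R by rewrite ltr0n muln_gt0 expn_gt0.
move: ((r.+1 * 2 ^ r)%:R : R) c40 vW => c4 c40 vW.
have np : 0 < 1 - p by lra.
have -> : N ^+ 2 * ((p * (1 + K * t / mu) - p) ^+ 2 / (p * (1 - p))) =
    K ^+ 2 * t ^+ 2 * (N ^+ 2 * p / mu ^+ 2 / (1 - p)) by field; rewrite !gt_eqF.
have -> : K ^+ 2 * B ^+ 2 * c4 / xi * (t ^+ 2 / v) =
    K ^+ 2 * t ^+ 2 * (B ^+ 2 * c4 / v / xi) by field; rewrite !gt_eqF.
apply: ler_wpM2l; first by rewrite -exprMn sqr_ge0.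
apply: ler_pM.
- by rewrite !(mulr_ge0, divr_ge0, invr_ge0) ?exprn_ge0 ?(ltW p0) ?(ltW mu0) ?(ltW N0).
- by rewrite invr_ge0 ltW.
- rewrite ler_pdivlMr// mulrAC ler_pdivrMr ?exprn_gt0//.
  apply: (@le_trans _ _ (c4 * (N * (N * p) ^+ r) ^+ 2)).
    have -> : N ^+ 2 * p * v = N * (N * p) * v by ring.
    apply: (@le_trans _ _ (N * (N * p) * (c4 * (N * (N * p) ^+ r * (N * p) ^+ r.-1)))).
      by rewrite ler_wpM2l// mulr_ge0// ltW.
    have lr : (N * p) ^+ r = (N * p) ^+ r.-1 * (N * p) by rewrite -exprSr prednK.
    rewrite lr; move: ((N * p) ^+ r.-1) => l.
    by rewrite le_eqVlt; apply/orP; left; apply/eqP; ring.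
  have -> : B ^+ 2 * c4 * mu ^+ 2 = c4 * (B * mu) ^+ 2 by ring.
  by rewrite ler_pM2l// lerXn2r ?nnegrE ?(ltW U0) ?mulr_ge0 ?(ltW B0) ?(ltW mu0).
- by rewrite lef_pV2 ?posrE//; lra.
Qed.

Lemma tilted_lower_bound r xi : (2 <= r)%N -> 0 < xi < 1 ->
  exists K C : R, [/\ 1 <= K, 0 < C &
  forall V p t, (r < #|V|)%N -> 0 < p <= 1 - xi -> 1 <= #|V|%:R * p -> 0 < t ->
  var_stars V p r <= t ^+ 2 -> K * t <= mean_stars V p r ->
  expR (- (C * (t ^+ 2 / var_stars V p r))) <= upper_tail V p r t].
Proof.
move=> r2 xi01; have /andP[x0 x1] := xi01.
have r0 : (0 < r)%N by exact: leq_trans r2.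
have B0 : 0 < (bin_const r)%:R :> R by rewrite ltr0n bin_const_gt0.
have [c3 c30 c3E] : exists2 c3, 0 < c3 & c3 = xi / (bin_const r)%:R ^+ 2.
  by exists (xi / (bin_const r)%:R ^+ 2) => //; rewrite divr_gt0 ?exprn_gt0.
have c40 : 0 < (r.+1 * 2 ^ r)%:R :> R by rewrite ltr0n muln_gt0 expn_gt0.
have [K5 K50 K5E] : exists2 K5, 0 < K5 & K5 = (r.+1 * 2 ^ r)%:R * 4 ^+ r / c3.
  by exists ((r.+1 * 2 ^ r)%:R * 4 ^+ r / c3) => //; rewrite divr_gt0// mulr_gt0// exprn_gt0.
(* This choice gives K5 <= K^2 / 2. As the tilted variance is at most K5 times the original one,
   Chebyshev with margin K t leaves probability at least 1 / 2. *)
have [K K1 KE] : exists2 K, 1 <= K & K = 2 * K5 + 1.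
  by exists (2 * K5 + 1) => //; lra.
have K0 : 0 < K by lra.
have [E E0 EE] : exists2 E, 0 <= E &
    E = K ^+ 2 * (bin_const r)%:R ^+ 2 * (r.+1 * 2 ^ r)%:R / xi.
  exists (K ^+ 2 * (bin_const r)%:R ^+ 2 * (r.+1 * 2 ^ r)%:R / xi) => //.
  by rewrite divr_ge0 ?(ltW x0)// mulr_ge0// mulr_ge0// exprn_ge0// ltW.
have l4 : 0 < ln 4 :> R by rewrite ln_gt0// ltr1n.
(* The factor 1 / xi gives K t / mu <= xi, so the tilted probability is at most (1 - xi) (1 + xi) <=
   1. The term ln 4 comes from (1 / 2)^2 and is absorbed because t^2 / v >= 1. *)
exists (K / xi), (ln 4 + E); split.
- by rewrite ler_pdivlMr//; lra.
- by rewrite ltr_pwDl.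
move=> V p t rn pxi lam1 t0 vt Kt; have /andP[p0 px] := pxi.
have p1 : p < 1 by clear -px x0; lra.
have p01 : 0 < p < 1 by rewrite p0.
have pp : 0 <= p <= 1 by rewrite !ltW.
have vW := @var_stars_lower R V r p xi r2 rn p0 px xi01.
rewrite -c3E in vW.
have mu0 : 0 < mean_stars V p r by apply: lt_le_trans Kt; rewrite mulr_gt0// divr_gt0.
have v0 : 0 < var_stars V p r.
  apply: lt_le_trans (@var_stars_mean R V r p xi r2 p0 px xi01); exact: mulr_gt0.
have expo := @tilted_exponent V r p xi K t r2 rn pxi xi01 lam1 t0.
rewrite /= -EE in expo.
pose d := K * t / mean_stars V p r.
rewrite -/d in expo.
have d0 : 0 <= d by rewrite /d divr_ge0 ?(ltW mu0) ?mulr_ge0 ?(ltW K0) ?(ltW t0).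
have dx : d <= xi.
  have -> : d = xi * (K / xi * t) / mean_stars V p r by rewrite /d; field; rewrite !gt_eqF.
  by rewrite ler_pdivrMr// ler_pM2l.
have dmu : mean_stars V p r * d = K * t by rewrite mulrCA divff ?mulr1// gt_eqF.
have mu' := @mean_stars_tilted V r p d r2 (ltW p0) d0.
rewrite mulrDr mulr1 mulrCA dmu in mu'.
have p'01 : 0 <= p * (1 + d) <= 1.
  apply/andP; split; first by rewrite mulr_ge0 ?(ltW p0)//; lra.
  apply: (@le_trans _ _ ((1 - xi) * (1 + xi))); last by clear; nra.
  by apply: ler_pM; rewrite ?(ltW p0)//; lra.
have lam'1 : 1 <= #|V|%:R * (p * (1 + d)).
  by apply: (le_trans lam1); rewrite mulrA ler_peMr//; lra.
have v' := @var_stars_upper R V r _ r0 p'01 lam'1.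
have {}v' : var_stars V (p * (1 + d)) r <= K5 * var_stars V p r.
  apply: (le_trans v'); rewrite K5E.
  apply: (@le_trans _ _ ((r.+1 * 2 ^ r)%:R * 4 ^+ r *
     (#|V|%:R * (#|V|%:R * p) ^+ r * (#|V|%:R * p) ^+ r.-1))); last first.
    rewrite [_ / c3 * _]mulrAC ler_pdivlMr// -[leLHS]mulrA ler_wpM2l//.
    by rewrite mulrC.
  rewrite -[leRHS]mulrA ler_wpM2l//.
  have lam0 : 0 <= #|V|%:R * p by lra.
  have n00 : 0 <= #|V|%:R :> R by [].
  have d2 : 1 + d <= 2 by lra.
  move: (#|V|%:R : R) lam0 n00 => N lam0 n00.
  rewrite [N * (p * _)]mulrA; move: (N * p) lam0 => l l0; rewrite !exprMn.
  have -> : N * (l ^+ r * (1 + d) ^+ r) * (l ^+ r.-1 * (1 + d) ^+ r.-1) =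
    ((1 + d) ^+ r * (1 + d) ^+ r.-1) * (N * l ^+ r * l ^+ r.-1) by ring.
  apply: ler_wpM2r; first by rewrite !mulr_ge0// exprn_ge0.
  have -> : 4 = 2 * 2 :> R by ring.
  rewrite exprMn; apply: ler_pM; rewrite ?exprn_ge0//; try lra.
    by apply: lerXn2r; rewrite ?nnegrE//; lra.
  apply: (@le_trans _ _ (2 ^+ r.-1)); first by apply: lerXn2r; rewrite ?nnegrE//; lra.
  by rewrite ler_weXn2l ?leq_pred//; lra.
pose s := mean_stars V (p * (1 + d)) r - mean_stars V p r - t.
have sK : K * t <= s.
  have : 1 * t <= K * t by rewrite ler_pM2r.
  by rewrite /s mul1r => h; lra.
have Kt0 : 0 < K * t by rewrite mulr_gt0.
have s0 : 0 < s by apply: lt_le_trans sK.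
have q'01 := @edge_prob01 R V _ p'01.
have half : 1 / 2 <= prob (edge_prob (p * (1 + d)))
    (fun A : {set {set V}} => mean_stars V p r + t <= (num_stars r A)%:R).
  have := @chebyshev_below R _ (edge_prob (p * (1 + d)))
    (fun A : {set {set V}} => (num_stars r A)%:R) s q'01 (ltW s0).
  rewrite expect_num_stars -/(mean_stars V (p * (1 + d)) r) -/(var_stars V (p * (1 + d)) r).
  have -> : mean_stars V (p * (1 + d)) r - s = mean_stars V p r + t by rewrite /s; ring.
  set P0 := prob _ _ => cheb.
  have P0h : P0 <= 1 / 2.
    rewrite -(ler_pM2r (exprn_gt0 2 s0)); apply: (le_trans cheb).
    apply: (le_trans v'); apply: (@le_trans _ _ (1 / 2 * (K * t) ^+ 2)); last first.
      by rewrite ler_pM2l// lerXn2r ?nnegrE ?(ltW Kt0) ?(ltW s0).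
    have KK : K5 <= 1 / 2 * K ^+ 2 by rewrite KE; clear -K50; nra.
    by rewrite exprMn mulrA; apply: ler_pM => //; exact: ltW.
  have : 1 - P0 <= prob (edge_prob (p * (1 + d)))
    (fun A : {set {set V}} => mean_stars V p r + t <= (num_stars r A)%:R).
    by rewrite -probC; apply: le_prob => // A /=; rewrite -ltNge => /ltW.
  by apply: le_trans; lra.
have := @tilted_prob R V p (p * (1 + d))
  (fun A : {set {set V}} => mean_stars V p r + t <= (num_stars r A)%:R) p01 p'01.
rewrite -/(upper_tail V p r t) => tilt.
have {}tilt : (1 / 2) ^+ 2 <= upper_tail V p r t * expR (E * (t ^+ 2 / var_stars V p r)).
  apply: (@le_trans _ _ (prob (edge_prob (p * (1 + d)))
    (fun A : {set {set V}} => mean_stars V p r + t <= (num_stars r A)%:R) ^+ 2)).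
    by apply: lerXn2r => //; rewrite nnegrE// (le_trans _ half).
  apply: (le_trans tilt); apply: ler_wpM2l; last by rewrite ler_expR.
  by apply: prob_ge0; exact: edge_prob01.
rewrite -(ler_pM2r (expR_gt0 (E * (t ^+ 2 / var_stars V p r)))); apply: le_trans tilt.
rewrite -expRD mulrDl opprD subrK.
have -> : (1 / 2) ^+ 2 = expR (- ln 4) :> R by rewrite expRN lnK ?posrE//; field.
rewrite ler_expR lerN2 ler_peMr ?(ltW l4)//.
by rewrite ler_pdivlMr// mul1r.
Qed.

(** Tilting is available only while t is at most a small multiple of mu. Beyond that M(t) log (e/p)
    = O(t^2 / v), and planting alone has the right order. *)
Lemma dense_lower_bound r xi : (2 <= r)%N -> 0 < xi < 1 -> exists2 C : R, 0 < C &
  forall V p tau t, (r < #|V|)%N -> 0 < p <= 1 - xi -> 1 <= #|V|%:R * p ->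
  0 < tau -> t = tau ^+ r -> var_stars V p r <= t ^+ 2 ->
  mean_stars V p r + t <= (num_stars r (complete_edges V))%:R ->
  expR (- (C * Num.min (t ^+ 2 / var_stars V p r) (upper_rate r #|V|%:R tau t * (1 - ln p))))
    <= upper_tail V p r t.
Proof.
move=> r2 xi01; have /andP[x0 x1] := xi01.
have r0 : (0 < r)%N by exact: leq_trans r2.
have B1 : 1 <= (bin_const r)%:R :> R by rewrite ler1n bin_const_gt0.
have B0 : 0 < (bin_const r)%:R :> R by rewrite ltr0n bin_const_gt0.
have [c3 /andP[c30 c31] c3E] : exists2 c3, 0 < c3 <= 1 & c3 = xi / (bin_const r)%:R ^+ 2.
  have B2 : 1 <= (bin_const r)%:R ^+ 2 :> R by rewrite exprn_ege1.
  have B20 : 0 < (bin_const r)%:R ^+ 2 :> R by apply: lt_le_trans B2.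
  by eexists => //; rewrite divr_gt0//= ler_pdivrMr// mul1r (le_trans (ltW x1)).
have [C1 C10 planted] := @planted_lower_bound R r xi c3 r2 xi01 c30.
have [K [C2 [K1 C20 tilted]]] := tilted_lower_bound r2 xi01.
have [c c01 cE] : exists2 c, 0 < c <= 1 & c = ((bin_const r)%:R * K)^-1.
  have BK : 1 <= (bin_const r)%:R * K by rewrite mulr_ege1.
  have BK0 : 0 < (bin_const r)%:R * K by lra.
  by eexists => //; rewrite invr_gt0 BK0 invf_le1.
have /andP[c0 c1] := c01.
have c40 : 0 < (r.+1 * 2 ^ r)%:R :> R by rewrite ltr0n muln_gt0 expn_gt0.
have [C3 C30 C3E] : exists2 C3, 0 < C3 & C3 = 2 / c * ((r.+1 * 2 ^ r)%:R / c).
  by exists (2 / c * ((r.+1 * 2 ^ r)%:R / c)) => //; rewrite mulr_gt0 ?divr_gt0.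
exists (C1 * (1 + C3) + C2); first by rewrite addr_gt0// mulr_gt0// addr_gt0.
move=> V p tau t rn pxi lam1 tau0 tE vt Xt; have /andP[p0 px] := pxi.
have p1 : p <= 1 by clear -px x0; lra.
have p01 : 0 < p <= 1 by rewrite p0.
have pp : 0 <= p <= 1 by rewrite ltW.
have t0 : 0 < t by rewrite tE exprn_gt0.
have v0 : 0 <= var_stars V p r by apply: expect_variance_ge0; exact: edge_prob01.
have xv : xi ^+ 2 * var_stars V p r <= t ^+ 2.
  by apply: le_trans vt; rewrite ler_piMl// exprn_ile1// ltW.
have vW := @var_stars_lower R V r p xi r2 rn p0 px xi01.
rewrite -c3E in vW.
have vU := @var_stars_upper R V r p r0 pp lam1.
have n0 : (0 < #|V|)%N by apply: leq_trans rn.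
have N1 : 1 <= #|V|%:R :> R by rewrite ler1n.
have W1 : 1 <= #|V|%:R * (#|V|%:R * p) ^+ r * (#|V|%:R * p) ^+ r.-1.
  by rewrite !mulr_ege1 ?exprn_ege1.
(* If tau < c3 <= 1, then t^2 = tau^(2r) <= tau < c3 <= v, against v <= t^2. *)
have ctau : c3 <= tau.
  rewrite leNgt; apply/negP => h.
  have : t ^+ 2 < c3.
    rewrite tE -exprM muln2 -addnn -(prednK r0) addSn exprS.
    apply: (@le_lt_trans _ _ (tau * 1)); last by rewrite mulr1.
    rewrite ler_pM2l// exprn_ile1 ?(ltW tau0)//; lra.
  apply/negP; rewrite -leNgt; apply: le_trans vt; apply: le_trans vW.
  by rewrite ler_peMr// ltW.
have H1 := planted V p tau t rn pxi ctau tE xv Xt.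
have H2 := tilted V p t rn pxi lam1 t0 vt.
have rate0 : 0 <= upper_rate r #|V|%:R tau t * (1 - ln p).
  rewrite mulr_ge0//; first by rewrite le_max ltW.
  by have := log_inv_ge1 p01; lra.
have tv0 : 0 <= t ^+ 2 / var_stars V p r by rewrite divr_ge0 ?sqr_ge0.
have big : mean_stars V p r < K * t ->
    upper_rate r #|V|%:R tau t * (1 - ln p) <= C3 * (t ^+ 2 / var_stars V p r).
  move=> muK.
  have ct : c * (#|V|%:R * (#|V|%:R * p) ^+ r) <= t.
    have U := @mean_stars_ge R V r p r2 rn p0.
    have K0 : 0 < K by lra.
    rewrite cE mulrC ler_pdivrMr ?mulr_gt0//; apply: (le_trans U).
    by rewrite [leRHS]mulrCA ler_pM2l// mulrC ltW// mulrC.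
  apply: (le_trans (large_deviation_rate r2 c01 p01 lam1 tau0 tE ct)).
  rewrite C3E -[leRHS]mulrA ler_pM2l ?divr_gt0//.
  have v00 : 0 < var_stars V p r by apply: lt_le_trans vW; rewrite mulr_gt0//; lra.
  have l0 : 0 < (#|V|%:R * p) ^+ r.-1 by rewrite exprn_gt0//; lra.
  rewrite ler_pdivrMr// -(ler_pM2r v00).
  have -> : (r.+1 * 2 ^ r)%:R / c * (t ^+ 2 / var_stars V p r) * (#|V|%:R * p) ^+ r.-1 * var_stars V p r
     = (r.+1 * 2 ^ r)%:R * (#|V|%:R * p) ^+ r.-1 * t * (t / c) by field; rewrite !gt_eqF.
  apply: (@le_trans _ _ (t * ((r.+1 * 2 ^ r)%:R *
    (#|V|%:R * (#|V|%:R * p) ^+ r * (#|V|%:R * p) ^+ r.-1)))); first by rewrite ler_pM2l.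
  have tc : #|V|%:R * (#|V|%:R * p) ^+ r <= t / c by rewrite ler_pdivlMr// mulrC.
  have -> : t * ((r.+1 * 2 ^ r)%:R * (#|V|%:R * (#|V|%:R * p) ^+ r * (#|V|%:R * p) ^+ r.-1)) =
    (r.+1 * 2 ^ r)%:R * (#|V|%:R * p) ^+ r.-1 * t * (#|V|%:R * (#|V|%:R * p) ^+ r) by ring.
  by rewrite ler_wpM2l// !mulr_ge0// ltW.
move: H1 H2 big rate0 tv0; move: (upper_rate _ _ _ _ * _) (t ^+ 2 / _) => Q Z H1 H2 big Q0 Z0.
have [KT|KT] := leP (K * t) (mean_stars V p r).
  have [ZQ|QZ] := leP Z Q.
    apply: le_trans (H2 KT); rewrite ler_expR lerN2 ler_wpM2r// lerDr mulr_ge0 ?(ltW C10)//; lra.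
  apply: le_trans H1; rewrite ler_expR lerN2 ler_wpM2r//.
  by rewrite mulrDr mulr1 -addrA lerDl addr_ge0 ?mulr_ge0 ?(ltW C10) ?(ltW C20) ?(ltW C30).
apply: le_trans H1; rewrite ler_expR lerN2 mulrDl -mulrA.
have h := big KT.
have m0 : 0 <= Num.min Z Q by rewrite le_min Z0.
have : Q <= (1 + C3) * Num.min Z Q.
  have [ZQ|QZ] := leP Z Q; first by rewrite mulrDl mul1r ler_wpDl.
  by rewrite mulrDl mul1r lerDl mulr_ge0// ltW.
move=> /(ler_wpM2l (ltW C10)) h2; apply: (le_trans h2).
by rewrite lerDl mulr_ge0// ltW.
Qed.

End TiltedLowerBound.

(** * Assembly of both ranges *)

Lemma one_le_ln (R : realType) n : (3 <= n)%N -> 1 <= ln n%:R :> R.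
Proof.
move=> n3.
(* The sixth root is fine enough for e <= 3, since (6 / 5)^6 < 3. *)
have e6 : expR (6^-1) <= 6 / 5 :> R.
  have h : 5 / 6 <= expR (- 6^-1) :> R.
    by apply: le_trans (expR_ge1Dx _); lra.
  have := expR_gt0 (6^-1 : R); rewrite expRN in h => e0.
  rewrite -[leLHS]invrK -[leRHS]invf_div lef_pV2 ?posrE ?invr_gt0//.
have e3 : expR 1 <= 3 :> R.
  have -> : 1 = 6%:R * 6^-1 :> R by field.
  rewrite expRM_natl; apply: (@le_trans _ _ ((6 / 5) ^+ 6)).
    by apply: lerXn2r; rewrite ?nnegrE ?expR_ge0.
  lra.
rewrite -[leLHS](expRK (1 : R)) ler_ln ?posrE ?expR_gt0 ?ltr0n//; last exact: leq_trans n3.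
by apply: (le_trans e3); rewrite ler_nat.
Qed.

Lemma num_stars_complete_gt0 (V : finType) r : (0 < #|V|)%N ->
  (0 < num_stars r (complete_edges V))%N -> (r < #|V|)%N.
Proof.
move=> n0 X; rewrite ltnNge; apply: contraTN X => nr.
rewrite -leqNgt leqn0 /num_stars sum_nat_eq0.
apply/forallP => v; rewrite implyTb; apply/eqP/bin_small.
by apply: leq_ltn_trans (deg_le _ _) _; rewrite -ltnS prednK.
Qed.

Theorem theorem5 (R : realType) (r : nat) (xi : R) :
  (2 <= r)%N -> 0 < xi < 1 ->
  exists c C : R, 0 < c /\ 0 < C /\
  forall (n : nat) (p t : R),
    (1 <= n)%N -> 0 < p <= 1 - xi ->
    let X := @star_count R r n in
    let mu := gnp_mean p X in
    let sigma := Num.sqrt (gnp_var p X) in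
    let M := Num.max (t `^ (r%:R^-1)) (t / n%:R ^+ (r - 1)) in
    let L := ln (expR 1 / p) in
    let Psi := Num.min (t ^+ 2 / sigma ^+ 2) (M * L) in
    let tail := gnp_pr p (fun G => mu + t <= X G) in
    1 <= mu + t <= X (complete_graph 'I_n) ->
    (ln n%:R / n%:R <= p -> sigma <= t ->
       c * Psi <= - ln tail <= C * Psi)
    /\
    (xi <= mu -> 0 < t ->
       M * L * ln n%:R ^+ (2 * r) <= t ^+ 2 / sigma ^+ 2 ->
       c * (M * L) <= - ln tail <= C * (M * L)).
Proof.
move=> r2 xi01; have /andP[x0 x1] := xi01.
have r0 : (0 < r)%N by exact: leq_trans r2.
have x20 : 0 < xi ^+ 2 by rewrite exprn_gt0.
have x21 : xi ^+ 2 <= 1 by rewrite exprn_ile1// ltW.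
have [c1 c10 dense_up] := dense_upper_bound r2 xi01.
have [c2 c20 sparse_up] := sparse_upper_bound r2 xi01.
have [C1 C10 dense_low] := dense_lower_bound r2 xi01.
have [C2 C20 planted] := @planted_lower_bound R r xi (xi ^+ 2) r2 xi01 x20.
exists (Num.min c1 c2), (Num.max C1 C2).
split; first by rewrite lt_min c10.
split; first by rewrite lt_max C10.
move=> n p t n1 pxi X mu sigma M L Psi tail.
have /andP[p0 px] := pxi.
have p1 : p <= 1 by clear -px x0; lra.
have p01 : 0 < p <= 1 by rewrite p0.
have pp : 0 <= p <= 1 by rewrite ltW.
have XE (G : sgraph 'I_n) : X G = (num_stars r (edges G))%:R.
  by rewrite /X /star_count card_copies_star.
have muE : mu = mean_stars 'I_n p r.
  apply: etrans (@gnp_meanE R _ p X (fun A => (num_stars r A)%:R) XE) _.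
  exact: expect_num_stars.
have varE : gnp_var p X = var_stars 'I_n p r.
  rewrite /gnp_var -/mu muE /var_stars /expect_variance expect_num_stars.
  by apply: (@gnp_meanE _ _ _ _ (fun A => ((num_stars r A)%:R - mean_stars 'I_n p r) ^+ 2)) => G; rewrite XE.
have v0 : 0 <= var_stars 'I_n p r by apply: expect_variance_ge0; exact: edge_prob01.
have sE : sigma ^+ 2 = var_stars 'I_n p r by rewrite /sigma varE sqr_sqrtr.
have tailE : tail = upper_tail 'I_n p r t.
  rewrite /tail muE.
  by apply: (@gnp_prE _ _ _ _ (fun A => mean_stars 'I_n p r + t <= (num_stars r A)%:R)) => G; rewrite XE.
have LE : L = 1 - ln p by rewrite /L ln_div ?posrE ?expR_gt0// expRK.
have cI : #|'I_n| = n by rewrite card_ord.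
rewrite XE muE => /andP[low high].
(* The complete graph contains a star because 1 <= mu + t <= X(K_n). Hence n > r >= 2 and ln n >=
   1. *)
have rn : (r < #|'I_n|)%N.
  apply: num_stars_complete_gt0; first by rewrite cI.
  by rewrite -(ltr_nat R); apply: lt_le_trans high; apply: lt_le_trans low.
have n3 : (3 <= n)%N by rewrite -cI; apply: leq_trans rn.
have l1 : 1 <= ln n%:R :> R := one_le_ln R n3.
have n0 : 0 < n%:R :> R by rewrite ltr0n.
have L1 : 1 <= L by rewrite LE log_inv_ge1.
pose tau := t `^ (r%:R^-1).
have ME : M = upper_rate r n%:R tau t by rewrite /M /upper_rate subn1.
have tauE : 0 < t -> 0 < tau /\ t = tau ^+ r.
  move=> t0; split; first exact: powR_gt0.
  rewrite -powR_mulrn ?powR_ge0// -powRrM mulVf ?powRr1 ?(ltW t0)//.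
  by rewrite pnatr_eq0 -lt0n.
have finish c C Q : Num.min c1 c2 <= c -> C <= Num.max C1 C2 -> 0 <= Q ->
    upper_tail 'I_n p r t <= expR (- (c * Q)) ->
    expR (- (C * Q)) <= upper_tail 'I_n p r t ->
    Num.min c1 c2 * Q <= - ln tail <= Num.max C1 C2 * Q.
  move=> cc CC Q0 up lo; rewrite tailE.
  have T0 : 0 < upper_tail 'I_n p r t by apply: lt_le_trans lo; exact: expR_gt0.
  apply/andP; split.
    apply: (@le_trans _ _ (c * Q)); first by rewrite ler_wpM2r.
    by rewrite lerNr -[leRHS]expRK ler_ln ?posrE ?expR_gt0.
  apply: (@le_trans _ _ (C * Q)); last by rewrite ler_wpM2r.
  by rewrite lerNl -[leLHS]expRK ler_ln ?posrE ?expR_gt0.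
have M0 : 0 < t -> 0 <= M * L.
  move=> t0; rewrite mulr_ge0//; last by apply: le_trans L1.
  by rewrite /M le_max powR_ge0.
have vmean := @var_stars_mean R 'I_n r p xi r2 p0 px xi01.
have mean0 : 0 < mean_stars 'I_n p r.
  rewrite /mean_stars mulr_gt0 ?exprn_gt0// ltr0n muln_gt0 bin_gt0.
  by rewrite (leq_trans _ rn)//= -ltnS prednK// (leq_trans _ rn).
have vpos : 0 < var_stars 'I_n p r by apply: lt_le_trans vmean; exact: mulr_gt0.
split=> [pn st|xmu t0 big].
  have s0 : 0 < sigma by rewrite /sigma sqrtr_gt0 varE.
  have t0 : 0 < t by apply: lt_le_trans st.
  have [tau0 tE] := tauE t0.
  have vt : var_stars 'I_n p r <= t ^+ 2.
    by rewrite -sE; apply: lerXn2r; rewrite ?nnegrE ?(ltW s0) ?(ltW t0).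
  have lN : ln n%:R <= n%:R * p by rewrite mulrC -ler_pdivrMr.
  rewrite /Psi sE ME LE; apply: (finish c1 C1).
  - by rewrite ge_min lexx.
  - by rewrite le_max lexx.
  - by rewrite le_min divr_ge0 ?sqr_ge0//= -ME -LE M0.
  - have := dense_up 'I_n p tau t rn pxi tau0 tE; rewrite cI; apply=> //.
    by apply: le_trans vt; rewrite ler_piMl.
  - have := dense_low 'I_n p tau t rn pxi; rewrite cI; apply=> //.
    exact: le_trans lN.
have [tau0 tE] := tauE t0.
have tQ : var_stars 'I_n p r * (M * L * ln n%:R ^+ (2 * r)) <= t ^+ 2.
  by rewrite mulrC -ler_pdivlMr// -sE.
have tM : tau <= M * L.
  apply: (@le_trans _ _ M); first by rewrite /M le_max lexx.
  by rewrite ler_peMr// /M le_max powR_ge0.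
have MLl : M * L <= M * L * ln n%:R ^+ (2 * r).
  by rewrite ler_peMr ?M0// exprn_ege1.
have x2v : xi ^+ 2 <= var_stars 'I_n p r.
  by apply: le_trans vmean; rewrite expr2 ler_pM2l// -muE.
(* From v >= xi^2 and M L >= tau one gets xi^2 tau <= t^2 = tau^(2r); tau < xi^2 <= 1 would
   contradict tau^(2r-1) <= tau. *)
have ctau : xi ^+ 2 <= tau.
  rewrite leNgt; apply/negP => h.
  have tau1 : tau <= 1 by apply: le_trans x21; exact: ltW.
  have : xi ^+ 2 * tau <= t ^+ 2.
    apply: le_trans tQ; apply: ler_pM; rewrite ?(ltW x20) ?(ltW tau0)//.
    exact: le_trans MLl.
  apply/negP; rewrite -ltNge tE -exprM muln2 -addnn -(prednK r0) addSn exprS [ltRHS]mulrC.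
  rewrite ltr_pM2l//; apply: le_lt_trans h.
  rewrite addnS exprS ler_piMr ?(ltW tau0)//.
  by apply: exprn_ile1 => //; exact: ltW.
(* Statement (ii) does not assume t >= sigma; mu >= xi yields this weaker form, which is the
   hypothesis of the upper bounds and of planting. *)
have xvt : xi ^+ 2 * var_stars 'I_n p r <= t ^+ 2.
  apply: le_trans tQ; rewrite mulrC ler_wpM2l//.
  by apply: le_trans MLl; apply: le_trans tM.
have low_bound : expR (- (C2 * (M * L))) <= upper_tail 'I_n p r t.
  have := planted 'I_n p tau t rn pxi ctau tE xvt high.
  by rewrite cI -ME -LE.
(* For n p >= ln n the bound with the minimum applies, and the hypothesis of (ii) makes M L the
   smaller term. *)
have [dense|sparse] := leP (ln n%:R) (n%:R * p).
  apply: (finish c1 C2) => //; rewrite ?ge_min ?le_max ?lexx ?orbT ?M0//.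
  have := dense_up 'I_n p tau t rn pxi tau0 tE; rewrite cI /= -ME -LE min_r; first exact.
  by rewrite ler_pdivlMr// mulrC; apply: le_trans tQ; rewrite ler_wpM2l.
apply: (finish c2 C2) => //; rewrite ?ge_min ?le_max ?lexx ?orbT ?M0//.
have := sparse_up 'I_n p tau t rn pxi tau0 tE; rewrite cI /= -ME -LE; apply=> //.
exact: ltW.
Qed.
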